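(* Let $(I_\alpha)_{\alpha\in\Gamma}$ be a finite family of $\{0,1\}$-valued random variables, and suppose that for each $\alpha\in\Gamma$ there are $\{0,1\}$-valued random variables $(J_{\beta\alpha})_{\beta\in\Gamma}$ on the same probability space with $\mathcal L(J_{\beta\alpha},\beta\in\Gamma\mid I_\alpha=1)=\mathcal L(I_\beta,\beta\in\Gamma)$. Let $\Gamma=\Gamma_1\uplus\Gamma_2$, $\Gamma_1=\biguplus_{j=1}^d\Gamma_{1j}$, $\Gamma_2=\biguplus_{j=1}^r\Gamma_{2j}$, $p_\alpha=\mathbb EI_\alpha$, and for positive constants $s_j$ set $W_{1j}=s_j^{-1}\sum_{\alpha\in\Gamma_{1j}}(I_\alpha-p_\alpha)$, $W_{2j}=\sum_{\alpha\in\Gamma_{2j}}I_\alpha$, $W_1=(W_{1j})_{j\le d}$, $W_2=(W_{2j})_{j\le r}$. Let $\Sigma=\mathrm{Cov}(W_1)$, $\lambda_j=\mathbb EW_{2j}$, assume all $\lambda_j>0$, and let $Z\sim\mathcal N_d(0,\Sigma)$, $N\sim\prod_j\mathrm{Po}(\lambda_j)$ be independent. Then for every $h\in\mathcal H_3$, $$\begin{aligned}|\mathbb Eh(W_1,W_2)-\mathbb Eh(Z,N)|\le&\sum_{j,k=1}^d\frac{\|\partial_{jk}f_h\|}{s_js_k}\sqrt{\mathrm{Var}\Big(\mathbb E\Big[\sum_{\alpha\in\Gamma_{1j}}I_\alpha\sum_{\beta\in\Gamma_{1k}}(I_\beta-J_{\beta\alpha})\,\Big|\,W_1,W_2\Big]\Big)}\\&+\frac12\sum_{j,k,\ell=1}^d\frac{\|\partial_{jk\ell}f_h\|}{s_js_ks_\ell}\sum_{\alpha\in\Gamma_{1j}}\mathbb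 E\Big|I_\alpha\sum_{\beta\in\Gamma_{1k}}(I_\beta-J_{\beta\alpha})\sum_{\gamma\in\Gamma_{1\ell}}(I_\gamma-J_{\gamma\alpha})\Big|\\&+\sum_{j=1}^d\sum_{k=1}^r\frac{\|\Delta_k(\partial_jf_h)\|}{s_j}\sum_{\alpha\in\Gamma_{1j}}\mathbb E\Big|I_\alpha\sum_{\beta\in\Gamma_{2k}}(I_\beta-J_{\beta\alpha})\Big|\\&+2\sum_{k=1}^r\sum_{j=1}^d\frac{\|\Delta_k(\partial_jf_h)\|}{s_j}\sum_{\alpha\in\Gamma_{2k}}\mathbb E\Big|I_\alpha\sum_{\beta\in\Gamma_{1j}}(I_\beta-J_{\beta\alpha})\Big|\\&+2\max_{1\le j,k\le r}\|\Delta_{jk}f_h\|\Big(\sum_{\alpha\in\Gamma_2}p_\alpha^2+\sum_{\alpha\in\Gamma_2}\sum_{\beta\in\Gamma_2\setminus\{\alpha\}}\mathbb E[I_\alpha|I_\beta-J_{\beta\alpha}|]\Big).\end{aligned}$$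
   Context: The conditional law given $I_\alpha=1$ is understood as a regular conditional distribution (meaningful even if $p_\alpha=0$). $\mathcal C_3=\{g\in C_b^3(\mathbb R^d):|g|_{\rm Lip}\vee|g|_2\vee|g|_3\le1\}$ ($|g|_k$ = max sup norm of $k$-th order partials), $\mathcal H_3=\{h:\mathbb R^d\times\mathbb Z_+^r\to\mathbb R:\sup|h|\le1,\ h(\cdot,y)\in\mathcal C_3\ \forall y\}$. With $\Sigma,\lambda$ as in the claim: $S_sh(x,y)=\mathbb Eh(\sqrt{1-s}x+\sqrt sZ,y)$, $p_s(y,z)=\prod_j\sum_{k=0}^{y_j\wedge z_j}\binom{y_j}k(1-s)^ks^{y_j-k}(\lambda_js)^{z_j-k}e^{-\lambda_js}/(z_j-k)!$, $T_sh(x,y)=\sum_{z\in\mathbb Z_+^r}S_sh(x,z)p_s(y,z)$, $f_h(x,y)=-\int_0^1\frac{1}{2(1-s)}[T_sh(x,y)-\mathbb Eh(Z,N)]ds$. $\partial_j$ are $x$-derivatives with $y$ fixed, $\Delta_kf(x,y)=f(x,y+e_k)-f(x,y)$, $\Delta_{jk}=\Delta_j\Delta_k$, and $\|\cdot\|$ is the supremum over $\mathbb R^d\times\mathbb Z_+^r$. *)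

(* Defs.v *)
From HB Require Import structures.
From mathcomp Require Import all_boot all_order all_algebra.
From mathcomp Require Import all_classical all_reals all_analysis.
Set Implicit Arguments.
Unset Strict Implicit.
Unset Printing Implicit Defensive.
Import Order.TTheory GRing.Theory Num.Theory.
Import numFieldNormedType.Exports.
Local Open Scope classical_set_scope.
Local Open Scope ring_scope.

Definition rseries {R : realType} (u : nat -> R) : R :=
  limn (fun n => \sum_(i < n) u i).

Definition Rint {R : realType} (A : set R) (f : R -> R) : R :=
  fine (\int[@lebesgue_measure R]_(t in A) (f t)%:E).

Definition phi01 {R : realType} (t : R) : R :=
  expR (- (t ^+ 2) / 2) / Num.sqrt (2 * pi).

Definition poisson_pmf {R : realType} (lam : R) (n : nat) : R :=
  expR (- lam) * lam ^+ n / (n `!)%:R.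

Definition upd {I : eqType} {V : Type} (b : I -> V) (j : I) (v : V) : I -> V :=
  fun i => if i == j then v else b i.

(* iterated (one coordinate at a time) standard-Gaussian integral:
   gaussIter l g b = E g(b with the coordinates in l replaced by iid N(0,1)) *)
Fixpoint gaussIter {R : realType} {I : eqType} (l : seq I)
    (g : (I -> R) -> R) (b : I -> R) : R :=
  match l with
  | [::] => g b
  | j :: l' => Rint setT (fun t => phi01 t * gaussIter l' g (upd b j t))
  end.

Fixpoint serIter {R : realType} {I : eqType} (l : seq I)
    (w : I -> nat -> R) (g : (I -> nat) -> R) (b : I -> nat) : R :=
  match l with
  | [::] => g b
  | j :: l' => rseries (fun n => w j n * serIter l' w g (upd b j n))
  end.

Definition stdGaussE {R : realType} (d : nat) (g : 'rV[R]_d -> R) : R :=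
  gaussIter (enum 'I_d) (fun b => g (\row_i b i)) (fun _ => 0).

Definition sqrtmx {R : realType} (d : nat) (Sigma : 'M[R]_d) : 'M[R]_d :=
  xget 0 [set A : 'M[R]_d | A^T *m A = Sigma].

(* E g(Z) for Z ~ N_d(0, Sigma): Z = G A with G standard, A^T A = Sigma *)
Definition gaussE {R : realType} (d : nat) (Sigma : 'M[R]_d)
    (g : 'rV[R]_d -> R) : R :=
  stdGaussE (fun u => g (u *m sqrtmx Sigma)).

Definition prodSeries {R : realType} (r : nat) (w : 'I_r -> nat -> R)
    (g : ('I_r -> nat) -> R) : R :=
  serIter (enum 'I_r) w g (fun _ => 0%N).

Definition pd {R : realType} {d : nat} (j : 'I_d) (g : 'rV[R]_d -> R)
    : 'rV[R]_d -> R :=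
  fun x => 'D_(delta_mx 0 j) g x.

Definition eucl {R : realType} {d : nat} (x : 'rV[R]_d) : R :=
  Num.sqrt (\sum_(i < d) x 0 i ^+ 2).

Definition C3 {R : realType} {d : nat} (g : 'rV[R]_d -> R) : Prop :=
  [/\ (exists M : R, forall x, `|g x| <= M),
      (forall x, differentiable g x),
      (forall j x, differentiable (pd j g) x),
      (forall j k x, differentiable (pd j (pd k g)) x) &
      (forall j k l, continuous (pd j (pd k (pd l g))))] /\
  [/\ (forall x x', `|g x - g x'| <= eucl (x - x')),
      (forall j k x, `|pd j (pd k g) x| <= 1) &
      (forall j k l x, `|pd j (pd k (pd l g)) x| <= 1)].

Definition H3 {R : realType} {d r : nat}
    (h : 'rV[R]_d -> ('I_r -> nat) -> R) : Prop :=
  (forall x y, `|h x y| <= 1) /\ (forall y, C3 (fun x => h x y)).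

Definition supn {R : realType} {d r : nat}
    (F : 'rV[R]_d -> ('I_r -> nat) -> R) : \bar R :=
  ereal_sup [set z | exists x y, z = (`|F x y|)%:E].

Definition pdx {R : realType} {d r : nat} (j : 'I_d)
    (F : 'rV[R]_d -> ('I_r -> nat) -> R) : 'rV[R]_d -> ('I_r -> nat) -> R :=
  fun x y => pd j (fun x' => F x' y) x.

Definition Dk {R : realType} {d r : nat} (k : 'I_r)
    (F : 'rV[R]_d -> ('I_r -> nat) -> R) : 'rV[R]_d -> ('I_r -> nat) -> R :=
  fun x y => F x (fun i => (y i + (i == k))%N) - F x y.

Definition qs {R : realType} (lam s : R) (a b : nat) : R :=
  \sum_(k < (minn a b).+1)
     ('C(a, k))%:R * (1 - s) ^+ k * s ^+ (a - k) *
     (lam * s) ^+ (b - k) * expR (- (lam * s)) / ((b - k)`!)%:R.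

Definition EhZN {R : realType} {d r : nat} (Sigma : 'M[R]_d) (lam : 'I_r -> R)
    (h : 'rV[R]_d -> ('I_r -> nat) -> R) : R :=
  prodSeries (fun j n => poisson_pmf (lam j) n) (fun y => gaussE Sigma (h^~ y)).

Definition Ss {R : realType} {d r : nat} (Sigma : 'M[R]_d) (s : R)
    (h : 'rV[R]_d -> ('I_r -> nat) -> R) (x : 'rV[R]_d) (y : 'I_r -> nat) : R :=
  gaussE Sigma (fun z => h (Num.sqrt (1 - s) *: x + Num.sqrt s *: z) y).

Definition Ts {R : realType} {d r : nat} (Sigma : 'M[R]_d) (lam : 'I_r -> R)
    (s : R) (h : 'rV[R]_d -> ('I_r -> nat) -> R)
    (x : 'rV[R]_d) (y : 'I_r -> nat) : R :=
  prodSeries (fun j n => qs (lam j) s (y j) n) (fun z => Ss Sigma s h x z).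

Definition fh {R : realType} {d r : nat} (Sigma : 'M[R]_d) (lam : 'I_r -> R)
    (h : 'rV[R]_d -> ('I_r -> nat) -> R) (x : 'rV[R]_d) (y : 'I_r -> nat) : R :=
  - Rint `[0, 1] (fun s => (2 * (1 - s))^-1 *
                           (Ts Sigma lam s h x y - EhZN Sigma lam h)).

Definition Ex {R : realType} {dT : measure_display} {T : measurableType dT}
    (P : probability T R) (X : T -> R) : R :=
  fine (\int[P]_w (X w)%:E).

Definition Prb {R : realType} {dT : measure_display} {T : measurableType dT}
    (P : probability T R) (A : set T) : R := fine (P A).

(* (a version of) E[X | V] for a random variable V taking finitely many
   values:  E[X | V](w) = E[X 1{V = V w}] / P(V = V w) *)
Definition condE {R : realType} {dT : measure_display} {T : measurableType dT}
    {K : Type} (P : probability T R) (X : T -> R) (V : T -> K) : T -> R :=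
  fun w => fine (\int[P]_(w' in [set w' | V w' = V w]) (X w')%:E)
           / Prb P [set w' | V w' = V w].

Definition Var {R : realType} {dT : measure_display} {T : measurableType dT}
    (P : probability T R) (X : T -> R) : R :=
  Ex P (fun w => (X w - Ex P X) ^+ 2).

Definition Cov {R : realType} {dT : measure_display} {T : measurableType dT}
    (P : probability T R) (X Y : T -> R) : R :=
  Ex P (fun w => (X w - Ex P X) * (Y w - Ex P Y)).

Definition b2r {R : realType} (b : bool) : R := (b : nat)%:R.

(* Main.v *)
(* Stein's method. Along the semigroup s |-> T_s h, which joins h (s = 0) to
   E h(Z, N) (s = 1), Gaussian integration by parts and summation by parts
   against the thinned Poisson kernel give the s-derivative; integrating it over
   [0, 1] shows that f = f_h solves
     sum_jl Sigma_jl f_jl - sum_j x_j f_j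
       + 2 sum_k (lambda_k Delta_k f (x, y) - y_k Delta_k f (x, y - e_k))
     = h - E h(Z, N).
   Differentiating f costs a factor (1 - s)^(-1/2) at most, which is integrable,
   so f is three times differentiable in x.  Evaluating the equation at (W_1, W_2),
   the coupling turns each E[(I_a - p_a) G(W)] into
   E[I_a (G(W) - G(W^a))], with W^a built from the J_{b a}.  The five terms of
   the bound are: the fluctuation of the linear term of the Taylor expansion of
   d_j f in x, its second-order remainder, the change of the counts W_2, and, for
   the Poisson part, the change of W_1 and the change of W_2. *)
Require Import Defs.
From HB Require Import structures.
From mathcomp Require Import all_boot all_order all_algebra.
From mathcomp Require Import all_classical all_reals all_analysis.
From mathcomp Require Import measurable_realfun.
From mathcomp Require Import ring lra zify.
Import Order.TTheory GRing.Theory Num.Theory.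
Import numFieldNormedType.Exports.
Local Open Scope classical_set_scope.
Local Open Scope ring_scope.
(** * One-variable calculus *)

Section RealDerivatives.
Context {R : realType}.
Set Implicit Arguments.
Unset Strict Implicit.
Implicit Types (f g : R -> R) (x a b c : R).

(** The sup norms in the bound are extended reals, with 0 * +oo = 0. Hence no estimate of f_h
    uniform in (x, y) is required, and the constants that dominate the thinned Poisson kernel may
    depend on y. In return, increments are bounded coordinate by coordinate, so that an infinite
    norm never meets a vanishing displacement. The weight (2 (1 - s))^(-1) is not integrable. For
    f_h itself it is tamed by T_s h - E h(Z, N) = O((1 - s)^(1/2)), for derivatives by powers of (1
    - s)^(1/2) gained from T_s. The Stein equation is then the integral of d/ds T_s h, term by term.
    The size-bias identity applied to W_1 itself gives Sigma_jl = E X_jl / (s_j s_l). The linear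
    Taylor term therefore enters as a covariance between X_jl and d_jl f(W), and conditioning on W
    before taking absolute values leaves the variance of a conditional expectation. This requires
    d_jl f to be evaluated exactly at (W_1, W_2), so x is moved first, with the counts frozen.
    Everything random is a function of finitely many indicators, which allows the probability space
    to be replaced by a finite set of configurations. *)

Lemma is_derive1M f g x a b : is_derive x 1 f a -> is_derive x 1 g b ->
  is_derive x 1 (fun t => f t * g t) (a * g x + f x * b).
Proof.
move=> df dg; apply: (is_derive_eq (is_deriveM df dg)).
by rewrite /GRing.scale/= addrC mulrC (mulrC (f x)) mulrC.
Qed.

Lemma is_derive1D f g x a b : is_derive x 1 f a -> is_derive x 1 g b ->
  is_derive x 1 (fun t => f t + g t) (a + b).
Proof. by move=> df dg; exact: is_deriveD. Qed.

Lemma is_derive1Z f x a c : is_derive x 1 f a ->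
  is_derive x 1 (fun t => c * f t) (c * a).
Proof. by move=> df; exact: is_deriveZ. Qed.

Lemma is_derive1_id x : is_derive x 1 (fun t : R => t) 1.
Proof. exact: is_derive_id. Qed.

Lemma is_derive1_cst c x : is_derive x 1 (fun=> c) 0.
Proof. exact: is_derive_cst. Qed.

Lemma is_derive1X f n x a : is_derive x 1 f a ->
  is_derive x 1 (fun t => f t ^+ n) (n%:R * f x ^+ n.-1 * a).
Proof.
move=> df; elim: n => [|n IH].
  under eq_fun do rewrite expr0.
  by rewrite !mul0r; exact: is_derive1_cst.
under eq_fun do rewrite exprS.
apply: is_derive_eq (is_derive1M df IH) _.
case: n {IH} => [|n] /=; first by rewrite !expr0; ring.
by rewrite !exprS -[n.+2%:R]natr1; ring.
Qed.

Lemma is_derive1_continuous f x a : is_derive x 1 f a -> {for x, continuous f}.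
Proof.
move=> /@ex_derive df; apply: differentiable_continuous.
exact/derivable1_diffP.
Qed.

End RealDerivatives.

(** * Iterated Gaussian integrals *)

Section Gaussian.
Context {R : realType}.
Set Implicit Arguments.
Unset Strict Implicit.
Notation mu := (@lebesgue_measure R).
Notation Rint := Defs.Rint.

Lemma phi01E : @phi01 R = normal_pdf 0 1.
Proof.
apply/funext => t; rewrite normal_pdfE ?oner_neq0// /phi01 /normal_peak /normal_fun.
by rewrite mulrC subr0 expr1n mul1r mulr_natl.
Qed.

Lemma phi01_ge0 (t : R) : 0 <= phi01 t.
Proof. by rewrite phi01E normal_pdf_ge0. Qed.

Lemma phi01_continuous : continuous (@phi01 R).
Proof. by rewrite phi01E; apply: continuous_normal_pdf; exact: oner_neq0. Qed.

Lemma Rint_phi01 : Rint setT (@phi01 R) = 1.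
Proof. by rewrite /Rint phi01E integral_normal_pdf. Qed.

(** A normal density of standard deviation 2 absorbs the linear factor, so integrability comes from
    [normal_pdf 0 2]. *)
Lemma phi01_env_le : exists C : R, forall t,
  phi01 t * (1 + `|t|) <= C * normal_pdf 0 2 t.
Proof.
have p2 : 0 < @normal_peak R 2 by apply: normal_peak_gt0; rewrite pnatr_eq0.
have p1 : 0 < @normal_peak R 1 by apply: normal_peak_gt0; rewrite oner_neq0.
exists (2 * normal_peak 1 / normal_peak 2) => t.
rewrite phi01E !normal_pdfE ?oner_neq0 ?pnatr_eq0// /normal_fun !subr0.
(* The exponent 3/8 is the gap 1/2 - 1/8 between the two Gaussian exponents. *)
have h1 : 1 + `|t| <= 2 * expR (3 * t ^+ 2 / 8).
  apply: (@le_trans _ _ (2 * (1 + 3 * t ^+ 2 / 8))); last first.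
    by rewrite ler_pM2l// expR_ge1Dx.
  by rewrite -real_normK ?num_real//; nra.
have -> : - t ^+ 2 / (2 ^+ 2 *+ 2) = - t ^+ 2 / (1 ^+ 2 *+ 2) + (3 * t ^+2 / 8).
  by field.
rewrite expRD.
rewrite (_ : _ / _ * _ = normal_peak 1 * expR (- t ^+ 2 / (1 ^+ 2 *+ 2)) * (2 * expR (3 * t ^+ 2 / 8))).
  by rewrite ler_pM2l// mulr_gt0// expR_gt0.
by field; rewrite gt_eqF.
Qed.

Lemma integrable_phi01_env :
  mu.-integrable setT (EFin \o (fun t => phi01 t * (1 + `|t|))).
Proof.
have [C HC] := phi01_env_le.
have hi : mu.-integrable setT (EFin \o (fun t : R => C * normal_pdf 0 2 t)).
  rewrite /comp; under eq_fun do rewrite EFinM.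
  by apply: integrableZl => //; exact: integrable_normal_pdf.
apply: le_integrable hi => //.
- apply/measurable_EFinP; apply: measurable_funM.
    by apply: continuous_measurable_fun; exact: phi01_continuous.
  by apply: measurable_funD => //; exact: measurableT_comp.
- move=> t _; rewrite /= lee_fin.
  rewrite ger0_norm; last by rewrite mulr_ge0 ?phi01_ge0// addr_ge0.
  exact: le_trans (HC t) (ler_norm _).
Qed.

Lemma integrable_phi01 M (K : R -> R) : measurable_fun setT K ->
  (forall t, `|K t| <= M * (1 + `|t|)) ->
  mu.-integrable setT (EFin \o (fun t => phi01 t * K t)).
Proof.
move=> mK bK.
have hi : mu.-integrable setT (EFin \o (fun t : R => M * (phi01 t * (1 + `|t|)))).
  rewrite /comp; under eq_fun do rewrite EFinM.
  by apply: integrableZl => //; exact: integrable_phi01_env.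
apply: le_integrable hi => //.
- apply/measurable_EFinP; apply: measurable_funM => //.
  by apply: continuous_measurable_fun; exact: phi01_continuous.
- move=> t _; rewrite /= lee_fin normrM ger0_norm ?phi01_ge0// mulrCA.
  apply: (@le_trans _ _ (phi01 t * (M * (1 + `|t|)))).
    by rewrite ler_wpM2l ?phi01_ge0.
  exact: ler_norm.
Qed.

Lemma updid (J : eqType) (V : Type) (b : J -> V) i x y :
  upd (upd b i x) i y = upd b i y.
Proof. by apply/funext => k; rewrite /upd; case: eqP. Qed.

Lemma updC (J : eqType) (V : Type) (b : J -> V) i j x y : i != j ->
  upd (upd b i x) j y = upd (upd b j y) i x.
Proof.
move=> ij; apply/funext => k; rewrite /upd.
by case: (eqVneq k j) => // ->; rewrite eq_sym (negbTE ij).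
Qed.

Lemma upd_same (J : eqType) (V : Type) (b : J -> V) i : upd b i (b i) = b.
Proof. by apply/funext => k; rewrite /upd; case: eqP => [->|]. Qed.

Context {J : finType}.
Implicit Types (g : (J -> R) -> R) (b : J -> R) (l : seq J).

Definition env b : R := 1 + \sum_i `|b i|.

(** Linear growth, because Gaussian integration by parts involves [b i * g b] with [g] bounded.
    Continuity is asked one coordinate at a time, as only one coordinate is integrated at a time. *)
Definition lingrowth M g :=
  (forall b j, continuous (fun t => g (upd b j t))) /\
  (forall b, `|g b| <= M * env b).

Lemma env_ge0 b : 0 <= env b.
Proof. by rewrite addr_ge0// sumr_ge0. Qed.

Lemma env_upd b j t : env (upd b j t) <= (1 + `|t|) * env b.
Proof.
rewrite /env (bigD1 j)//= [X in _ <= _ * (1 + X)](bigD1 j)//=.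
rewrite (_ : upd b j t j = t); last by rewrite /upd eqxx.
rewrite (eq_bigr (fun i => `|b i|)); last first.
  by move=> i /negbTE ij; rewrite /upd ij.
set S := \sum_(i | _) _.
have S0 : 0 <= S by rewrite sumr_ge0.
have := normr_ge0 t; have := normr_ge0 (b j); nra.
Qed.

Lemma lingrowth_ge0 M g : lingrowth M g -> 0 <= M.
Proof.
move=> [_ /(_ (fun _ => 0))]; rewrite /env big1 ?addr0 ?mulr1; last by move=> ? _; rewrite normr0.
exact: le_trans.
Qed.

Lemma lingrowth_upd M g b j t : lingrowth M g ->
  `|g (upd b j t)| <= M * env b * (1 + `|t|).
Proof.
move=> Hg; apply: le_trans (Hg.2 _) _.
by rewrite -mulrA ler_wpM2l ?(lingrowth_ge0 Hg)// mulrC env_upd.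
Qed.

Lemma lingrowth_integrable M g b j : lingrowth M g ->
  mu.-integrable setT (EFin \o (fun t => phi01 t * g (upd b j t))).
Proof.
move=> Hg; apply: (@integrable_phi01 (M * env b)).
  by apply: continuous_measurable_fun; exact: Hg.1.
by move=> t; exact: lingrowth_upd.
Qed.

Lemma lingrowth_lin M N g k (c : R) : lingrowth M g -> lingrowth N k ->
  lingrowth (`|c| * M + N) (fun b => c * g b + k b).
Proof.
move=> [cg bg] [ck bk]; split.
  move=> b j t; apply: cvgD; last exact: ck.
  by apply: cvgMl_tmp; exact: cg.
move=> b; rewrite mulrDl; apply: le_trans (ler_normD _ _) _.
by rewrite lerD// normrM -mulrA ler_wpM2l.
Qed.

Lemma lingrowthW M N g : M <= N -> lingrowth M g -> lingrowth N g.
Proof.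
move=> MN [cg bg]; split => // b; apply: le_trans (bg b) _.
by rewrite ler_wpM2r// env_ge0.
Qed.

(** This is 1 + E|G| for a standard normal G: the factor by which one integration enlarges a growth
    constant. *)
Definition phic : R := Rint setT (fun t => phi01 t * (1 + `|t|)).

Lemma Rint_phi01_bound (K : R -> R) M : measurable_fun setT K ->
  (forall t, `|K t| <= M * (1 + `|t|)) ->
  `|Rint setT (fun t => phi01 t * K t)| <= M * phic.
Proof.
move=> mK bK.
have iK := integrable_phi01 mK bK.
apply: le_trans (le_normr_Rintegral measurableT iK) _.
rewrite /phic [Rint _ _](_ : _ = \int[mu]_(t in setT) (phi01 t * (1 + `|t|)))//.
rewrite -RintegralZl//; last exact: integrable_phi01_env.
apply: le_Rintegral => //.
- by have := integrable_norm iK; apply: eq_integrable => // t _ /=.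
- rewrite /comp; under eq_fun do rewrite EFinM.
  by apply: integrableZl => //; exact: integrable_phi01_env.
- move=> t _; rewrite normrM ger0_norm ?phi01_ge0// mulrCA.
  by rewrite ler_wpM2l ?phi01_ge0.
Qed.

Lemma Rint_phi01_continuous (f : R -> R -> R) (M u v : R) :
  (forall x, x \in `]u, v[ -> measurable_fun setT (f x)) ->
  (forall x t, x \in `]u, v[ -> `|f x t| <= M * (1 + `|t|)) ->
  (forall x t, x \in `]u, v[ -> {for x, continuous (f ^~ t)}) ->
  forall x, x \in `]u, v[ ->
    {for x, continuous (fun x => Rint setT (fun t => phi01 t * f x t))}.
Proof.
move=> mf bf cf x xuv.
have := @continuity_under_integral R _ _ mu (fun x t => phi01 t * f x t) setT
   measurableT u v _ _ (fun t => M * (phi01 t * (1 + `|t|))).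
apply => //.
- by move=> y yuv; apply: (@integrable_phi01 M); [apply: mf|move=> t; apply: bf].
- apply/aeW => t _ y /set_mem yuv; apply: cvgM; first exact: cvg_cst.
  exact: cf.
- rewrite /comp; under eq_fun do rewrite EFinM.
  by apply: integrableZl => //; exact: integrable_phi01_env.
- move=> y yuv; apply/aeW => t _.
  rewrite normrM ger0_norm ?phi01_ge0// mulrCA.
  by rewrite ler_wpM2l ?phi01_ge0// bf.
- exact: mem_set.
Qed.

Lemma Rint_phi01_derive (f f' : R -> R -> R) (M u v : R) :
  (forall x, x \in `]u, v[ -> measurable_fun setT (f x)) ->
  (forall x t, x \in `]u, v[ -> `|f x t| <= M * (1 + `|t|)) ->
  (forall x t, x \in `]u, v[ -> `|f' x t| <= M * (1 + `|t|)) ->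
  (forall x t, x \in `]u, v[ -> is_derive x 1 (f ^~ t) (f' x t)) ->
  forall x, x \in `]u, v[ ->
    is_derive x 1 (fun x => Rint setT (fun t => phi01 t * f x t))
                  (Rint setT (fun t => phi01 t * f' x t)).
Proof.
move=> mf bf bf' df x xuv.
pose F (x : R) (t : R) := phi01 t * f x t.
have dF y t : y \in `]u, v[ -> is_derive y 1 (F ^~ t) (phi01 t * f' y t).
  by move=> yuv; have := df y t yuv => ?; exact: is_deriveZ.
have d1F y t : y \in `]u, v[ -> partial1of2 F y t = phi01 t * f' y t.
  by move=> yuv; rewrite partial1of2E; have /@derive_val := dF y t yuv.
have iF y : y \in `]u, v[ -> mu.-integrable setT (EFin \o F y).
  by move=> yuv; apply: (@integrable_phi01 M); [apply: mf|move=> t; apply: bf].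
have derF y t : y \in `]u, v[ -> setT t -> derivable (F ^~ t) y 1.
  by move=> yuv _; have /@ex_derive := dF y t yuv.
pose G (t : R) := `|M| * (phi01 t * (1 + `|t|)).
have G0 t : 0 <= G t by rewrite !mulr_ge0 ?phi01_ge0// addr_ge0.
have iG : mu.-integrable setT (EFin \o G).
  rewrite /comp; under eq_fun do rewrite EFinM.
  by apply: integrableZl => //; exact: integrable_phi01_env.
have Gub y t : y \in `]u, v[ -> setT t -> `|partial1of2 F y t| <= G t.
  move=> yuv _; rewrite d1F// normrM ger0_norm ?phi01_ge0// /G mulrCA.
  rewrite ler_wpM2l ?phi01_ge0//; apply: le_trans (bf' _ _ yuv) _.
  by rewrite ler_wpM2r ?addr_ge0// ler_norm.
have D1 := derivable_under_integral measurableT xuv iF derF G0 iG Gub.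
have D2 := differentiation_under_integral measurableT xuv iF derF G0 iG Gub.
apply: DeriveDef => //; rewrite -derive1E D2.
by apply: eq_Rintegral => t _; rewrite d1F.
Qed.

Lemma lingrowth_step M g j : lingrowth M g ->
  lingrowth (M * phic) (fun b => Rint setT (fun t => phi01 t * g (upd b j t))).
Proof.
move=> Hg; have M0 := lingrowth_ge0 Hg; split => [b i x|b]; last first.
  rewrite mulrAC; apply: Rint_phi01_bound; last by move=> t; exact: lingrowth_upd.
  by apply: continuous_measurable_fun; exact: Hg.1.
have [->|ij] := eqVneq i j.
  by under eq_fun do under eq_fun do rewrite updid; exact: cvg_cst.
(* On the unit neighbourhood of x, 1 + |y| is at most 2 + |x|, which makes the domination
   uniform. *)
apply: (@Rint_phi01_continuous (fun y t => g (upd (upd b i y) j t))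
  (M * ((2 + `|x|) * env b)) (x - 1) (x + 1)).
- by move=> y _; apply: continuous_measurable_fun; exact: Hg.1.
- move=> y t; rewrite in_itv/= => /andP[y1 y2].
  apply: le_trans (lingrowth_upd _ _ _ Hg) _.
  rewrite ler_wpM2r ?addr_ge0// ler_wpM2l//; apply: le_trans (env_upd _ _ _) _.
  rewrite ler_wpM2r ?env_ge0//.
  rewrite (_ : 2 + `|x| = 1 + (1 + `|x|)); last by ring.
  rewrite lerD2l; rewrite -(subrK x y); apply: le_trans (ler_normD _ _) _.
  by rewrite lerD2r ler_norml; lra.
- move=> y t _; rewrite /= (_ : (fun _ => _) = (fun z => g (upd (upd b j t) i z))).
    exact: Hg.1.
  by apply/funext => z; rewrite updC.
- by rewrite in_itv/=; lra.
Qed.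

Lemma lingrowth_gaussIter M g l : lingrowth M g ->
  lingrowth (M * phic ^+ size l) (gaussIter l g).
Proof.
elim: l => [|j l IH] Hg /=; first by rewrite mulr1.
by rewrite exprSr mulrA; exact: lingrowth_step (IH Hg).
Qed.

Lemma gaussIter_lin M N g k (c : R) l b : lingrowth M g -> lingrowth N k ->
  gaussIter l (fun b => c * g b + k b) b = c * gaussIter l g b + gaussIter l k b.
Proof.
move=> Hg Hk; elim: l b => [//|j l IH] b /=.
have ig := lingrowth_integrable b j (lingrowth_gaussIter l Hg).
have ik := lingrowth_integrable b j (lingrowth_gaussIter l Hk).
rewrite -RintegralZl// -RintegralD//; last first.
  by rewrite /comp; under eq_fun do rewrite EFinM; exact: integrableZl.
by apply: eq_Rintegral => t _; rewrite IH mulrDr mulrCA.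
Qed.

Lemma gaussIter_cst (c : R) l b : gaussIter l (fun=> c) b = c.
Proof.
elim: l b => [//|j l IH] b /=.
under eq_fun do rewrite IH.
rewrite [LHS]RintegralZr//; last first.
  by rewrite phi01E; exact: integrable_normal_pdf.
by rewrite [Rintegral _ _ _]Rint_phi01 mul1r.
Qed.

Lemma lingrowth_cst (c : R) : lingrowth `|c| (fun=> c).
Proof.
split; first by move=> b j t; exact: cvg_cst.
by move=> b; rewrite ler_peMr// /env lerDl sumr_ge0.
Qed.

Lemma gaussIter_le M N g k l b : lingrowth M g -> lingrowth N k ->
  (forall b, g b <= k b) -> gaussIter l g b <= gaussIter l k b.
Proof.
move=> Hg Hk gk; elim: l b => [//|j l IH] b /=.
apply: le_Rintegral => //.
- exact: lingrowth_integrable (lingrowth_gaussIter l Hg).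
- exact: lingrowth_integrable (lingrowth_gaussIter l Hk).
- by move=> t _; rewrite ler_wpM2l ?phi01_ge0.
Qed.

(** Comparison with the constants -M and M, which iterated integration fixes since the mass is one;
    no power of [phic] is lost. *)
Lemma gaussIter_bounded M N g l b : lingrowth N g -> (forall b, `|g b| <= M) ->
  `|gaussIter l g b| <= M.
Proof.
move=> Hg bg; rewrite ler_norml.
rewrite -[X in _ && (_ <= X)](gaussIter_cst M l b) -[X in X <= _](gaussIter_cst (- M) l b).
apply/andP; split; (apply: gaussIter_le; [| |move=> b'; have := bg b'; rewrite ler_norml => /andP[]//]);
  by [exact: Hg|exact: lingrowth_cst].
Qed.

Lemma gaussIter_continuous l (g : R -> (J -> R) -> R) (M u v : R) :
  (forall x, x \in `]u, v[ -> lingrowth M (g x)) ->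
  (forall x b, x \in `]u, v[ -> {for x, continuous (g ^~ b)}) ->
  forall b x, x \in `]u, v[ ->
    {for x, continuous (fun x => gaussIter l (g x) b)}.
Proof.
move=> Hg cg; elim: l => [|j l IH] b x xuv /=; first exact: cg.
apply: (@Rint_phi01_continuous (fun y t => gaussIter l (g y) (upd b j t))
  (M * phic ^+ size l * env b) u v) => //.
- move=> y yuv; apply: continuous_measurable_fun.
  exact: (lingrowth_gaussIter l (Hg _ yuv)).1.
- by move=> y t yuv; exact: lingrowth_upd (lingrowth_gaussIter l (Hg _ yuv)).
- by move=> y t yuv; apply: IH.
Qed.

Lemma gaussIter_derive l (g g' : R -> (J -> R) -> R) (M u v : R) :
  (forall x, x \in `]u, v[ -> lingrowth M (g x)) ->
  (forall x, x \in `]u, v[ -> lingrowth M (g' x)) ->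
  (forall x b, x \in `]u, v[ -> is_derive x 1 (g ^~ b) (g' x b)) ->
  forall b x, x \in `]u, v[ ->
    is_derive x 1 (fun x => gaussIter l (g x) b) (gaussIter l (g' x) b).
Proof.
move=> Hg Hg' dg; elim: l => [|j l IH] b x xuv /=; first exact: dg.
apply: (@Rint_phi01_derive (fun y t => gaussIter l (g y) (upd b j t))
  (fun y t => gaussIter l (g' y) (upd b j t))
  (M * phic ^+ size l * env b) u v) => //.
- move=> y yuv; apply: continuous_measurable_fun.
  exact: (lingrowth_gaussIter l (Hg _ yuv)).1.
- by move=> y t yuv; exact: lingrowth_upd (lingrowth_gaussIter l (Hg _ yuv)).
- by move=> y t yuv; exact: lingrowth_upd (lingrowth_gaussIter l (Hg' _ yuv)).
Qed.

Lemma phi01_derive (t : R) : is_derive t 1 phi01 (- t * phi01 t).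
Proof.
pose q (t : R) : R := - (t ^+ 2) / 2.
have dq : is_derive t 1 q (- t).
  rewrite /q; under eq_fun do rewrite mulNr expr2 mulrC -mulNr.
  apply: is_derive_eq (is_derive1Z _ (is_derive1M (is_derive1_id _) (is_derive1_id _))) _.
  by field.
rewrite /phi01; under eq_fun do rewrite mulrC.
apply: is_derive_eq (is_derive1Z _ (is_derive1_comp (is_derive_expR (q t)) dq)) _.
by rewrite /q; ring.
Qed.

Lemma phi01_nat_cvg0 : @phi01 R n%:R @[n --> \oo] --> (0 : R).
Proof.
(* From (n - 1)^2 >= 0 one has -n^2/2 <= 1/2 - n, so e^(-n) dominates up to a constant. *)
have h : (phi01 0 * expR (1 / 2)) * expR (1 *- n) @[n --> \oo] --> (0 : R).
  rewrite -[X in _ --> X](mulr0 (phi01 0 * expR (1 / 2))).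
  by apply: cvgMl_tmp; exact: cvgn_expR.
apply: squeeze_cvgr h; last exact: cvg_cst.
apply: nearW => n; rewrite phi01_ge0/= /phi01 expr0n/= oppr0 mul0r expR0 -mulrA mulrC mul1r.
rewrite ler_wpM2l ?invr_ge0 ?sqrtr_ge0// -expRD ler_expR.
have := sqr_ge0 (n%:R - 1 : R); rewrite -mulNrn; nra.
Qed.

Lemma phi01N (t : R) : phi01 (- t) = phi01 t.
Proof. by rewrite /phi01 sqrrN. Qed.

(** The difference of the integrands is the derivative of [phi01 * K]. Over [-n, n] it integrates to
    a boundary term that tends to 0, and dominated convergence carries this to the whole line. *)
Lemma phi01_ibp (K K' : R -> R) (M : R) : (forall t : R, is_derive t 1 K (K' t)) ->
  continuous K' -> (forall t, `|K t| <= M) -> (forall t, `|K' t| <= M) ->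
  Rint setT (fun t => phi01 t * (t * K t)) = Rint setT (fun t => phi01 t * K' t).
Proof.
move=> dK cK' bK bK'.
have cK : continuous K.
  by move=> t; apply: is_derive1_continuous (dK t).
have M0 : 0 <= M by apply: le_trans (bK 0).
have bKt t : `|t * K t| <= M * (1 + `|t|).
  rewrite normrM mulrC mulrDr mulr1; apply: ler_wpDl => //.
  by rewrite ler_wpM2r.
have bK't t : `|K' t| <= M * (1 + `|t|).
  by apply: le_trans (bK' t) _; rewrite ler_peMr// lerDl.
have iK : mu.-integrable setT (EFin \o (fun t => phi01 t * (t * K t))).
  apply: integrable_phi01 bKt; apply: measurable_funM => //.
  exact: continuous_measurable_fun.
have iK' : mu.-integrable setT (EFin \o (fun t => phi01 t * K' t)).
  by apply: integrable_phi01 bK't; exact: continuous_measurable_fun.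
apply/eqP; rewrite eq_sym -subr_eq0 -RintegralB//.
pose F t := phi01 t * K t.
pose F' t := phi01 t * K' t - phi01 t * (t * K t).
have iF' : mu.-integrable setT (EFin \o F').
  by rewrite /comp/F'; under eq_fun do rewrite EFinB; exact: integrableB.
have dF (t : R) : is_derive t 1 F (F' t).
  apply: is_derive_eq (is_derive1M (phi01_derive t) (dK t)) _.
  by rewrite /F'; ring.
have cF' : continuous F'.
  move=> t; apply: cvgB; (apply: cvgM; first exact: phi01_continuous).
    exact: cK'.
  by apply: cvgM; [exact: cvg_id|exact: cK].
have cF : continuous F.
  by move=> t; apply: cvgM; [exact: phi01_continuous|exact: cK].
pose f_ n := EFin \o (F' \_ `[- n%:R, n%:R]).
have mF' : measurable_fun setT F' by exact: continuous_measurable_fun.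
have E n : (\int[mu]_(x in setT) f_ n x)%E = (F n%:R - F (- n%:R))%:E.
  rewrite /f_ -restrict_EFin -integral_mkcond.
  (* The fundamental theorem is applied to a nondegenerate interval, so n = 0 is treated apart. *)
  have [->|n0] := eqVneq n 0%N.
    by rewrite oppr0 set_itv1 integral_set1 subrr.
  rewrite EFinB; apply: continuous_FTC2.
  - by rewrite gtrN// ltr0n lt0n.
  - exact: continuous_subspaceT.
  - split => [x _||]; first by have /@ex_derive := dF x.
    + by apply: cvg_at_right_filter; exact: cF.
    + by apply: cvg_at_left_filter; exact: cF.
  - by move=> x _; rewrite derive1E; have /@derive_val := dF x.
have [_ _ C1] : [/\ mu.-integrable setT (EFin \o F'),
    (\int[mu]_(x in setT) `|f_ n x - (EFin \o F') x|)%E @[n --> \oo] --> 0%E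
   & (\int[mu]_(x in setT) f_ n x)%E @[n --> \oo] --> (\int[mu]_(x in setT) (EFin \o F') x)%E].
  apply: (@dominated_convergence _ _ _ mu setT measurableT f_ (EFin \o F') (EFin \o (fun t => `|F' t|))).
  - move=> n; apply/measurable_EFinP; apply/(measurable_restrictT _ _).1 => //.
    exact: measurable_funTS.
  - exact/measurable_EFinP.
  - apply/aeW => x _; apply: cvg_EFin; first exact: nearW.
    apply: cvg_near_cst; near=> n.
    rewrite /f_/= /patch ifT// inE/= in_itv/= -ler_norml.
    by near: n; exact: nbhs_infty_ger.
  - exact: integrable_norm.
  - apply/aeW => x n _; rewrite /f_/= lee_fin /patch; case: ifPn => // _.
    by rewrite normr0.
have C2 : (F n%:R - F (- n%:R)) @[n --> \oo] --> (0 : R).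
  apply/norm_cvg0P.
  have h : (2 * M) * phi01 (n%:R : R) @[n --> \oo] --> (0 : R).
    rewrite -[X in _ --> X](mulr0 (2 * M)).
    by apply: cvgMl_tmp; exact: phi01_nat_cvg0.
  apply: squeeze_cvgr h; last exact: cvg_cst.
  apply: nearW => n; rewrite normr_ge0/= /F phi01N -mulrBr normrM ger0_norm ?phi01_ge0//.
  rewrite mulrC ler_wpM2r ?phi01_ge0//; apply: le_trans (ler_normB _ _) _.
  by have := bK n%:R; have := bK (- n%:R); lra.
have C3 : (F n%:R - F (- n%:R))%:E @[n --> \oo] --> (\int[mu]_(x in setT) (F' x)%:E)%E.
  by move: C1; under eq_fun do rewrite E.
have : (\int[mu]_(x in setT) (F' x)%:E)%E = 0%E.
  by apply: cvg_unique C3 _ => //; apply: cvg_EFin => //; exact: nearW.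
by rewrite /Rintegral => ->.
Unshelve. all: by end_near. Qed.

Lemma gaussIter_upd l g b j t : j \notin l ->
  gaussIter l g (upd b j t) = gaussIter l (fun b' => g (upd b' j t)) b.
Proof.
elim: l b => [//|i l IH] b /=; rewrite inE negb_or => /andP[ji jl].
apply: eq_Rintegral => x _; rewrite -IH// updC//.
Qed.

Lemma gaussIter_pull M l g b j : j \notin l -> lingrowth M g ->
  gaussIter l (fun b => b j * g b) b = b j * gaussIter l g b.
Proof.
move=> jl Hg; elim: l b jl => [//|i l IH] b /=.
rewrite inE negb_or => /andP[ji jl].
rewrite -[RHS]RintegralZl//; last first.
  exact: lingrowth_integrable (lingrowth_gaussIter l Hg).
by apply: eq_Rintegral => x _; rewrite IH// /upd (negbTE ji) mulrCA.
Qed.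

Lemma lingrowth_updcst M g j t : lingrowth M g ->
  lingrowth (M * (1 + `|t|)) (fun b => g (upd b j t)).
Proof.
move=> Hg; split => [b i x|b]; last first.
  by apply: le_trans (lingrowth_upd _ _ _ Hg) _; rewrite mulrAC.
have [->|ij] := eqVneq i j.
  by under eq_fun do rewrite updid; exact: cvg_cst.
under eq_fun do rewrite updC//.
exact: Hg.1.
Qed.

(* Stein's identity E[Z_j g(Z)] = E[d_j g(Z)]. *)
Lemma gaussIter_ibp l j g g' M b : uniq l -> j \in l ->
  lingrowth M g -> lingrowth M g' ->
  (forall b, `|g b| <= M) -> (forall b, `|g' b| <= M) ->
  (forall b (t : R), is_derive t 1 (fun t => g (upd b j t)) (g' (upd b j t))) ->
  gaussIter l (fun b => b j * g b) b = gaussIter l g' b.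
Proof.
move=> ul jl Hg Hg' bg bg' dg; have M0 := lingrowth_ge0 Hg.
elim: l b ul jl => [//|i l IH] b /= /andP[il ul]; rewrite inE.
(* If j is not the outermost variable, the identity passes under the outer integral. If it is, the
   factor [b j] is constant for the inner integrals and the one-variable formula applies. *)
have [ij _|ji /= jl] := eqVneq j i; last first.
  by apply: eq_Rintegral => t _; rewrite IH.
rewrite -{}ij in il *; rewrite (_ : Rint _ _ =
    Rint setT (fun t => phi01 t * (t * gaussIter l g (upd b j t)))); last first.
  apply: eq_Rintegral => t _; rewrite (gaussIter_pull _ il Hg).
  by rewrite {1}/upd eqxx.
apply: (@phi01_ibp _ _ M).
- move=> t; under eq_fun do rewrite gaussIter_upd//.
  rewrite gaussIter_upd//.
  have H0 x k : x \in `](t - 1), (t + 1)[ -> lingrowth M k ->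
    lingrowth (M * (2 + `|t|)) (fun b => k (upd b j x)).
    rewrite in_itv/= => /andP[x1 x2] Hk.
    apply: lingrowthW (lingrowth_updcst j x Hk).
    rewrite ler_wpM2l// (_ : 2 + `|t| = 1 + (1 + `|t|)); last by ring.
    rewrite lerD2l -(subrK t x); apply: le_trans (ler_normD _ _) _.
    by rewrite lerD2r ler_norml; lra.
  apply: (@gaussIter_derive l (fun x b => g (upd b j x)) (fun x b => g' (upd b j x))
     (M * (2 + `|t|)) (t - 1) (t + 1)).
  + by move=> x xt; apply: H0.
  + by move=> x xt; apply: H0.
  + by rewrite in_itv/=; lra.
- exact: (lingrowth_gaussIter l Hg').1.
- by move=> t; exact: gaussIter_bounded Hg bg.
- by move=> t; exact: gaussIter_bounded Hg' bg'.
Qed.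

End Gaussian.

(** * Iterated series *)

Section Series.
Context {R : realType}.
Set Implicit Arguments.
Unset Strict Implicit.
Implicit Types (a b w u : nat -> R) (C D : R).

(** A single ratio 1/2 suffices since Poisson weights decay faster than any geometric sequence. The
    class is stable under shifts and gives explicit tails. *)
Definition geo C a := forall n, `|a n| <= C * 2^-1 ^+ n.

Lemma geo_ge0 C a : geo C a -> 0 <= C.
Proof. by move=> /(_ 0%N); rewrite expr0 mulr1; exact: le_trans. Qed.

Lemma geoW C D a : C <= D -> geo C a -> geo D a.
Proof.
move=> CD ga n; apply: le_trans (ga n) _.
by rewrite ler_wpM2r// exprn_ge0// invr_ge0.
Qed.

Lemma geo_lin C D a b (c : R) : geo C a -> geo D b ->
  geo (`|c| * C + D) (fun n => c * a n + b n).
Proof.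
move=> ga gb n; apply: le_trans (ler_normD _ _) _.
by rewrite mulrDl lerD// normrM -mulrA ler_wpM2l.
Qed.

Lemma geo_bounded C a u (M : R) : geo C a -> (forall n, `|u n| <= M) ->
  geo (C * M) (fun n => a n * u n).
Proof.
by move=> ga bu n; rewrite normrM mulrAC ler_pM.
Qed.

(** Convolution with the point mass at 1: the law of n + 1 when [w] is the law of n. *)
Definition shiftw w (n : nat) : R := if n is m.+1 then w m else 0.

Lemma geo_shiftw C w : geo C w -> geo (2 * C) (shiftw w).
Proof.
move=> gw [|n] /=.
  by rewrite normr0 mulr1 mulr_ge0// (geo_ge0 gw).
apply: le_trans (gw n) _; rewrite exprS; set e := 2^-1 ^+ n.
by rewrite (_ : 2 * C * (2^-1 * e) = C * e)//; field.
Qed.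

Lemma geo_shift C a : geo C a -> geo C (fun n => a n.+1).
Proof.
move=> ga n; apply: le_trans (ga n.+1) _.
rewrite ler_wpM2l ?(geo_ge0 ga)// exprS ler_piMl// ?exprn_ge0// ?invr_ge0//.
by rewrite invf_le1// ler1n.
Qed.

(** The factor 1 - 2^(-m) is exactly the partial geometric sum, which closes the induction with an
    equality of bounds. *)
Lemma geo_cauchy C a N m : geo C a ->
  `|\sum_(i < N + m) a i - \sum_(i < N) a i| <= 2 * C * 2^-1 ^+ N * (1 - 2^-1 ^+ m).
Proof.
move=> ga; elim: m => [|m IH]; first by rewrite addn0 !subrr normr0 mulr0.
rewrite addnS big_ord_recr/= addrAC; apply: le_trans (ler_normD _ _) _.
have := ga (N + m)%N; move: IH; rewrite exprD exprS.
set e := 2^-1 ^+ N; set f := 2^-1 ^+ m.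
by move=> h1 h2; apply: le_trans (lerD h1 h2) _; rewrite le_eqVlt; apply/orP; left; apply/eqP; field.
Qed.

Lemma geo_cvg C a : geo C a -> \sum_(i < n) a i @[n --> \oo] --> rseries a.
Proof.
move=> ga.
have : cvgn (series a).
  apply: normed_cvg; apply: (@series_le_cvg _ _ (geometric C 2^-1)).
  - by move=> n; exact: normr_ge0.
  - by move=> n /=; rewrite mulr_ge0 ?(geo_ge0 ga)// exprn_ge0// invr_ge0.
  - exact: ga.
  - by apply: is_cvg_geometric_series; rewrite ger0_norm ?invr_ge0// invf_lt1// ltr1n.
rewrite /rseries (_ : series a = (fun n => \sum_(i < n) a i))//.
by apply/funext => n; rewrite /series/= big_mkord.
Qed.

Lemma geo_tail C a N : geo C a ->
  `|rseries a - \sum_(i < N) a i| <= 2 * C * 2^-1 ^+ N.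
Proof.
move=> ga; set S := \sum_(i < N) a i.
have h : `|\sum_(i < n) a i - S| @[n --> \oo] --> `|rseries a - S|.
  by apply: cvg_norm; apply: cvgB; [exact: geo_cvg ga|exact: cvg_cst].
rewrite -(cvg_lim _ h)//; apply: limr_le; first by apply/cvg_ex; eexists; exact: h.
near=> n.
have Nn : (N <= n)%N by near: n; exact: nbhs_infty_ge.
rewrite -(subnKC Nn); apply: le_trans (geo_cauchy _ _ ga) _.
apply: ler_piMr; last by rewrite gerBl exprn_ge0// invr_ge0.
by rewrite !mulr_ge0 ?(geo_ge0 ga)// exprn_ge0// invr_ge0.
Unshelve. all: by end_near. Qed.

Lemma geo_rseries C a : geo C a -> `|rseries a| <= 2 * C.
Proof. by move=> /(geo_tail 0); rewrite big_ord0 subr0 mulr1. Qed.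

Lemma rseries_eq a (l : R) : \sum_(i < n) a i @[n --> \oo] --> l -> rseries a = l.
Proof. by move=> h; apply/cvg_lim. Qed.

Lemma rseries_lin C D a b (c : R) : geo C a -> geo D b ->
  rseries (fun n => c * a n + b n) = c * rseries a + rseries b.
Proof.
move=> ga gb; apply: rseries_eq; under eq_fun do rewrite big_split -mulr_sumr.
by apply: cvgD; [apply: cvgMl_tmp; exact: geo_cvg ga|exact: geo_cvg gb].
Qed.

Lemma rseries_shift C a : geo C a -> rseries a = a 0%N + rseries (fun n => a n.+1).
Proof.
move=> ga; apply: rseries_eq; rewrite -cvg_shiftS.
rewrite (_ : [sequence _]_n = (fun n => a 0%N + \sum_(i < n) a i.+1)); last first.
  by apply/funext => n /=; rewrite big_ord_recl.
by apply: cvgD; [exact: cvg_cst|exact: geo_cvg (geo_shift ga)].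
Qed.

(** Summation by parts; [shiftw w 0 = 0] leaves no boundary term at 0. *)
Lemma rseries_abel C w u (M : R) : geo C w -> (forall n, `|u n| <= M) ->
  rseries (fun n => (shiftw w n - w n) * u n) =
  rseries (fun n => w n * (u n.+1 - u n)).
Proof.
move=> gw bu.
have g1 := geo_bounded (geo_shiftw gw) bu.
have g2 := geo_bounded gw bu.
have g3 : geo (C * M) (fun n => w n * u n.+1) by apply: geo_bounded gw _ => n.
have -> : (fun n => (shiftw w n - w n) * u n) =
  (fun n => -1 * (w n * u n) + shiftw w n * u n) by apply/funext => n; ring.
have -> : (fun n => w n * (u n.+1 - u n)) =
  (fun n => -1 * (w n * u n) + w n * u n.+1) by apply/funext => n; ring.
rewrite (rseries_lin _ g2 g1) (rseries_lin _ g2 g3); congr (_ + _).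
by rewrite (rseries_shift g1) /= mul0r add0r.
Qed.

(** Dominated convergence for series: the common geometric bound makes both tails small, and
    finitely many terms converge. *)
Lemma rseries_cvg (T : Type) (F : set_system T) {FF : ProperFilter F} C
    (a : T -> nat -> R) (l : nat -> R) :
  (\forall t \near F, geo C (a t)) -> geo C l ->
  (forall n, a t n @[t --> F] --> l n) ->
  rseries (a t) @[t --> F] --> rseries l.
Proof.
move=> ga gl cvl; have C0 := geo_ge0 gl.
apply/cvgrPdist_le => e e0.
have [N HN] : exists N, 2 * C * 2^-1 ^+ N <= e / 3.
  have : geometric (2 * C) 2^-1 n @[n --> \oo] --> (0 : R).
    by apply: cvg_geometric; rewrite ger0_norm ?invr_ge0// invf_lt1// ltr1n.
  move=> /cvgrPdist_le /(_ (e / 3)); rewrite divr_gt0// => /(_ isT) [N _ /(_ N (leqnn N))] /=.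
  by rewrite sub0r normrN => h; exists N; apply: le_trans (ler_norm _) h.
have cS : \sum_(i < N) a t i @[t --> F] --> \sum_(i < N) l i.
  elim: (N) => [|k IH].
    by rewrite big_ord0; under eq_fun do rewrite big_ord0; exact: cvg_cst.
  rewrite big_ord_recr; under eq_fun do rewrite big_ord_recr.
  by apply: cvgD; [exact: IH|exact: cvl].
move/cvgrPdist_le : cS => /(_ (e / 3)); rewrite divr_gt0// => /(_ isT) cS.
near=> t.
have h1 := geo_tail N gl.
have h2 : `|\sum_(i < N) l i - \sum_(i < N) a t i| <= e / 3 by near: t.
have h3 : `|rseries (a t) - \sum_(i < N) a t i| <= 2 * C * 2^-1 ^+ N.
  by apply: geo_tail; near: t.
move: h1 h2 h3; rewrite !ler_norml; move: HN; set T1 := _ * _; lra.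
Unshelve. all: by end_near. Qed.

Lemma is_derive1_cvg (f : R -> R) (x l : R) :
  h^-1 *: (f (h + x) - f x) @[h --> 0^'] --> l -> is_derive x 1 f l.
Proof.
move=> h; have h' : h^-1 *: ((f \o shift x) (h *: 1) - f x) @[h --> 0^'] --> l.
  by under eq_fun do rewrite /= [_ *: 1]mulr1.
by apply: DeriveDef; [apply/cvg_ex; exists l|apply/cvg_lim].
Qed.

Lemma is_derive1_cvgE (f : R -> R) (x l : R) : is_derive x 1 f l ->
  h^-1 *: (f (h + x) - f x) @[h --> 0^'] --> l.
Proof.
move=> [df <-]; have := df; rewrite /derivable /derive => /cvg_ex[/= l' h].
rewrite (cvg_lim _ h)//.
by move: h; under eq_fun do rewrite /= [_ *: 1]mulr1.
Qed.

Lemma mean_value_le (f f' : R -> R) (u v K : R) :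
  (forall x, x \in `]u, v[ -> is_derive x 1 f (f' x)) ->
  (forall x, x \in `]u, v[ -> `|f' x| <= K) ->
  forall x y, x \in `]u, v[ -> y \in `]u, v[ -> `|f y - f x| <= K * `|y - x|.
Proof.
move=> df bf.
suff H : forall x y, x \in `]u, v[ -> y \in `]u, v[ -> x <= y -> `|f y - f x| <= K * `|y - x|.
  move=> x y xuv yuv; have [xy|yx] := leP x y; first exact: H.
  by rewrite distrC (distrC y); apply: H => //; exact: ltW.
move=> x y xuv yuv xy.
have sub z : z \in `[x, y] -> z \in `]u, v[.
  move: xuv yuv; rewrite !in_itv/= => /andP[ux xv] /andP[uy yv] /andP[xz zy].
  by rewrite (lt_le_trans ux)// (le_lt_trans zy).
have [z zxy ->] := @MVT_segment _ f f' x y xy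
  (fun z zxy => df z (sub z (subset_itv_oo_cc zxy)))
  (derivable_within_continuous (fun z zxy => @ex_derive _ _ _ _ _ _ _ (df z (sub z zxy)))).
by rewrite normrM ler_wpM2r// bf// sub.
Qed.

(** By the mean value inequality the difference quotients inherit the geometric bound of the
    derivatives, so [rseries_cvg] applies to them. *)
Lemma rseries_derive (a a' : R -> nat -> R) C (u v : R) :
  (forall x, x \in `]u, v[ -> geo C (a x)) ->
  (forall x, x \in `]u, v[ -> geo C (a' x)) ->
  (forall x n, x \in `]u, v[ -> is_derive x 1 (a ^~ n) (a' x n)) ->
  forall x, x \in `]u, v[ ->
  is_derive x 1 (fun x => rseries (a x)) (rseries (a' x)).
Proof.
move=> ga ga' da x xuv; apply: is_derive1_cvg.
have nearuv : \forall h \near 0^', h + x \in `]u, v[.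
  have : \forall y \near x, y \in `]u, v[ by exact: near_in_itvoo.
  move=> /nbhs_ballP[e /= e0 he].
  exists e => //= h /=; rewrite sub0r normrN => hh _; apply: he.
  by rewrite /ball/= opprD addrCA subrr addr0 normrN.
have near0 : \forall h \near (0:R)^', h != 0 by exact: nbhs_dnbhs_neq.
have h1 : rseries (fun n => h^-1 * (a (h + x) n - a x n)) @[h --> 0^'] --> rseries (a' x).
  apply: (@rseries_cvg _ _ _ C); last first.
  - by move=> n; exact: (is_derive1_cvgE (da _ n xuv)).
  - exact: ga'.
  - near=> h => n.
    have huv : h + x \in `]u, v[ by near: h.
    have h0 : h != 0 by near: h.
    rewrite normrM normfV ler_pdivrMl ?normr_gt0//.
    have := @mean_value_le _ _ u v (C * 2^-1 ^+ n)
      (fun x xuv => da x n xuv) (fun x xuv => ga' x xuv n) x (h + x) xuv huv.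
    by rewrite addrK mulrC.
apply: cvg_trans h1; apply: near_eq_cvg; near=> h.
have huv : h + x \in `]u, v[ by near: h.
have g2 := geo_lin (- 1) (ga _ xuv) (ga _ huv).
have -> : (fun n => h^-1 * (a (h + x) n - a x n)) =
  (fun n => h^-1 * (-1 * a x n + a (h + x) n) + 0) by apply/funext => n; ring.
have gz : geo 0 (fun=> 0) by move=> n; rewrite normr0 mul0r.
rewrite (rseries_lin _ g2 gz) (rseries_lin _ (ga _ xuv) (ga _ huv)).
rewrite [rseries (fun=> 0)](_ : _ = 0); last first.
  by apply: rseries_eq; under eq_fun do rewrite big1//; exact: cvg_cst.
by rewrite /GRing.scale/=; ring.
Unshelve. all: by end_near. Qed.

(** * Iterated series in several counting coordinates *)

Context {K : eqType}.
Implicit Types (l : seq K) (wt : K -> nat -> R) (f : (K -> nat) -> R) (z : K -> nat) (M N : R).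

Definition incr z j : K -> nat := fun i => (z i + (i == j))%N.

Lemma incr_upd z j n : incr (upd z j n) j = upd z j n.+1.
Proof.
by apply/funext => i; rewrite /incr /upd; case: eqP => _; rewrite ?addn1 ?addn0.
Qed.

Lemma incr_updC z i j n : i != j -> incr (upd z i n) j = upd (incr z j) i n.
Proof.
move=> ij; apply/funext => k; rewrite /incr /upd.
by case: (eqVneq k i) => // ->; rewrite (negbTE ij) addn0.
Qed.

Lemma rseries0 : rseries (fun=> 0 : R) = 0.
Proof. by apply: rseries_eq; under eq_fun do rewrite big1//; exact: cvg_cst. Qed.

Lemma rseries_sum (I : Type) (s : seq I) (a : I -> nat -> R) C :
  (forall i, geo C (a i)) ->
  rseries (fun n => \sum_(i <- s) a i n) = \sum_(i <- s) rseries (a i) /\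
  geo (C *+ size s) (fun n => \sum_(i <- s) a i n).
Proof.
move=> ga; elim: s => [|i s [IH1 IH2]].
  rewrite big_nil; under eq_fun do rewrite big_nil.
  by split; [exact: rseries0|move=> n; rewrite normr0 mul0r].
rewrite big_cons; under eq_fun do rewrite big_cons -[a i _]mul1r.
split; first by rewrite (rseries_lin 1 (ga i) IH2) mul1r IH1.
move=> n; rewrite /= mulrS mulrDl mul1r.
by apply: le_trans (ler_normD _ _) _; apply: lerD; [exact: ga|exact: IH2].
Qed.

Lemma serIter_bounded C M l wt f z : 0 <= C -> (forall j, geo C (wt j)) ->
  (forall z, `|f z| <= M) -> `|serIter l wt f z| <= (2 * C) ^+ size l * M.
Proof.
move=> C0 gw bf; elim: l z => [|j l IH] z /=; first by rewrite mul1r.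
have := geo_rseries (geo_bounded (gw j) (fun n => IH (upd z j n))).
by move=> /le_trans; apply; rewrite exprS !mulrA.
Qed.

Lemma geo_serIter C M l wt w f z j : geo C w -> (forall j, geo C (wt j)) ->
  (forall z, `|f z| <= M) ->
  geo (C * ((2 * C) ^+ size l * M)) (fun n => w n * serIter l wt f (upd z j n)).
Proof.
move=> gw gwt bf; apply: (geo_bounded gw) => n.
exact: serIter_bounded (geo_ge0 gw) gwt bf.
Qed.

Lemma serIter_lin C M N l wt f g (c : R) z : (forall j, geo C (wt j)) ->
  (forall z, `|f z| <= M) -> (forall z, `|g z| <= N) ->
  serIter l wt (fun z => c * f z + g z) z = c * serIter l wt f z + serIter l wt g z.
Proof.
move=> gw bf bg; elim: l z => [//|j l IH] z /=.
rewrite -(rseries_lin c (geo_serIter l z j (gw j) gw bf) (geo_serIter l z j (gw j) gw bg)).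
by congr rseries; apply/funext => n; rewrite IH; ring.
Qed.

Lemma serIter_eqw l wt wt' f z : {in l, wt =1 wt'} ->
  serIter l wt f z = serIter l wt' f z.
Proof.
elim: l z => [//|j l IH] z /= H.
congr rseries; apply/funext => n; rewrite H ?mem_head// IH//.
by move=> i il; rewrite H// inE il orbT.
Qed.

Lemma serIter_updw l wt w f z j : j \notin l ->
  serIter l (upd wt j w) f z = serIter l wt f z.
Proof.
move=> jl; apply: serIter_eqw => i il; rewrite /upd; case: eqP => // ij.
by move: jl; rewrite -ij il.
Qed.

Lemma geo_upd C wt w j : (forall i, geo C (wt i)) -> geo C w ->
  forall i, geo C (upd wt j w i).
Proof. by move=> gw gw' i; rewrite /upd; case: eqP. Qed.

(** Multilinearity in the weights: it lifts identities of the one-coordinate kernel [qs] to the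
    operator [Ts]. *)
Lemma serIter_wlin C M l wt w w' f (c : R) j z : uniq l -> j \in l ->
  (forall i, geo C (wt i)) -> geo C w -> geo C w' -> (forall z, `|f z| <= M) ->
  serIter l (upd wt j (fun n => c * w n + w' n)) f z =
  c * serIter l (upd wt j w) f z + serIter l (upd wt j w') f z.
Proof.
move=> ul jl gwt gw gw' bf; elim: l z ul jl => [//|i l IH] z /= /andP[il ul].
rewrite inE; have [ij _|ji /= jl] := eqVneq j i.
  rewrite -{}ij in il *.
  have E w0 : (fun n => upd wt j w0 j n * serIter l (upd wt j w0) f (upd z j n)) =
      (fun n => w0 n * serIter l wt f (upd z j n)).
    by apply/funext => n; rewrite serIter_updw// {1}/upd eqxx.
  rewrite !E.
  rewrite -(rseries_lin c (geo_serIter l z j gw gwt bf) (geo_serIter l z j gw' gwt bf)).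
  by congr rseries; apply/funext => n; ring.
have E w0 : upd wt j w0 i = wt i by rewrite /upd eq_sym (negbTE ji).
rewrite !E.
rewrite -(rseries_lin c (geo_serIter l z i (gwt i) (geo_upd j gwt gw) bf)
   (geo_serIter l z i (gwt i) (geo_upd j gwt gw') bf)).
by congr rseries; apply/funext => n; rewrite IH//; ring.
Qed.

Lemma serIter_incr l wt f j z : j \notin l ->
  serIter l wt (fun z => f (incr z j)) z = serIter l wt f (incr z j).
Proof.
elim: l z => [//|i l IH] z /=; rewrite inE negb_or => /andP[ji jl].
by congr rseries; apply/funext => n; rewrite IH// incr_updC// eq_sym.
Qed.

Lemma serIter_abel C M l wt f j z : uniq l -> j \in l ->
  (forall i, geo C (wt i)) -> (forall z, `|f z| <= M) ->
  serIter l (upd wt j (fun n => shiftw (wt j) n - wt j n)) f z =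
  serIter l wt (fun z => f (incr z j) - f z) z.
Proof.
move=> ul jl gwt bf; elim: l z ul jl => [//|i l IH] z /= /andP[il ul].
rewrite inE; have [ij _|ji /= jl] := eqVneq j i.
  rewrite -{}ij in il *.
  under eq_fun do rewrite serIter_updw//.
  rewrite {1}/upd eqxx (rseries_abel (gwt j) (fun n => serIter_bounded l (upd z j n) (geo_ge0 (gwt j)) gwt bf)).
  congr rseries; apply/funext => n; congr (_ * _).
  have -> : (fun z => f (incr z j) - f z) = (fun z => -1 * f z + f (incr z j)).
    by apply/funext => y; ring.
  rewrite (serIter_lin l _ _ gwt bf (fun y => bf (incr y j))) serIter_incr//.
  by rewrite incr_upd; ring.
congr rseries; apply/funext => n; rewrite IH//; congr (_ * _).
by rewrite /upd eq_sym (negbTE ji).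
Qed.

Lemma serIter_w0 C M l wt f j z : uniq l -> j \in l ->
  (forall i, geo C (wt i)) -> (forall z, `|f z| <= M) ->
  serIter l (upd wt j (fun=> 0)) f z = 0.
Proof.
move=> ul jl gwt bf.
have C0 := geo_ge0 (gwt j).
have g0 : geo C (fun=> 0) by move=> n; rewrite normr0 mulr_ge0// exprn_ge0// invr_ge0.
(* Zero is -1 * 0 + 0, so linearity expresses the value x as -x + x. *)
have := serIter_wlin (-1) z ul jl gwt g0 g0 bf.
rewrite (_ : (fun n => -1 * 0 + 0) = (fun=> 0)); last by apply/funext => n; ring.
by move=> ->; ring.
Qed.

Lemma serIter_cvg (T : Type) (F : set_system T) {FF : ProperFilter F} C M l
    (wt : T -> K -> nat -> R) (wt0 : K -> nat -> R)
    (f : T -> (K -> nat) -> R) (f0 : (K -> nat) -> R) z :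
  (\forall t \near F, forall j, geo C (wt t j)) -> (forall j, geo C (wt0 j)) ->
  (\forall t \near F, forall z, `|f t z| <= M) -> (forall z, `|f0 z| <= M) ->
  (forall j n, wt t j n @[t --> F] --> wt0 j n) ->
  (forall z, f t z @[t --> F] --> f0 z) ->
  serIter l (wt t) (f t) z @[t --> F] --> serIter l wt0 f0 z.
Proof.
move=> gw gw0 bf bf0 cw cf; elim: l z => [//|j l IH] z /=.
apply: (@rseries_cvg _ _ _ (C * ((2 * C) ^+ size l * M))) => [||n].
- near=> t.
  have gwt : forall j, geo C (wt t j) by near: t.
  have bft : forall z, `|f t z| <= M by near: t.
  exact: (geo_serIter l z j (gwt j) gwt bft).
- exact: (geo_serIter l z j (gw0 j) gw0 bf0).
- by apply: cvgM; [exact: cw|exact: IH].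
Unshelve. all: by end_near. Qed.

(** The product rule: each summand differentiates the weight of one coordinate, the last term the
    summed function. Uniform geometric bounds on ]u, v[ justify the termwise derivative at every
    level. *)
Lemma serIter_derive C M l (wt wt' : R -> K -> nat -> R)
    (f f' : R -> (K -> nat) -> R) (u v : R) : uniq l -> 0 <= C -> 0 <= M ->
  (forall x j, x \in `]u, v[ -> geo C (wt x j)) ->
  (forall x j, x \in `]u, v[ -> geo C (wt' x j)) ->
  (forall x z, x \in `]u, v[ -> `|f x z| <= M) ->
  (forall x z, x \in `]u, v[ -> `|f' x z| <= M) ->
  (forall x j n, x \in `]u, v[ -> is_derive x 1 (fun x => wt x j n) (wt' x j n)) ->
  (forall x z, x \in `]u, v[ -> is_derive x 1 (f ^~ z) (f' x z)) ->
  forall x z, x \in `]u, v[ ->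
  is_derive x 1 (fun x => serIter l (wt x) (f x) z)
   (\sum_(k <- l) serIter l (upd (wt x) k (wt' x k)) (f x) z +
    serIter l (wt x) (f' x) z).
Proof.
move=> ul C0 M0 gw gw' bf bf' dw df; elim: l ul => [_|j l IH /= /andP[jl ul]] x z xuv /=.
  by rewrite big_nil add0r; exact: df.
set B := (2 * C) ^+ size l * M.
have B0 : 0 <= B by rewrite mulr_ge0// exprn_ge0// mulr_ge0.
pose S y z := serIter l (wt y) (f y) z.
pose S' y z := \sum_(k <- l) serIter l (upd (wt y) k (wt' y k)) (f y) z +
    serIter l (wt y) (f' y) z.
have bS y z' : y \in `]u, v[ -> `|S y z'| <= B.
  by move=> yuv; apply: serIter_bounded => // [i|z'']; [exact: gw|exact: bf].
have bU y k z' : y \in `]u, v[ -> `|serIter l (upd (wt y) k (wt' y k)) (f y) z'| <= B.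
  move=> yuv; apply: serIter_bounded => // [i|z'']; last exact: bf.
  by apply: geo_upd => [i'|]; [exact: gw|exact: gw'].
have bS' y z' : y \in `]u, v[ -> `|S' y z'| <= B *+ size l + B.
  move=> yuv; apply: le_trans (ler_normD _ _) _; apply: lerD; last first.
    by apply: serIter_bounded => // [i|z'']; [exact: gw|exact: bf'].
  rewrite (le_trans (ler_norm_sum _ _ _))//.
  apply: le_trans (ler_sum _ (fun k _ => bU y k z' yuv)) _.
  by rewrite big_const_seq count_predT iter_addr addr0.
have P0 : 0 <= B *+ size l by rewrite mulrn_wge0.
set D := C * B + C * (B *+ size l + B).
have H := @rseries_derive (fun y n => wt y j n * S y (upd z j n))
   (fun y n => wt' y j n * S y (upd z j n) + wt y j n * S' y (upd z j n)) D u v.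
apply: is_derive_eq; first apply: H => //.
- move=> y yuv; apply: geoW (geo_bounded (gw y j yuv) (fun n => bS y (upd z j n) yuv)).
  by rewrite /D lerDl mulr_ge0// addr_ge0.
- move=> y yuv n; rewrite /D mulrDl; apply: le_trans (ler_normD _ _) _; apply: lerD.
    exact: (geo_bounded (gw' y j yuv) (fun n => bS y (upd z j n) yuv)).
  exact: (geo_bounded (gw y j yuv) (fun n => bS' y (upd z j n) yuv)).
- by move=> y n yuv; apply: is_derive1M; [exact: dw|exact: IH].
rewrite /S'.
have g1 : geo (C * B) (fun n => wt' x j n * S x (upd z j n)).
  exact: (geo_bounded (gw' x j xuv) (fun n => bS x (upd z j n) xuv)).
have g2 k : geo (C * B) (fun n => wt x j n *
    serIter l (upd (wt x) k (wt' x k)) (f x) (upd z j n)).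
  exact: (geo_bounded (gw x j xuv) (fun n => bU x k (upd z j n) xuv)).
have g3 : geo (C * B) (fun n => wt x j n * serIter l (wt x) (f' x) (upd z j n)).
  apply: (geo_bounded (gw x j xuv)) => n.
  by apply: serIter_bounded => // [i|z'']; [exact: gw|exact: bf'].
have [s1 s2] := rseries_sum l g2.
have -> : (fun n => wt' x j n * S x (upd z j n) + wt x j n *
    (\sum_(k <- l) serIter l (upd (wt x) k (wt' x k)) (f x) (upd z j n) +
     serIter l (wt x) (f' x) (upd z j n))) =
  (fun n => 1 * (1 * (wt' x j n * S x (upd z j n)) +
    \sum_(k <- l) (wt x j n * serIter l (upd (wt x) k (wt' x k)) (f x) (upd z j n))) +
    wt x j n * serIter l (wt x) (f' x) (upd z j n)).
  by apply/funext => n; rewrite -mulr_sumr; ring.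
rewrite (rseries_lin _ (geo_lin 1 g1 s2) g3) (rseries_lin _ g1 s2) !mul1r s1.
congr (_ + _); rewrite big_cons; congr (_ + _).
  congr rseries; apply/funext => n.
  by rewrite serIter_updw// [upd (wt x) _ _ _](_ : _ = wt' x j)// /upd eqxx.
apply: eq_big_seq => k kl.
congr rseries; apply/funext => n; rewrite [upd (wt x) _ _ j](_ : _ = wt x j)//.
by rewrite /upd; case: eqP => // jk; move: jl; rewrite jk kl.
Qed.

Lemma serIter_derive_cw C M l wt (f f' : R -> (K -> nat) -> R) (u v : R) :
  uniq l -> 0 <= C -> 0 <= M -> (forall j, geo C (wt j)) ->
  (forall x z, x \in `]u, v[ -> `|f x z| <= M) ->
  (forall x z, x \in `]u, v[ -> `|f' x z| <= M) ->
  (forall x z, x \in `]u, v[ -> is_derive x 1 (f ^~ z) (f' x z)) ->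
  forall x z, x \in `]u, v[ ->
  is_derive x 1 (fun x => serIter l wt (f x) z) (serIter l wt (f' x) z).
Proof.
move=> ul C0 M0 gw bf bf' df x z xuv.
apply: is_derive_eq.
  apply: (@serIter_derive C M l (fun=> wt) (fun _ _ _ => 0) f f' u v) => //.
    by move=> _ _ _ n; rewrite normr0 mulr_ge0// exprn_ge0// invr_ge0.
  by move=> y j n _; exact: is_derive1_cst.
rewrite big_seq_cond big1 ?add0r// => k /andP[kl _].
by apply: (serIter_w0 _ ul kl gw) => z'; exact: bf.
Qed.

End Series.

(** * The thinned Poisson kernel *)

Section ThinnedPoisson.
Context {R : realType}.
Set Implicit Arguments.
Unset Strict Implicit.
Implicit Types (lam s : R) (a b n : nat).

(** The Poisson(lam s) mass at b - k. The explicit test is needed because truncated subtraction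
    would give the mass at 0 when k > b. *)
Definition pterm lam s b k : R :=
  if (k <= b)%N then (lam * s) ^+ (b - k) * expR (- (lam * s)) / (b - k)`!%:R else 0.

(** With the cutoff moved into [pterm], the range no longer depends on b. For s in [0, 1] the sum is
    visibly the law of Bin(a, 1 - s) + Po(lam s). *)
Lemma qsE lam s a b :
  qs lam s a b = \sum_(k < a.+1) 'C(a, k)%:R * (1 - s) ^+ k * s ^+ (a - k) * pterm lam s b k.
Proof.
rewrite /qs -(big_mkord xpredT (fun k => 'C(a, k)%:R * (1 - s) ^+ k * s ^+ (a - k) *
     (lam * s) ^+ (b - k) * expR (- (lam * s)) / (b - k)`!%:R)).
rewrite -(big_mkord xpredT (fun k => 'C(a, k)%:R * (1 - s) ^+ k * s ^+ (a - k) * pterm lam s b k)).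
rewrite [RHS](@big_cat_nat _ _ _ (minn a b).+1) ?ltnS ?geq_minl//=.
rewrite [X in _ = _ + X]big_nat_cond [X in _ = _ + X]big1 ?addr0; last first.
  move=> k /andP[/andP[k1 k2] _]; rewrite /pterm leqNgt.
  have -> : (b < k)%N by move: k1; rewrite gtn_min ltnNge -ltnS k2.
  by rewrite mulr0.
rewrite big_nat_cond [RHS]big_nat_cond; apply: eq_bigr => k /andP[/andP[_ kl] _].
move: kl; rewrite ltnS leq_min /pterm => /andP[_ ->].
by rewrite !mulrA.
Qed.

Lemma qs0E lam s b : qs lam s 0 b = (lam * s) ^+ b * expR (- (lam * s)) / b`!%:R.
Proof.
by rewrite qsE big_ord_recl big_ord0 addr0 /= bin0 !mul1r /pterm subn0.
Qed.

(** One further point dies with probability s and survives with probability 1 - s; algebraically,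
    Pascal's rule. *)
Lemma qs_rec lam s a b :
  qs lam s a.+1 b = s * qs lam s a b + (1 - s) * shiftw (qs lam s a) b.
Proof.
have -> : shiftw (qs lam s a) b =
   \sum_(k < a.+1) 'C(a, k)%:R * (1 - s) ^+ k * s ^+ (a - k) * pterm lam s b k.+1.
  by case: b => [|b] /=; [rewrite big1// => k _; rewrite mulr0|rewrite qsE].
rewrite !qsE; set P := pterm lam s b.
rewrite big_ord_recl /= bin0 !mul1r subn0.
have -> : \sum_(i < a.+1) 'C(a.+1, bump 0 i)%:R * (1 - s) ^+ bump 0 i *
     s ^+ (a.+1 - bump 0 i) * P (bump 0 i) =
  \sum_(i < a.+1) ('C(a, i.+1)%:R * (1 - s) ^+ i.+1 * s ^+ (a - i) * P i.+1) +
  (1 - s) * \sum_(i < a.+1) ('C(a, i)%:R * (1 - s) ^+ i * s ^+ (a - i) * P i.+1).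
  rewrite mulr_sumr -big_split; apply: eq_bigr => i _ /=.
  by rewrite /bump/= add1n subSS binS natrD exprS; ring.
rewrite addrA; congr (_ + _).
have -> : s ^+ a.+1 * P 0%N + \sum_(i < a.+1)
     'C(a, i.+1)%:R * (1 - s) ^+ i.+1 * s ^+ (a - i) * P i.+1 =
   \sum_(i < a.+2) 'C(a, i)%:R * (1 - s) ^+ i * s ^+ (a.+1 - i) * P i.
  rewrite [RHS]big_ord_recl /= bin0 !mul1r subn0.
  by congr (_ + _); apply: eq_bigr => i _; rewrite /bump/= add1n subSS.
rewrite big_ord_recr/= bin_small// !mul0r addr0 mulr_sumr.
apply: eq_bigr => i _; rewrite subSn; last by rewrite -ltnS.
by rewrite exprS; ring.
Qed.

Lemma exp_term_le (x : R) n : 0 <= x -> x ^+ n / n`!%:R <= expR x.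
Proof.
move=> x0; case: n => [|n]; first by rewrite expr0 divr1 -expR0 ler_expR.
by apply: le_trans (expR_ge1Dxn n x0); rewrite lerDr.
Qed.

(** The range |s| <= 2 contains a neighbourhood of [0, 1], so continuity at the endpoints is
    two-sided. In 6 lam, 2 lam bounds the exponential factor and 4 lam comes from (4 lam)^n / n! <=
    e^(4 lam). One step of [qs_rec] costs |s| + 2 |1 - s| <= 8. *)
Lemma geo_qs lam s a : 0 <= lam -> `|s| <= 2 -> geo (8 ^+ a * expR (6 * lam)) (qs lam s a).
Proof.
move=> l0 s2; elim: a => [|a IH].
  move=> n; rewrite qs0E mul1r.
  have e1 : expR (- (lam * s)) <= expR (2 * lam).
    rewrite ler_expR; move: s2; rewrite ler_norml; nra.
  rewrite !normrM normrX normfV normr_nat (ger0_norm (expR_ge0 _)).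
  have -> : 6 * lam = 2 * lam + 4 * lam by ring.
  rewrite expRD mulrAC mulrC -mulrA ler_pM ?expR_ge0//.
  rewrite normrM (ger0_norm l0) ler_pdivrMr ?ltr0n ?fact_gt0//.
  have := exp_term_le n (mulr_ge0 (ler0n R 4) l0).
  rewrite ler_pdivrMr ?ltr0n ?fact_gt0// => h.
  have e2 : (lam * `|s|) ^+ n <= (2 * lam) ^+ n.
    by apply: lerXn2r; rewrite ?nnegrE ?mulr_ge0//; nra.
  apply: le_trans e2 _.
  have -> : 2 * lam = (4 * lam) * 2^-1 by field.
  by rewrite exprMn mulrAC ler_wpM2r// exprn_ge0// invr_ge0.
have C0 : 0 <= 8 ^+ a * expR (6 * lam) by exact: geo_ge0 IH.
rewrite (_ : qs lam s a.+1 = (fun n => s * qs lam s a n + ((1 - s) * shiftw (qs lam s a) n + 0))); last first.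
  by apply/funext => n; rewrite addr0 qs_rec.
have g0 : geo 0 (fun=> 0 : R) by move=> n; rewrite normr0 mul0r.
apply: geoW (geo_lin s IH (geo_lin (1 - s) (geo_shiftw IH) g0)).
rewrite exprS; set C := _ * expR _ in C0 *; rewrite -mulrA -/C.
have : `|1 - s| <= 3 by apply: le_trans (ler_normB _ _) _; rewrite normr1; lra.
have := normr_ge0 s; have := normr_ge0 (1 - s); nra.
Qed.

Lemma qs_at0 lam a b : qs lam 0 a b = (b == a)%:R.
Proof.
elim: a b => [|a IH] b.
  rewrite qs0E mulr0 oppr0 expR0 mulr1 expr0n; case: b => [|b] //=.
    by rewrite divr1.
  by rewrite mul0r.
by rewrite qs_rec mul0r add0r subr0 mul1r; case: b => [|b] //=.
Qed.

Lemma qs_at1 lam a b : qs lam 1 a b = Defs.poisson_pmf lam b.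
Proof.
elim: a b => [|a IH] b; last by rewrite qs_rec mul1r subrr mul0r addr0.
by rewrite qs0E mulr1 /Defs.poisson_pmf (mulrC (lam ^+ b)).
Qed.

(** The recursion arranged to isolate 1 - s, the factor that later lets Delta_k cancel the singular
    weight. *)
Lemma qs_diff lam s a b :
  qs lam s a.+1 b = (1 - s) * (shiftw (qs lam s a) b - qs lam s a b) + qs lam s a b.
Proof. by rewrite qs_rec; ring. Qed.

(** As s grows the immigration mean gains at rate lam while each of the a points loses survival
    probability at unit rate. At a = 0 the value [a.-1] is harmless beside the factor a. *)
Definition qsD lam s a b : R :=
  lam * (shiftw (qs lam s a) b - qs lam s a b)
  - a%:R * (shiftw (qs lam s a.-1) b - qs lam s a.-1 b).

Lemma qs_derive lam s a b : is_derive s 1 (fun s => qs lam s a b) (qsD lam s a b).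
Proof.
elim: a b => [|a IH] b.
  under eq_fun do rewrite qs0E.
  have dl : is_derive s 1 (fun s => lam * s) lam.
    by apply: is_derive_eq (is_derive1Z _ (is_derive1_id _)) _; rewrite mulr1.
  have dl' : is_derive s 1 (fun s => - (lam * s)) (- lam) by exact: is_deriveN.
  have dX : is_derive s 1 (fun s => (lam * s) ^+ b) (b%:R * (lam * s) ^+ b.-1 * lam).
    exact: is_derive1X dl.
  have de := @is_derive1_comp _ expR (fun s => - (lam * s)) _ _ _ (is_derive_expR _) dl'.
  rewrite /qsD mul0r subr0.
  under eq_fun do rewrite mulrC.
  apply: is_derive_eq (is_derive1Z _ (is_derive1M dX de)) _ => /=.
  case: b {dX} => [|b] /=.
    by rewrite !qs0E /= expr0 !mul1r fact0; field.
  rewrite !qs0E factS natrM exprS.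
  have N0 : (b.+1%:R : R) != 0 by rewrite pnatr_eq0.
  have F0 : (b`!%:R : R) != 0 by rewrite pnatr_eq0 -lt0n fact_gt0.
  move: N0 F0; move: (b.+1%:R : R) (b`!%:R : R) => N F N0 F0.
  by field; rewrite N0 F0.
under eq_fun do rewrite qs_rec.
have d1s : is_derive s 1 (fun s => 1 - s) (- 1).
  apply: is_derive_eq (is_derive1D (is_derive1_cst 1 _) (is_deriveN (is_derive1_id _))) _.
  by rewrite add0r.
have dsh : is_derive s 1 (fun s => shiftw (qs lam s a) b) (shiftw (qsD lam s a) b).
  by case: b => [|b] /=; [exact: is_derive1_cst|exact: IH].
apply: is_derive_eq (is_derive1D (is_derive1M (is_derive1_id s) (IH b)) (is_derive1M d1s dsh)) _.
have sh2 : shiftw (qs lam s a.+1) b = s * shiftw (qs lam s a) b +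
    (1 - s) * shiftw (shiftw (qs lam s a)) b.
  by case: b {IH dsh} => [|b] /=; [ring|rewrite qs_rec].
have shD : shiftw (qsD lam s a) b =
   lam * (shiftw (shiftw (qs lam s a)) b - shiftw (qs lam s a) b)
  - a%:R * (shiftw (shiftw (qs lam s a.-1)) b - shiftw (qs lam s a.-1) b).
  by case: b {IH dsh sh2} => [|b] //=; ring.
rewrite shD /qsD /= sh2 qs_rec -natr1.
(* What remains is [qs_rec] one level down. It is stated with the factor a so that it also holds at
   a = 0, where there is no lower level. *)
suff : a%:R * (shiftw (qs lam s a) b - qs lam s a b) =
   a%:R * (s * (shiftw (qs lam s a.-1) b - qs lam s a.-1 b) +
   (1 - s) * (shiftw (shiftw (qs lam s a.-1)) b - shiftw (qs lam s a.-1) b)).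
  move=> h; rewrite !mulrDl mul1r h; ring.
case: a {IH dsh sh2 shD} => [|a]; first by rewrite !mul0r.
have -> : shiftw (qs lam s a.+1) b = s * shiftw (qs lam s a) b +
    (1 - s) * shiftw (shiftw (qs lam s a)) b.
  by case: b => [|b] /=; [ring|rewrite qs_rec].
rewrite qs_rec /=; ring.
Qed.

Lemma geo_qsD lam s a : 0 <= lam -> `|s| <= 2 ->
  geo ((3 * lam + 3 * a%:R) * (8 ^+ a * expR (6 * lam))) (qsD lam s a).
Proof.
move=> l0 s2.
have H c : geo (3 * (8 ^+ c * expR (6 * lam))) (fun b => shiftw (qs lam s c) b - qs lam s c b).
  have g := geo_qs c l0 s2.
  have := geo_lin (- 1) g (geo_shiftw g); rewrite normrN normr1 mul1r.
  rewrite (_ : (fun n => _ + _) = (fun b => shiftw (qs lam s c) b - qs lam s c b)).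
    by apply: geoW; set X := _ * _; lra.
  by apply/funext => n; ring.
have g0 : geo 0 (fun=> 0 : R) by move=> n; rewrite normr0 mul0r.
have := geo_lin lam (H a) (geo_lin (- a%:R) (H a.-1) g0).
rewrite (_ : (fun n => _ + _) = qsD lam s a); last first.
  by apply/funext => n; rewrite /qsD; ring.
apply: geoW; rewrite normrN normr_nat ger0_norm// addr0.
have E8 : (8 : R) ^+ a.-1 <= 8 ^+ a.
  by apply: ler_weXn2l; [rewrite ler1n|exact: leq_pred].
have : a%:R * (8 ^+ a.-1 * expR (6 * lam)) <= a%:R * (8 ^+ a * expR (6 * lam)).
  by rewrite ler_wpM2l// ler_wpM2r// expR_ge0.
by set X := 8 ^+ a * _; set Y := 8 ^+ _ * _; lra.
Qed.

End ThinnedPoisson.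

(** * Integrals over [0, 1] with an integrable singularity at 1 *)

Section SingularIntegral.
Context {R : realType}.
Set Implicit Arguments.
Unset Strict Implicit.
Notation mu := (@lebesgue_measure R).
Notation Rint := Defs.Rint.
Implicit Types (f g F : R -> R) (C D c s : R).

(** For s >= 1 the default values make this 0; bounds by [kap] are therefore only stated on the open
    interval. *)
Definition kap s : R := (Num.sqrt (1 - s))^-1.

Lemma kap_ge0 s : 0 <= kap s.
Proof. by rewrite invr_ge0 sqrtr_ge0. Qed.

Lemma is_derive1_onem s : is_derive s 1 (fun s : R => 1 - s) (- 1).
Proof.
apply: is_derive_eq (is_derive1D (is_derive1_cst 1 _) (is_deriveN (is_derive1_id _))) _.
by rewrite add0r.
Qed.

Lemma sqrt_onem_continuous : continuous (fun s : R => Num.sqrt (1 - s)).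
Proof.
move=> s; apply: (@continuous_comp _ _ _ (fun s : R => 1 - s) Num.sqrt).
  exact: is_derive1_continuous (is_derive1_onem s).
exact: sqrt_continuous.
Qed.

Lemma is_derive1_sqrt_onem s : s < 1 ->
  is_derive s 1 (fun s => Num.sqrt (1 - s)) (- (2^-1 * kap s)).
Proof.
move=> s1; have h : 0 < 1 - s by rewrite subr_gt0.
apply: is_derive_eq (@is_derive1_comp _ Num.sqrt (fun s => 1 - s) _ _ _ (is_derive1_sqrt h) (is_derive1_onem s)) _.
by rewrite /kap invfM mulrN1.
Qed.

Lemma kap_continuous s : s < 1 -> {for s, continuous kap}.
Proof.
move=> s1; apply: cvgV; last exact: sqrt_onem_continuous.
by rewrite gt_eqF// sqrtr_gt0 subr_gt0.
Qed.

(** Exhaustion by compact intervals, on each of which the primitive -2 sqrt(1 - s) bounds the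
    integral by 2. *)
Lemma kap_integral_lty : (\int[mu]_(s in `]0%R, 1%R[) (kap s)%:E < +oo)%E.
Proof.
(* The shift by 2 keeps the right endpoint strictly between 0 and 1 even at n = 0. *)
pose A (n : nat) : set R := [set` `[0, 1 - n.+2%:R^-1]].
have A1 n x : A n x -> x < 1.
  rewrite /A/= in_itv/= => /andP[_ h]; apply: le_lt_trans h _.
  by rewrite ltrBlDr ltrDl invr_gt0.
have mA n : measurable (A n) by exact: measurable_itv.
have cA n : {within A n, continuous kap}.
  apply: continuous_in_subspaceT => x xA; apply: kap_continuous; apply: (A1 n).
  exact: set_mem xA.
have mk n : measurable_fun (A n) (EFin \o kap).
  by apply/measurable_EFinP; exact: subspace_continuous_measurable_fun.
have cv : (\int[mu]_(x in A i) (kap x)%:E)%E @[i --> \oo] -->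
    (\int[mu]_(x in \bigcup_i A i) (kap x)%:E)%E.
  apply: ge0_nondecreasing_set_cvg_integral => //.
  - move=> n m nm; apply/subsetPset => x; rewrite /A/= !in_itv/= => /andP[-> h] /=.
    apply: le_trans h _; rewrite lerD2l lerN2 lef_pV2 ?posrE ?ltr0n// ler_nat.
    by rewrite !ltnS.
  - by move=> n x _; rewrite lee_fin kap_ge0.
apply: (@le_lt_trans _ _ 2%:E); last by rewrite ltry.
have sub : `]0%R, 1%R[ `<=` \bigcup_i A i.
  move=> x; rewrite /= in_itv/= => /andP[x0 x1].
  have : \forall n \near \oo, n.+1%:R^-1 < 1 - x.
    by apply: near_infty_natSinv_lt (PosNum (_ : 0 < 1 - x)); rewrite subr_gt0.
  move=> [n _ /(_ n.+1) /=]; rewrite leqnSn => /(_ isT) h.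
  exists n => //; rewrite /A/= in_itv/= (ltW x0)/= lerBrDr addrC -lerBrDr; exact: ltW.
apply: (@le_trans _ _ (\int[mu]_(x in \bigcup_i A i) (kap x)%:E)%E).
  apply: ge0_subset_integral => //=.
  - by apply: bigcup_measurable => i _; exact: mA.
  - by apply/measurable_fun_bigcup => // i; exact: mk.
  - by move=> x _; rewrite lee_fin kap_ge0.
apply: cvge_le cv; apply: nearW => n.
pose Q s := - (2 * Num.sqrt (1 - s)).
have n1 : 0 < 1 - n.+2%:R^-1 :> R by rewrite subr_gt0 invf_lt1 ?ltr0n// ltr1n.
have n2 : 1 - n.+2%:R^-1 < 1 :> R by rewrite ltrBlDr ltrDl invr_gt0.
have cQ : continuous Q.
  by move=> s; apply: cvgN; apply: cvgMl_tmp; exact: sqrt_onem_continuous.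
have dQ s : s < 1 -> is_derive s 1 Q (kap s).
  move=> s1; apply: is_derive_eq (is_deriveN (is_derive1Z 2 (is_derive1_sqrt_onem s1))) _.
  by field.
rewrite (@continuous_FTC2 _ kap Q 0 (1 - n.+2%:R^-1))//.
- rewrite -EFinB lee_fin /Q subr0 sqrtr1.
  by have := sqrtr_ge0 (1 - (1 - n.+2%:R^-1) : R); lra.
- exact: (cA n).
- split => [x||].
  + rewrite in_itv/= => /andP[_ x1].
    by have /@ex_derive := dQ x (lt_trans x1 n2).
  + by apply: cvg_at_right_filter; exact: cQ.
  + by apply: cvg_at_left_filter; exact: cQ.
- move=> x; rewrite in_itv/= => /andP[_ x1]; rewrite derive1E.
  by have /@derive_val := dQ x (lt_trans x1 n2).
Qed.

Lemma kap_integrable : mu.-integrable `[0, 1] (EFin \o kap).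
Proof.
have mk : measurable_fun (`]0, 1[ : set R) kap.
  apply: open_continuous_measurable_fun; first exact: interval_open.
  by move=> x; rewrite inE/= in_itv/= => /andP[_]; exact: kap_continuous.
apply/integrableP; split.
  by apply/measurable_EFinP; exact: measurable_fun_itv_cc mk.
rewrite integral_itv_bndoo; last first.
  by apply: measurableT_comp => //; exact/measurable_EFinP.
under eq_integral do rewrite /= ger0_norm ?kap_ge0//.
exact: kap_integral_lty.
Qed.

Lemma kapZ_integrable (c : R) : mu.-integrable `]0, 1[ (EFin \o (fun s => c * kap s)).
Proof.
rewrite (_ : _ \o _ = (fun s : R => (c%:E * (kap s)%:E)%E))//.
apply: integrableZl => //; apply: integrableS kap_integrable => //.
exact: subset_itv_oo_cc.
Qed.

(** Continuity inside gives measurability and the bound gives integrability; values at 0 and 1 are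
    left free. *)
Definition singular C f :=
  (forall s, s \in `]0, 1[ -> {for s, continuous f}) /\
  (forall s, s \in `]0, 1[ -> `|f s| <= C * kap s).

Lemma singular_measurable C f : singular C f -> measurable_fun (`]0, 1[ : set R) f.
Proof.
move=> [cf _]; apply: open_continuous_measurable_fun; first exact: interval_open.
by move=> x; rewrite inE; exact: cf.
Qed.

Lemma singular_integrable C f : singular C f -> mu.-integrable `[0, 1] (EFin \o f).
Proof.
move=> sf; have mf := singular_measurable sf.
apply/integrableP; split.
  by apply/measurable_EFinP; exact: measurable_fun_itv_cc mf.
rewrite integral_itv_bndoo; last first.
  by apply: measurableT_comp => //; exact/measurable_EFinP.
have iK := kapZ_integrable `|C|.
have /integrableP[mK] := iK; apply: le_lt_trans.
apply: ge0_le_integral => //.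
- by apply: measurableT_comp => //; exact/measurable_EFinP.
- exact: measurableT_comp.
- move=> s s01; rewrite /= lee_fin; apply: le_trans (sf.2 _ s01) _.
  rewrite (le_trans (ler_norm _))// !normrM normr_id//.
Qed.

Lemma singular_Rint_oo C f : singular C f -> Rint `[0, 1] f = Rint `]0, 1[ f.
Proof.
move=> sf; rewrite /Rint integral_itv_bndoo//; apply/measurable_EFinP.
exact: singular_measurable sf.
Qed.

Lemma singular_ext C f g : (forall s, s \in `]0, 1[ -> f s = g s) ->
  singular C f -> singular C g.
Proof.
move=> fg [cf bf]; split => s s01; last by rewrite -fg// bf.
have := cf s s01; rewrite /prop_for /continuous_at (fg s s01); apply: cvg_trans.
apply: near_eq_cvg; have : \forall y \near s, y \in `]0, 1[ by exact: near_in_itvoo.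
by apply: filterS => y /fg.
Qed.

Lemma Rint_singular_eq C f g : singular C f ->
  (forall s, s \in `]0, 1[ -> f s = g s) -> Rint `[0, 1] f = Rint `[0, 1] g.
Proof.
move=> sf fg; rewrite (singular_Rint_oo sf) (singular_Rint_oo (singular_ext fg sf)).
by apply: eq_Rintegral => s; rewrite inE; exact: fg.
Qed.

Lemma singular_lin C D c f g : singular C f -> singular D g ->
  singular (`|c| * C + D) (fun s => c * f s + g s).
Proof.
move=> [cf bf] [cg bg]; split => s s01.
  by apply: cvgD; [apply: cvgMl_tmp; exact: cf|exact: cg].
apply: le_trans (ler_normD _ _) _; rewrite mulrDl; apply: lerD; last exact: bg.
by rewrite normrM -mulrA ler_wpM2l// bf.
Qed.

Lemma singular0 : singular 0 (fun=> 0).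
Proof. by split => s _; [exact: cvg_cst|rewrite normr0 mul0r]. Qed.

Lemma Rint_singular_lin C D c f g : singular C f -> singular D g ->
  Rint `[0, 1] (fun s => c * f s + g s) = c * Rint `[0, 1] f + Rint `[0, 1] g.
Proof.
move=> sf sg.
have i1 := singular_integrable sf; have i2 := singular_integrable sg.
rewrite -[c * Rint _ _]RintegralZl// -[RHS]RintegralD//.
by rewrite (_ : _ \o _ = (fun s : R => (c%:E * (f s)%:E)%E))//; exact: integrableZl.
Qed.

Lemma singular_sum (I : Type) (r : seq I) C (f : I -> R -> R) (c : I -> R) :
  (forall i, singular C (f i)) ->
  exists D, singular D (fun s => \sum_(i <- r) c i * f i s) /\
  Rint `[0, 1] (fun s => \sum_(i <- r) c i * f i s) =
  \sum_(i <- r) c i * Rint `[0, 1] (f i).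
Proof.
move=> sf; elim: r => [|i r [D [IH1 IH2]]].
  exists 0; under eq_fun do rewrite big_nil; split; first exact: singular0.
  by rewrite big_nil [LHS]Rintegral_cst// mul0r.
exists (`|c i| * C + D); under eq_fun do rewrite big_cons.
split; first exact: singular_lin (sf i) IH1.
by rewrite big_cons (Rint_singular_lin _ (sf i) IH1) IH2.
Qed.

(** The constant for [f t] may vary with t: it only ensures integrability, whereas the derivative is
    dominated uniformly by D. *)
Lemma Rint_singular_derive (f f' : R -> R -> R) (D u v : R) :
  (forall t, t \in `]u, v[ -> exists C, singular C (f t)) ->
  (forall t, t \in `]u, v[ -> singular D (f' t)) ->
  (forall t s, t \in `]u, v[ -> s \in `]0, 1[ -> is_derive t 1 (f ^~ s) (f' t s)) ->
  forall t, t \in `]u, v[ ->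
  is_derive t 1 (fun t => Rint `[0, 1] (f t)) (Rint `[0, 1] (f' t)).
Proof.
move=> sf sf' df t tuv.
have d1 y s : y \in `]u, v[ -> s \in `]0, 1[ -> partial1of2 f y s = f' y s.
  by move=> yuv s01; rewrite partial1of2E; have /@derive_val := df y s yuv s01.
pose G s := `|D| * kap s.
have iG := kapZ_integrable `|D|.
have G0 s : 0 <= G s by rewrite mulr_ge0// kap_ge0.
have iF y : y \in `]u, v[ -> mu.-integrable `]0, 1[ (EFin \o f y).
  move=> /sf[C /singular_integrable]; apply: integrableS => //.
  exact: subset_itv_oo_cc.
have derF y s : y \in `]u, v[ -> s \in `]0, 1[ -> derivable (f ^~ s) y 1.
  by move=> yuv s01; have /@ex_derive := df y s yuv s01.
have Gub y s : y \in `]u, v[ -> s \in `]0, 1[ -> `|partial1of2 f y s| <= G s.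
  move=> yuv s01; rewrite d1//; apply: le_trans ((sf' y yuv).2 s s01) _.
  by rewrite ler_wpM2r ?kap_ge0// ler_norm.
have m01 : measurable (`]0, 1[ : set R) by exact: measurable_itv.
have D1 := @derivable_under_integral R _ _ mu f _ m01 t u v tuv iF derF G G0 iG Gub.
have D2 := @differentiation_under_integral R _ _ mu f _ m01 t u v tuv iF derF G G0 iG Gub.
have D3 : is_derive t 1 (fun t => Rint `]0, 1[ (f t)) (Rint `]0, 1[ (f' t)).
  apply: DeriveDef => //; rewrite -derive1E D2.
  by apply: eq_Rintegral => s; rewrite inE => s01; rewrite d1.
rewrite (singular_Rint_oo (sf' t tuv)).
apply: near_eq_is_derive D3.
have : \forall y \near t, y \in `]u, v[ by exact: near_in_itvoo.
by apply: filterS => y /sf[C] /singular_Rint_oo ->.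
Qed.

(** As f may blow up at 1, the indefinite integral H is compared with F: H - F has zero derivative
    inside and is continuous up to the endpoints, hence constant. *)
Lemma Rint_singular_FTC C F f : {within `[0, 1], continuous F} ->
  (forall s, s \in `]0, 1[ -> is_derive s 1 F (f s)) -> singular C f ->
  Rint `[0, 1] f = F 1 - F 0.
Proof.
move=> cF dF sf; have iF := singular_integrable sf.
pose H (b : R) := \int[mu]_(t in `[0, b]) f t.
have cH : {within `[0, 1], continuous H}.
  exact: parameterized_integral_continuous.
have dH s : s \in `]0, 1[ -> is_derive s 1 H (f s).
  move=> s01; have := s01; rewrite in_itv/= => /andP[s0 s1].
  have [d1 d2] := continuous_FTC1_closed s1 iF s0 (sf.1 s s01).
  by apply: DeriveDef => //; rewrite -derive1E.
have dG s : s \in `]0, 1[ -> is_derive s 1 (fun s => H s - F s) ((fun=> 0) s).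
  move=> s01; apply: is_derive_eq (is_derive1D (dH s s01) (is_deriveN (dF s s01))) _.
  by rewrite subrr.
have cG : {within `[0, 1], continuous (fun s => H s - F s)}.
  by move=> x; apply: cvgB; [exact: cH|exact: cF].
have [c _] := MVT_segment ler01 dG cG.
rewrite mul0r /H set_itv1 Rintegral_set1.
rewrite [Rint _ _](_ : _ = \int[mu]_(t in `[0, 1]) f t)//.
by move=> h; lra.
Qed.

(* Since the derivative is O((1 - s)^(-1/2)), F s - F 1 is O((1 - s)^(1/2)); this
   makes the integrand (2 (1 - s))^(-1) (T_s h - E h(Z, N)) of f_h integrable. *)
Lemma singular_primitive_bound C F f : {within `[0, 1], continuous F} ->
  (forall s, s \in `]0, 1[ -> is_derive s 1 F (f s)) -> singular C f ->
  forall s, s \in `]0, 1[ -> `|F s - F 1| <= (2 * C) * Num.sqrt (1 - s).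
Proof.
move=> cF dF sf s s01; have := s01; rewrite in_itv/= => /andP[s0 s1].
have sub x : x \in `]s, 1[ -> x \in `]0, 1[.
  by rewrite !in_itv/= => /andP[sx ->]; rewrite (lt_trans s0).
have dP x : x \in `]s, 1[ -> is_derive x 1 (fun s => (2 * C) * Num.sqrt (1 - s)) (- (C * kap x)).
  rewrite in_itv/= => /andP[_ x1].
  by apply: is_derive_eq (is_derive1Z _ (is_derive1_sqrt_onem x1)) _; field.
have subc : `[s, 1] `<=` `[0, 1] by apply: subset_itvr; rewrite bnd_simp ltW.
have cFs : {within `[s, 1], continuous F} by exact: continuous_subspaceW cF.
have cPs : {within `[s, 1], continuous (fun s => (2 * C) * Num.sqrt (1 - s))}.
  by apply: continuous_subspaceT => x; apply: cvgMl_tmp; exact: sqrt_onem_continuous.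
(* The sign e treats both inequalities at once. The comparison function 2 C sqrt(1 - s) has
   derivative -C [kap], so the difference is monotone. *)
have key (e : R) : `|e| = 1 -> e * (F s - F 1) <= (2 * C) * Num.sqrt (1 - s).
  move=> e1.
  have dK x : x \in `]s, 1[ -> is_derive x 1
     (fun s => e * F s + - ((2 * C) * Num.sqrt (1 - s))) (e * f x + C * kap x).
    move=> xs; apply: is_derive_eq (is_derive1D (is_derive1Z e (dF x (sub x xs))) (is_deriveN (dP x xs))) _.
    by rewrite opprK.
  have cK : {within `[s, 1], continuous (fun s => e * F s + - ((2 * C) * Num.sqrt (1 - s)))}.
    by move=> x; apply: cvgB; [apply: cvgMl_tmp; exact: cFs|exact: cPs].
  have [c cs] := MVT s1 dK cK.
  rewrite subrr sqrtr0 mulr0 oppr0 addr0 => h.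
  have : 0 <= (e * f c + C * kap c) * (1 - s).
    rewrite mulr_ge0 ?subr_ge0 ?(ltW s1)//.
    have := sf.2 c (sub c cs); rewrite -[`|f c|]mul1r -e1 -normrM ler_norml; lra.
  by rewrite -h; lra.
rewrite ler_norml; apply/andP; split.
  by have := key (-1); rewrite normrN normr1 => /(_ erefl); lra.
by have := key 1; rewrite normr1 mul1r => /(_ erefl).
Qed.

End SingularIntegral.

(** * Gram factorization of covariance matrices *)

Section Cholesky.
Context {R : rcfType}.
Set Implicit Arguments.
Unset Strict Implicit.

Definition psd d (S : 'M[R]_d) := forall u : 'rV[R]_d, 0 <= (u *m S *m u^T) 0 0.

Lemma quadratic_block d (a : 'M[R]_1) (v : 'rV[R]_d) (S : 'M[R]_d) (t : R) (u : 'rV[R]_d) :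
  (row_mx t%:M u *m block_mx a v v^T S *m (row_mx t%:M u)^T) 0 0 =
  t ^+ 2 * a 0 0 + 2 * t * (u *m v^T) 0 0 + (u *m S *m u^T) 0 0.
Proof.
rewrite mul_row_block tr_row_mx mul_row_col !mulmxDl tr_scalar_mx.
rewrite !mul_mx_scalar !mul_scalar_mx -scalemxAl.
have -> : v *m u^T = u *m v^T.
  apply/matrixP => i j; rewrite !ord1 !mxE; apply: eq_bigr => k _.
  by rewrite !mxE mulrC.
by rewrite !mxE; ring.
Qed.

(* Induction on the dimension: the first row of the factor is a multiple of the
   first row of S, and the Schur complement is again positive semidefinite. *)
Lemma psd_gram d (S : 'M[R]_d) : S^T = S -> psd S -> exists A : 'M[R]_d, A^T *m A = S.
Proof.
elim: d S => [|d IH] S sS pS.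
  by exists 0; rewrite mulmx0 [RHS]flatmx0.
move: S sS pS; rewrite -[d.+1]/(1 + d)%N => S; rewrite -[S]submxK.
move: (@ulsubmx _ 1 d 1 d S) (@ursubmx _ 1 d 1 d S) (@dlsubmx _ 1 d 1 d S) (@drsubmx _ 1 d 1 d S) => a v w B.
rewrite tr_block_mx => /eq_block_mx[_ _ vw sB]; rewrite -vw => {w vw} pS.
have q t u := pS (row_mx t%:M u).
have {}q t (u : 'rV_d) : 0 <= t ^+ 2 * a 0 0 + 2 * t * (u *m v^T) 0 0 + (u *m B *m u^T) 0 0.
  by rewrite -quadratic_block.
have pB : psd B by move=> u; have := q 0 u; rewrite expr0n/= !(mul0r,mulr0) !add0r.
have a0 : 0 <= a 0 0.
  by have := q 1 0; rewrite !mul0mx !mxE expr1n mul1r mulr0 !addr0.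
have aE : a = (a 0 0)%:M by rewrite [LHS]mx11_scalar.
move: a0; rewrite le_eqVlt => /predU1P[a0|a0].
  have v0 (u : 'rV_d) : (u *m v^T) 0 0 = 0.
    apply/eqP; apply/negPn/negP => n0.
    (* With a = 0 the form is affine in t; this t makes its value -1. *)
    have := q (- ((u *m B *m u^T) 0 0 + 1) / (2 * (u *m v^T) 0 0)) u.
    rewrite -a0 mulr0 add0r; set x := (u *m v^T) 0 0; set y := (u *m B *m u^T) 0 0.
    rewrite (_ : _ + _ = -1); last by field; rewrite n0.
    by rewrite oppr_ge0 ler10.
  have {}v0 : v = 0.
    apply/rowP => j; rewrite mxE; have := v0 (delta_mx 0 j).
    by rewrite -rowE !mxE.
  have [A HA] := IH B sB pB.
  exists (block_mx (0 : 'M[R]_1) 0 0 A); rewrite tr_block_mx !trmx0 mulmx_block.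
  rewrite !(mulmx0, mul0mx, add0r, addr0) HA aE -a0 v0 trmx0; congr block_mx.
  by apply/matrixP => i j; rewrite !mxE mul0rn.
have pB' : psd (B - (a 0 0)^-1 *: (v^T *m v)).
  (* The minimiser in t of the quadratic form; its minimum is the Schur complement. *)
  move=> u; have := q (- (a 0 0)^-1 * (u *m v^T) 0 0) u.
  rewrite mulmxBr mulmxBl [X in _ <= X -> _](_ : _ =
    (u *m B *m u^T) 0 0 - (a 0 0)^-1 * (u *m v^T) 0 0 ^+ 2); last by field; rewrite gt_eqF.
  rewrite [X in _ -> _ <= X]mxE [X in _ -> _ <= _ + X]mxE; congr (_ <= _ - _).
  rewrite -scalemxAr -scalemxAl [in RHS]mxE; congr (_ * _).
  rewrite mulmxA -(mulmxA (u *m v^T)) [RHS]mxE big_ord1 expr2; congr (_ * _).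
  by rewrite !mxE; apply: eq_bigr => k _; rewrite !mxE mulrC.
have sB' : (B - (a 0 0)^-1 *: (v^T *m v))^T = B - (a 0 0)^-1 *: (v^T *m v).
  by rewrite linearB/= linearZ/= trmx_mul trmxK sB.
have [A HA] := IH _ sB' pB'.
set r := Num.sqrt (a 0 0).
have r0 : r != 0 by rewrite gt_eqF// sqrtr_gt0.
have rr : r * r = a 0 0 by rewrite -expr2 sqr_sqrtr// ltW.
exists (block_mx r%:M (r^-1 *: v) 0 A).
rewrite tr_block_mx trmx0 tr_scalar_mx mulmx_block !(mulmx0, mul0mx, add0r, addr0).
rewrite -scalar_mxM rr -aE mul_scalar_mx scalerA mulfV// scale1r HA.
rewrite linearZ/= mul_mx_scalar scalerA mulfV// scale1r -scalemxAl -scalemxAr scalerA.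
by rewrite -invfM rr addrC subrK.
Qed.

End Cholesky.

(** * Directional and mixed derivatives *)

Section MultivariateCalculus.
Context {R : realType} {d : nat}.
Set Implicit Arguments.
Unset Strict Implicit.
Implicit Types (g : 'rV[R]_d -> R) (x v : 'rV[R]_d).

Lemma derive_pd g x v : differentiable g x -> 'D_v g x = \sum_j v 0 j * pd j g x.
Proof.
move=> dg; rewrite deriveE// {1}(row_sum_delta v) linear_sum; apply: eq_bigr => j _.
by rewrite linearZ/= /pd deriveE.
Qed.

Lemma is_derive1_scale (a : R -> R) (t a' : R) v : is_derive t 1 a a' ->
  is_derive t 1 (fun t => a t *: v) (a' *: v).
Proof.
move=> da; have d1 : differentiable a t by apply/derivable1_diffP; have /@ex_derive := da.
apply: DeriveDef; first by apply/derivable1_diffP; exact: differentiableZl.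
rewrite deriveE; last exact: differentiableZl.
by rewrite diffZl// -deriveE//; have /@derive_val -> := da.
Qed.

Lemma is_derive1_chain g (c : R -> 'rV[R]_d) (t : R) v : differentiable g (c t) ->
  is_derive t 1 c v -> is_derive t 1 (fun t => g (c t)) (\sum_j v 0 j * pd j g (c t)).
Proof.
move=> dg dc; have d1 : differentiable c t by apply/derivable1_diffP; have /@ex_derive := dc.
have d2 : differentiable (g \o c) t by exact: differentiable_comp.
apply: DeriveDef; first by apply/derivable1_diffP.
rewrite -derive_pd// deriveE// (_ : (fun t => g (c t)) = g \o c)// diff_comp//=.
rewrite [RHS]deriveE//; congr ('d g (c t) _).
by rewrite -deriveE//; have /@derive_val := dc.
Qed.

Lemma is_derive1_line x v (t : R) : is_derive t 1 (fun t => x + t *: v) v.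
Proof.
have h : is_derive t 1 (fun t : R => t *: v) v.
  by apply: is_derive_eq (is_derive1_scale v (is_derive1_id t)) _; rewrite scale1r.
have hc : is_derive t 1 (fun _ : R => x) 0 by exact: is_derive_cst.
by have := is_deriveD hc h; rewrite add0r.
Qed.

Lemma line_continuous x v : continuous (fun t : R => x + t *: v).
Proof.
move=> t; apply: differentiable_continuous; apply/derivable1_diffP.
by have /@ex_derive := is_derive1_line x v t.
Qed.

Lemma is_derive_line g x v (t l : R) :
  is_derive (x + t *: v) v g l -> is_derive t 1 (fun t => g (x + t *: v)) l.
Proof.
move=> dg; apply: is_derive1_cvg; have [/cvg_ex[/= l' h] hl] := dg.
have e : l' = l by rewrite -hl; apply/esym/cvg_lim.
move: h; rewrite e; apply: cvg_trans; rewrite (_ : (fun h => _) =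
  (fun h : R => h^-1 *: (g (h *: v + (x + t *: v)) - g (x + t *: v))))//.
apply/funext => h; congr (_ *: (g _ - _)).
by rewrite scalerDl addrCA.
Qed.

(** Allows directional derivatives of integrals and series to be computed with a real parameter,
    where dominated differentiation is available. *)
Lemma line_is_derive g x v (l : R) :
  is_derive (0 : R) 1 (fun t => g (x + t *: v)) l -> is_derive x v g l.
Proof.
move=> /is_derive1_cvgE h.
have {}h : h^-1 *: ((g \o shift x) (h *: v) - g x) @[h --> (0 : R)^'] --> l.
  move: h; rewrite scale0r addr0; apply: cvg_trans.
  rewrite (_ : (fun h => _) = (fun h : R => h^-1 *: (g (x + (h + 0) *: v) - g x)))//.
  by apply/funext => h; rewrite /= addr0 (addrC x).
by apply: DeriveDef; [apply/cvg_ex; exists l|apply/cvg_lim].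
Qed.

Lemma pd_line g x j (t : R) : differentiable g (x + t *: delta_mx 0 j) ->
  is_derive t 1 (fun t => g (x + t *: delta_mx 0 j)) (pd j g (x + t *: delta_mx 0 j)).
Proof.
by move=> dg; apply: is_derive_line; apply: DeriveDef => //; exact: diff_derivable.
Qed.

(** Mean value theorem twice, first in direction j and then in direction k. The left side is
    symmetric in j and k, which is what proves [pdC]. *)
Lemma second_difference g (j k : 'I_d) x (t : R) : 0 < t -> (forall x, differentiable g x) ->
  (forall x, differentiable (pd j g) x) ->
  exists a b : R, [/\ 0 <= a <= t, 0 <= b <= t &
   g (x + t *: delta_mx 0 k + t *: delta_mx 0 j) - g (x + t *: delta_mx 0 j)
   - (g (x + t *: delta_mx 0 k) - g x) = t * t * pd k (pd j g) (x + a *: delta_mx 0 j + b *: delta_mx 0 k)].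
Proof.
move=> t0 dg djg; set ej := delta_mx 0 j; set ek := delta_mx 0 k.
have dc (f f' : R -> R) : (forall a : R, is_derive a 1 f (f' a)) ->
    exists2 c, 0 <= c <= t & f t - f 0 = f' c * t.
  move=> df; have [|c] := @MVT _ f f' 0 t t0 (fun a _ => df a).
    by apply: continuous_subspaceT => a; exact: is_derive1_continuous (df a).
  rewrite in_itv/= subr0 => /andP[c0 ct] E; exists c => //.
  by rewrite (ltW c0) ltW.
have d1 (a : R) : is_derive a 1 (fun a => g (x + t *: ek + a *: ej) + - g (x + a *: ej))
   (pd j g (x + t *: ek + a *: ej) + - pd j g (x + a *: ej)).
  by apply: is_derive1D; [exact: pd_line|apply: is_deriveN; exact: pd_line].
have [a at_ E1] := dc _ _ d1.
have d2 (b : R) : is_derive b 1 (fun b => pd j g (x + a *: ej + b *: ek))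
   (pd k (pd j g) (x + a *: ej + b *: ek)) by exact: pd_line.
have [b bt E2] := dc _ _ d2.
exists a, b; split => //.
move: E1 E2; rewrite !scale0r !addr0 => ->.
by rewrite (addrAC x) => ->; ring.
Qed.

Lemma pdC g (j k : 'I_d) x : (forall x, differentiable g x) ->
  (forall j x, differentiable (pd j g) x) ->
  (forall j k, continuous (pd j (pd k g))) -> pd k (pd j g) x = pd j (pd k g) x.
Proof.
move=> dg djg cg; apply/eqP; rewrite -subr_eq0; apply/eqP.
apply/eqP; rewrite -normr_le0; apply/ler_addgt0Pl => e e0; rewrite addr0.
pose p (i1 i2 : 'I_d) (z : R * R) := x + z.1 *: delta_mx 0 i1 + z.2 *: delta_mx 0 i2 : 'rV[R]_d.
have cp i1 i2 : {for (0, 0), continuous (p i1 i2)}.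
  apply: cvgD; first apply: cvgD; first exact: cvg_cst.
    by apply: cvgZr_tmp; exact: cvg_fst.
  by apply: cvgZr_tmp; exact: cvg_snd.
have H i1 i2 : \forall z \near (0 : R, 0 : R),
    `|pd i2 (pd i1 g) x - pd i2 (pd i1 g) (p i1 i2 z)| < e / 2.
  have h : {for (0 : R, 0 : R), continuous (fun z => pd i2 (pd i1 g) (p i1 i2 z))}.
    by apply: (@continuous_comp _ _ _ (p i1 i2) (pd i2 (pd i1 g))); [exact: cp|exact: cg].
  have p0 : p i1 i2 (0, 0) = x by rewrite /p !scale0r !addr0.
  have /cvgrPdist_lt/(_ (e / 2)) : pd i2 (pd i1 g) (p i1 i2 z) @[z --> (0 : R, 0 : R)] --> pd i2 (pd i1 g) x.
    by rewrite -[X in _ --> pd _ _ X]p0; exact: h.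
  by apply; rewrite divr_gt0.
have [[[A1 A2] [/= /nbhs_ballP[r1 /= r10 R1] /nbhs_ballP[r2 /= r20 R2]] HA]
  [[B1 B2] [/= /nbhs_ballP[r3 /= r30 R3] /nbhs_ballP[r4 /= r40 R4]] HB]] := (H j k, H k j).
pose r := Num.min (Num.min r1 r2) (Num.min r3 r4).
have r0 : 0 < r by rewrite !lt_min r10 r20 r30 r40.
have rr y : 0 <= y <= r / 2 -> [/\ A1 y, A2 y, B1 y & B2 y].
  move=> /andP[y0 yr].
  have : `|0 - y| < r by rewrite sub0r normrN ger0_norm//; apply: le_lt_trans yr _; rewrite ltr_pdivrMr// ltr_pMr// ltr1n.
  rewrite /r !lt_min => /andP[/andP[h1 h2] /andP[h3 h4]].
  by split; [exact: (R1 y h1)|exact: (R2 y h2)|exact: (R3 y h3)|exact: (R4 y h4)].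
have t0 : 0 < r / 2 by rewrite divr_gt0.
have [a [b [ha hb E1]]] := @second_difference g j k x (r / 2) t0 dg (djg j).
have [b' [a' [hb' ha' E2]]] := @second_difference g k j x (r / 2) t0 dg (djg k).
(* Both are the same second difference divided by the squared step, taken at two points within the
   continuity radius of x. *)
have E : pd k (pd j g) (p j k (a, b)) = pd j (pd k g) (p k j (b', a')).
  have tt : r / 2 * (r / 2) != 0 by rewrite gt_eqF// mulr_gt0.
  apply: (mulfI tt).
  apply: etrans (esym E1) _; apply: etrans _ E2.
  rewrite (addrAC x (r / 2 *: delta_mx 0 k)).
  move: (g (_ + _ + _)) (g (x + r / 2 *: delta_mx 0 j)) (g (x + r / 2 *: delta_mx 0 k)) (g x).
  by clear; move=> y1 y2 y3 y4; ring.
have [a1 _ _ _] := rr _ ha; have [_ b2 _ _] := rr _ hb.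
have [_ _ b1' _] := rr _ hb'; have [_ _ _ a2'] := rr _ ha'.
have := HA (a, b) (conj a1 b2); have := HB (b', a') (conj b1' a2').
rewrite E; move: (pd j (pd k g) (p k j (b', a'))) (pd k (pd j g) x) (pd j (pd k g) x).
clear -e0.
move=> y1 y2 y3 h1 h2; rewrite (_ : y2 - y3 = (y2 - y1) - (y3 - y1)); last by ring.
apply: le_trans (ler_normB _ _) _; by rewrite [leRHS](splitr e); apply: lerD; exact: ltW.
Qed.

End MultivariateCalculus.

(** * Finite combinations under Gaussian integrals *)

Section LinGrowthSums.
Context {R : realType} {J : finType}.
Set Implicit Arguments.
Unset Strict Implicit.
Implicit Types (f : (J -> R) -> R) (M : R) (b : J -> R).

Lemma lingrowth_sum (I : Type) (l : seq I) (c : I -> R) (f : I -> (J -> R) -> R) (M : R) :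
  (forall i, lingrowth M (f i)) ->
  lingrowth (\sum_(i <- l) `|c i| * M) (fun b => \sum_(i <- l) c i * f i b).
Proof.
move=> Hf; elim: l => [|i l IH].
  rewrite big_nil (_ : (fun b => _) = (fun=> 0)); last first.
    by apply/funext => b; rewrite big_nil.
  by rewrite -[X in lingrowth X](@normr0 _ R); exact: lingrowth_cst.
rewrite big_cons (_ : (fun b => _) =
    (fun b => c i * f i b + \sum_(j <- l) c j * f j b)); last first.
  by apply/funext => b; rewrite big_cons.
exact: lingrowth_lin (Hf i) IH.
Qed.

Lemma gaussIter_sum (I : Type) (l : seq I) (c : I -> R) (f : I -> (J -> R) -> R) (M : R)
    (e : seq J) b : (forall i, lingrowth M (f i)) ->
  gaussIter e (fun b => \sum_(i <- l) c i * f i b) b =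
  \sum_(i <- l) c i * gaussIter e (f i) b.
Proof.
move=> Hf; elim: l => [|i l IH].
  rewrite big_nil (_ : (fun b => _) = (fun=> 0)); first exact: gaussIter_cst.
  by apply/funext => b'; rewrite big_nil.
rewrite (_ : (fun b => _) =
    (fun b => c i * f i b + \sum_(j <- l) c j * f j b)); last first.
  by apply/funext => b'; rewrite big_cons.
by rewrite big_cons (gaussIter_lin (c i) e b (Hf i) (lingrowth_sum l c Hf)) IH.
Qed.

Lemma lingrowth_coord M f i : lingrowth M f -> (forall b, `|f b| <= M) ->
  lingrowth M (fun b => b i * f b).
Proof.
move=> Hf bf; split => [b j t|b]; last first.
  rewrite normrM mulrC ler_pM// /env; apply: ler_wpDl => //.
  by rewrite (bigD1 i)//= lerDl sumr_ge0.
rewrite /continuous_at; apply: cvgM; last exact: Hf.1.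
rewrite /upd; case: (i == j); [exact: cvg_id|exact: cvg_cst].
Qed.

End LinGrowthSums.

(** * The semigroup and the Stein equation *)

Section InterpolationSemigroup.
Context {R : realType} {d r : nat}.
Set Implicit Arguments.
Unset Strict Implicit.
Notation Rint := Defs.Rint.
Variables (Sigma : 'M[R]_d) (lam : 'I_r -> R).
Hypothesis lam0 : forall j, 0 <= lam j.
Let A := sqrtmx Sigma.
Implicit Types (g h : 'rV[R]_d -> ('I_r -> nat) -> R) (x v : 'rV[R]_d)
  (y z : 'I_r -> nat) (b : 'I_d -> R) (s M : R) (j : 'I_d) (k : 'I_r).

Definition bcont M g :=
  (forall x y, `|g x y| <= M) /\ (forall y, continuous (g ^~ y)).

Lemma bcont_ge0 M g : bcont M g -> 0 <= M.
Proof. by move=> [/(_ 0 (fun=> 0%N)) + _]; exact: le_trans. Qed.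

Definition pt x s b := Num.sqrt (1 - s) *: x + Num.sqrt s *: ((\row_i b i) *m A).

(** Moving one Gaussian coordinate moves the point along a line, which turns coordinatewise
    continuity and derivatives into statements along lines. *)
Lemma pt_upd x s b j t :
  pt x s (upd b j t) = pt x s (upd b j 0) + t *: (Num.sqrt s *: (delta_mx 0 j *m A)).
Proof.
rewrite /pt -addrA; congr (_ + _).
rewrite [t *: (_ *: _)]scalerA mulrC -scalerA -scalerDr [t *: (_ *m _)]scalemxAl -mulmxDl; congr (_ *: (_ *m _)).
apply/rowP => i; rewrite !mxE /upd eqxx/=.
by case: (eqVneq i j) => _; rewrite ?mulr1 ?mulr0 ?add0r ?addr0.
Qed.

Lemma lingrowth_bounded M (f : ('I_d -> R) -> R) : 0 <= M ->
  (forall b j, continuous (fun t => f (upd b j t))) -> (forall b, `|f b| <= M) ->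
  lingrowth M f.
Proof.
move=> M0 cf bf; split => // b; apply: le_trans (bf b) _.
by rewrite ler_peMr// /env lerDl sumr_ge0.
Qed.

Lemma lingrowth_pt M g x s y : bcont M g -> lingrowth M (fun b => g (pt x s b) y).
Proof.
move=> Hg; apply: lingrowth_bounded (bcont_ge0 Hg) _ _ => [b j t|b]; last exact: Hg.1.
rewrite (_ : (fun t => _) = (g ^~ y) \o
    (fun t => pt x s (upd b j 0) + t *: (Num.sqrt s *: (delta_mx 0 j *m A)))).
  by apply: continuous_comp; [exact: line_continuous|exact: Hg.2].
by apply/funext => t' /=; rewrite pt_upd.
Qed.

Lemma SsE s g x y :
  Ss Sigma s g x y = gaussIter (enum 'I_d) (fun b => g (pt x s b) y) (fun=> 0).
Proof. by []. Qed.

Lemma Ss_bound M g s x y : bcont M g -> `|Ss Sigma s g x y| <= M.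
Proof.
move=> Hg; rewrite SsE; apply: gaussIter_bounded (lingrowth_pt _ _ _ Hg) _ => b.
exact: Hg.1.
Qed.

Lemma Ss_lin M N g g' (c : R) s x y : bcont M g -> bcont N g' ->
  Ss Sigma s (fun x y => c * g x y + g' x y) x y =
  c * Ss Sigma s g x y + Ss Sigma s g' x y.
Proof.
move=> Hg Hg'; rewrite !SsE.
exact: gaussIter_lin (lingrowth_pt _ _ _ Hg) (lingrowth_pt _ _ _ Hg').
Qed.

Lemma pt_continuous x b : continuous (fun s => pt x s b).
Proof.
move=> s; apply: cvgD; apply: cvgZr_tmp; last exact: sqrt_continuous.
exact: sqrt_onem_continuous.
Qed.

Lemma Ss_continuous M g x y : bcont M g -> continuous (fun s => Ss Sigma s g x y).
Proof.
move=> Hg s; have s01 : s \in `]s - 1, s + 1[ by rewrite in_itv/=; lra.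
rewrite /continuous_at; under eq_fun do rewrite SsE; rewrite SsE.
apply: (@gaussIter_continuous _ _ _ (fun s b => g (pt x s b) y) M (s - 1) (s + 1)) s01.
  by move=> t _; exact: lingrowth_pt.
move=> t b _; apply: (@continuous_comp _ _ _ (fun s => pt x s b) (g ^~ y)).
  exact: pt_continuous.
exact: Hg.2.
Qed.

Definition qw s y : 'I_r -> nat -> R := fun k n => qs (lam k) s (y k) n.

(** One geometric constant for all coordinates, for the kernel ([geo_qs]) and for its s-derivative
    ([geo_qsD]) alike. *)
Definition qC y : R := \sum_k ((1 + 3 * lam k + 3 * (y k)%:R) * (8 ^+ y k * expR (6 * lam k))).

Lemma qC_ge k y : (1 + 3 * lam k + 3 * (y k)%:R) * (8 ^+ y k * expR (6 * lam k)) <= qC y.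
Proof.
rewrite /qC (bigD1 k)//= lerDl sumr_ge0// => i _.
by rewrite !mulr_ge0 ?addr_ge0 ?expR_ge0 ?exprn_ge0 ?mulr_ge0.
Qed.

Lemma qC_ge0 y : 0 <= qC y.
Proof.
rewrite /qC sumr_ge0// => i _.
by rewrite !mulr_ge0 ?addr_ge0 ?expR_ge0 ?exprn_ge0 ?mulr_ge0.
Qed.

Lemma geo_qw s y k : `|s| <= 2 -> geo (qC y) (qw s y k).
Proof.
move=> s2; apply: geoW (geo_qs (y k) (lam0 k) s2); apply: le_trans (qC_ge k y).
rewrite ler_peMl ?mulr_ge0 ?expR_ge0 ?exprn_ge0//.
by rewrite -addrA lerDl addr_ge0 ?mulr_ge0.
Qed.

Lemma geo_qwD s y k : `|s| <= 2 -> geo (qC y) (qsD (lam k) s (y k)).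
Proof.
move=> s2; apply: geoW (geo_qsD (y k) (lam0 k) s2); apply: le_trans (qC_ge k y).
rewrite ler_wpM2r ?mulr_ge0 ?expR_ge0 ?exprn_ge0//.
by rewrite -addrA lerDr.
Qed.

Lemma TsE s g x y : Ts Sigma lam s g x y =
  serIter (enum 'I_r) (qw s y) (Ss Sigma s g x) (fun=> 0%N).
Proof. by []. Qed.

Definition TC y : R := (2 * qC y) ^+ size (enum 'I_r).

Lemma TC_ge0 y : 0 <= TC y.
Proof. by rewrite exprn_ge0// mulr_ge0// qC_ge0. Qed.

Lemma Ts_bound M g s x y : bcont M g -> `|s| <= 2 ->
  `|Ts Sigma lam s g x y| <= TC y * M.
Proof.
move=> Hg s2; rewrite TsE; apply: serIter_bounded.
- exact: qC_ge0.
- by move=> k; exact: geo_qw.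
- by move=> z; exact: Ss_bound.
Qed.

Lemma Ts_lin M N g g' (c : R) s x y : bcont M g -> bcont N g' -> `|s| <= 2 ->
  Ts Sigma lam s (fun x y => c * g x y + g' x y) x y =
  c * Ts Sigma lam s g x y + Ts Sigma lam s g' x y.
Proof.
move=> Hg Hg' s2; rewrite !TsE.
rewrite (_ : Ss Sigma s _ x = (fun z => c * Ss Sigma s g x z + Ss Sigma s g' x z)); last first.
  by apply/funext => z; exact: Ss_lin Hg Hg'.
by apply: (@serIter_lin _ _ (qC y) M N) => z; [exact: geo_qw|exact: Ss_bound|exact: Ss_bound].
Qed.

Lemma Ts_continuous M g x y (s : R) : bcont M g -> s \in `[0, 1] ->
  {for s, continuous (fun s => Ts Sigma lam s g x y)}.
Proof.
move=> Hg; rewrite in_itv/= => /andP[s0 s1].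
have sn : \forall t \near s, `|t| <= 2.
  (* An open interval around [0, 1] on which the kernel bounds still hold, so the endpoints need no
     separate treatment. *)
  have h : s \in `]-1, 2[ by rewrite in_itv/=; lra.
  have := near_in_itvoo h; apply: filterS => t; rewrite in_itv/= ler_norml; lra.
rewrite /prop_for /continuous_at; under eq_fun do rewrite TsE; rewrite TsE.
apply: (@serIter_cvg _ _ _ (nbhs s) _ (qC y) M).
- by apply: filterS sn => t t2 k; exact: geo_qw.
- by move=> k; apply: geo_qw; rewrite ger0_norm//; lra.
- by apply: nearW => t z; exact: Ss_bound.
- by move=> z; exact: Ss_bound.
- by move=> k n; exact: is_derive1_continuous (qs_derive _ _ _ _).
- by move=> z; exact: Ss_continuous Hg _.
Qed.

Lemma bcont_incr M g k : bcont M g -> bcont M (fun x y => g x (incr y k)).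
Proof. by move=> [bg cg]; split => [x y|y]; [exact: bg|exact: cg]. Qed.

Lemma bcont_lin M N g g' (c : R) : bcont M g -> bcont N g' ->
  bcont (`|c| * M + N) (fun x y => c * g x y + g' x y).
Proof.
move=> [bg cg] [bg' cg']; split => [x y|y x].
  by apply: le_trans (ler_normD _ _) _; rewrite lerD// normrM ler_wpM2l.
have h1 := @cvgMl_tmp _ _ _ (nbhs_filter x) _ c _ (cg y x).
exact: (cvgD h1 (cg' y x)).
Qed.

Lemma bcont0 : bcont 0 (fun _ _ => 0).
Proof. by split => [x y|y]; [rewrite normr0|exact: cst_continuous]. Qed.

Lemma DkE k g : Dk k g = (fun x y => -1 * g x y + g x (incr y k)).
Proof. by apply/funext => x; apply/funext => y; rewrite /Dk mulN1r addrC. Qed.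

Lemma bcont_Dk M g k : bcont M g -> bcont (`|-1| * M + M) (Dk k g).
Proof. by move=> Hg; rewrite DkE; exact: bcont_lin Hg (bcont_incr _ Hg). Qed.

Lemma Ss_Dk M g k s x z : bcont M g ->
  Ss Sigma s (Dk k g) x z = Ss Sigma s g x (incr z k) - Ss Sigma s g x z.
Proof.
by move=> Hg; rewrite DkE (Ss_lin _ _ _ _ Hg (bcont_incr k Hg)) mulN1r addrC.
Qed.

Lemma geo_shift_diff C (w : nat -> R) : geo C w ->
  geo (3 * C) (fun n => shiftw w n - w n).
Proof.
move=> gw; have := geo_lin (-1) gw (geo_shiftw gw).
rewrite normrN normr1 mul1r (_ : (fun n => _) = (fun n => shiftw w n - w n)).
  by apply: geoW; lra.
by apply/funext => n; ring.
Qed.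

(** Summation by parts in coordinate k moves the difference from the kernel to the function. *)
Lemma Ts_shift M g k s x y : bcont M g -> `|s| <= 2 ->
  serIter (enum 'I_r) (upd (qw s y) k (fun n => shiftw (qw s y k) n - qw s y k n))
    (Ss Sigma s g x) (fun=> 0%N) = Ts Sigma lam s (Dk k g) x y.
Proof.
move=> Hg s2; rewrite TsE.
rewrite (@serIter_abel _ _ (qC y) M) ?enum_uniq ?mem_enum//.
- congr serIter; apply/funext => z; exact: esym (Ss_Dk k s x z Hg).
- by move=> i; exact: geo_qw.
- by move=> z; exact: Ss_bound.
Qed.

(** An extra point in coordinate k matters only if it survives the thinning, hence the factor 1 -
    s. *)
Lemma Ts_Dk M g k s x y : bcont M g -> `|s| <= 2 ->
  Ts Sigma lam s g x (incr y k) - Ts Sigma lam s g x y =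
  (1 - s) * Ts Sigma lam s (Dk k g) x y.
Proof.
move=> Hg s2; rewrite -(Ts_shift _ _ _ Hg s2) !TsE.
set w := qw s y; set D := fun n => _ - _.
have -> : qw s (incr y k) = upd w k (fun n => (1 - s) * D n + w k n).
  apply/funext => i; rewrite /upd; case: eqP => [->|/eqP ik]; apply/funext => n.
    by rewrite /qw /incr eqxx addn1 qs_diff.
  by rewrite /qw /incr (negbTE ik) addn0.
have gw i : geo (3 * qC y) (w i).
  by apply: geoW (geo_qw y i s2); have := qC_ge0 y; lra.
have gD : geo (3 * qC y) D by apply: geo_shift_diff; exact: geo_qw.
rewrite (@serIter_wlin _ _ (3 * qC y) M) ?enum_uniq ?mem_enum//.
  by rewrite upd_same addrK.
by move=> z; exact: Ss_bound.
Qed.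

(** The factor is the scaling of x inside S_s; differentiation passes through the iterated integrals
    and then through the iterated series. *)
Lemma Ts_derive_x M M' g g' v s x y : bcont M g -> bcont M' g' -> `|s| <= 2 ->
  (forall x y, is_derive x v (g ^~ y) (g' x y)) ->
  is_derive x v (fun x => Ts Sigma lam s g x y) (Num.sqrt (1 - s) * Ts Sigma lam s g' x y).
Proof.
move=> Hg Hg' s2 dg; apply: line_is_derive.
set c : R := Num.sqrt (1 - s).
have c0 : 0 <= c by exact: sqrtr_ge0.
(* The summand 0 gives c * g' the shape handled by [bcont_lin] and [Ts_lin]. *)
have Hcg' : bcont (`|c| * M' + 0) (fun x y => c * g' x y + 0).
  exact: bcont_lin Hg' bcont0.
have T0 x' : Ts Sigma lam s (fun x y => c * g' x y + 0) x' y = c * Ts Sigma lam s g' x' y.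
  rewrite (Ts_lin _ _ _ Hg' bcont0 s2); apply/eqP; rewrite -subr_eq0 addrAC subrr add0r -normr_le0.
  by have := Ts_bound x' y bcont0 s2; rewrite mulr0.
rewrite -T0.
have M0 := bcont_ge0 Hg; have M0' := bcont_ge0 Hg'.
have B0 : 0 <= `|c| * M' + 0 by rewrite addr0 mulr_ge0.
have i0 : (0 : R) \in `]-1, 1[ by rewrite in_itv/=; lra.
have E t' b : pt (x + t' *: v) s b = pt x s b + (c * t') *: v.
  by rewrite /pt scalerDr scalerA -!addrA; congr (_ + _); rewrite addrC.
have h1 (t : R) (z : 'I_r -> nat) : t \in `]-1, 1[ ->
    `|Ss Sigma s g (x + t *: v) z| <= M + (`|c| * M' + 0).
  by move=> _; apply: le_trans (Ss_bound _ _ _ Hg) _; rewrite lerDl.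
have h2 (t : R) (z : 'I_r -> nat) : t \in `]-1, 1[ ->
    `|Ss Sigma s (fun x y => c * g' x y + 0) (x + t *: v) z| <= M + (`|c| * M' + 0).
  by move=> _; apply: le_trans (Ss_bound _ _ _ Hcg') _; rewrite lerDr.
have h3 (t : R) (z : 'I_r -> nat) : t \in `]-1, 1[ ->
    is_derive t 1 (fun t => Ss Sigma s g (x + t *: v) z)
      (Ss Sigma s (fun x y => c * g' x y + 0) (x + t *: v) z).
  move=> t1.
  apply: (@gaussIter_derive _ _ _ (fun t b => g (pt (x + t *: v) s b) z)
    (fun t b => c * g' (pt (x + t *: v) s b) z + 0) (M + (`|c| * M' + 0)) (-1) 1 _ _ _ _ _ t1).
  - by move=> u _; apply: lingrowthW (lingrowth_pt _ _ _ Hg); rewrite lerDl.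
  - by move=> u _; apply: lingrowthW (lingrowth_pt _ _ _ Hcg'); rewrite lerDr.
  - move=> u b _; rewrite addr0 mulrC; under eq_fun do rewrite E.
    have dl : is_derive u 1 (fun u => c * u) c.
      by apply: is_derive_eq (is_derive1Z c (is_derive1_id u)) _; rewrite mulr1.
    have dg' : is_derive (c * u : R) 1 (fun u => g (pt x s b + u *: v) z) (g' (pt (x + u *: v) s b) z).
      by apply: (@is_derive_line _ _ (g ^~ z)); rewrite -E; exact: dg.
    exact: (@is_derive1_comp _ (fun u => g (pt x s b + u *: v) z) (fun u => c * u) _ _ _ dg' dl).
have := @serIter_derive_cw R _ (qC y) (M + (`|c| * M' + 0)) (enum 'I_r) (qw s y)
  (fun t z => Ss Sigma s g (x + t *: v) z)
  (fun t z => Ss Sigma s (fun x y => c * g' x y + 0) (x + t *: v) z) (-1) 1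
  (enum_uniq _) (qC_ge0 y) (addr_ge0 M0 B0) (fun k => geo_qw y k s2) h1 h2 h3 0 (fun=> 0%N) i0.
by rewrite scale0r addr0.
Qed.

Lemma rseries_delta (u : nat -> R) (a : nat) : rseries (fun n => (n == a)%:R * u n) = u a.
Proof.
apply: rseries_eq; apply: cvg_near_cst; exists a.+1 => //= n /= an.
rewrite (bigD1 (Ordinal an))//= eqxx mul1r big1 ?addr0// => i.
rewrite -val_eqE/= => /negbTE ->; exact: mul0r.
Qed.

Lemma serIter_delta (l : seq 'I_r) y z (u : ('I_r -> nat) -> R) : uniq l ->
  serIter l (fun k n => (n == y k)%:R) u z = u (fun i => if i \in l then y i else z i).
Proof.
elim: l z => [//|k l IH] z /= /andP[kl ul].
rewrite rseries_delta IH//; congr u; apply/funext => i.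
by rewrite inE /upd; case: eqP => [->|//]; rewrite (negbTE kl).
Qed.

Lemma Ts_at0 g x y : Ts Sigma lam 0 g x y = g x y.
Proof.
rewrite TsE (_ : qw 0 y = (fun k n => (n == y k)%:R)); last first.
  by apply/funext => k; apply/funext => n; rewrite /qw qs_at0.
rewrite serIter_delta ?enum_uniq// SsE.
rewrite (_ : (fun b => _) = (fun=> g x y)); first exact: gaussIter_cst.
apply/funext => b; rewrite /pt subr0 sqrtr1 scale1r sqrtr0 scale0r addr0.
by congr (g x _); apply/funext => i; rewrite mem_enum.
Qed.

Lemma Ts_at1 g x y : Ts Sigma lam 1 g x y = EhZN Sigma lam g.
Proof.
rewrite TsE /EhZN /prodSeries; congr serIter.
  by apply/funext => k; apply/funext => n; rewrite /qw qs_at1.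
apply/funext => z; rewrite SsE; congr gaussIter.
by apply/funext => b; rewrite /pt subrr sqrtr0 scale0r add0r sqrtr1 scale1r.
Qed.

Lemma bcont_sum (I : Type) (l : seq I) (c : I -> R)
    (g : I -> 'rV[R]_d -> ('I_r -> nat) -> R) M : (forall i, bcont M (g i)) ->
  bcont (\sum_(i <- l) `|c i| * M) (fun x y => \sum_(i <- l) c i * g i x y).
Proof.
move=> Hg; elim: l => [|i l IH].
  rewrite big_nil (_ : (fun x y => _) = (fun _ _ => 0)); first exact: bcont0.
  by apply/funext => x; apply/funext => y; rewrite big_nil.
rewrite big_cons (_ : (fun x y => _) = (fun x y => c i * g i x y + \sum_(j <- l) c j * g j x y)).
  exact: bcont_lin (Hg i) IH.
by apply/funext => x; apply/funext => y; rewrite big_cons.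
Qed.

Lemma Ss_sum (I : Type) (l : seq I) (c : I -> R)
    (g : I -> 'rV[R]_d -> ('I_r -> nat) -> R) M s x y : (forall i, bcont M (g i)) ->
  Ss Sigma s (fun x y => \sum_(i <- l) c i * g i x y) x y =
  \sum_(i <- l) c i * Ss Sigma s (g i) x y.
Proof.
by move=> Hg; rewrite SsE (gaussIter_sum _ _ _ _ (fun i => lingrowth_pt x s y (Hg i))).
Qed.

Lemma Ts_sum (I : Type) (l : seq I) (c : I -> R)
    (g : I -> 'rV[R]_d -> ('I_r -> nat) -> R) M s x y :
  (forall i, bcont M (g i)) -> `|s| <= 2 ->
  Ts Sigma lam s (fun x y => \sum_(i <- l) c i * g i x y) x y =
  \sum_(i <- l) c i * Ts Sigma lam s (g i) x y.
Proof.
move=> Hg s2; elim: l => [|i l IH].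
  rewrite big_nil (_ : (fun x y => _) = (fun _ _ => 0)); last first.
    by apply/funext => x'; apply/funext => y'; rewrite big_nil.
  by apply/eqP; rewrite -normr_le0; have := Ts_bound x y bcont0 s2; rewrite mulr0.
rewrite big_cons -IH -(Ts_lin _ _ _ (Hg i) (bcont_sum l c Hg) s2).
by congr Ts; apply/funext => x'; apply/funext => y'; rewrite big_cons.
Qed.

(** * Test functions and their partial derivatives *)

Lemma H3_bcont h : H3 h -> bcont 1 h.
Proof.
move=> [bh ch]; split => // y x; apply: differentiable_continuous.
by have [[_ dh _ _ _] _] := ch y; exact: dh.
Qed.

Lemma eucl_delta (t : R) j : eucl (t *: delta_mx 0 j : 'rV[R]_d) = `|t|.
Proof.
rewrite /eucl (bigD1 j)//= big1 ?addr0; last first.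
  by move=> i /negbTE ij; rewrite !mxE ij andbF mulr0 expr0n.
by rewrite !mxE !eqxx mulr1 sqrtr_sqr.
Qed.

Lemma H3_diff h y x : H3 h -> differentiable (h ^~ y) x.
Proof. by move=> [_ /(_ y)[[_ dh _ _ _] _]]; exact: dh. Qed.

Lemma H3_diff1 h y j x : H3 h -> differentiable (pdx j h ^~ y) x.
Proof. by move=> [_ /(_ y)[[_ _ dh _ _] _]]; exact: dh. Qed.

Lemma H3_diff2 h y (j k : 'I_d) x : H3 h -> differentiable (pdx j (pdx k h) ^~ y) x.
Proof. by move=> [_ /(_ y)[[_ _ _ dh _] _]]; exact: dh. Qed.

(** [C3] controls first-order partials through the Lipschitz bound, so the constant 1 is read off
    the difference quotients. *)
Lemma H3_bcont1 h j : H3 h -> bcont 1 (pdx j h).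
Proof.
move=> Hh; split => [x y|y x]; last exact: differentiable_continuous (H3_diff1 _ _ _ Hh).
have [_ /(_ y)[_ [lip _ _]]] := Hh.
have := @pd_line _ _ (h ^~ y) x j 0; rewrite scale0r addr0.
move=> /(_ (H3_diff _ _ Hh)) /is_derive1_cvgE; rewrite scale0r addr0.
move=> /cvg_norm cv; rewrite [X in X <= _](_ : _ = `|pd j (h ^~ y) x|)//.
rewrite -(cvg_lim _ cv)//; apply: limr_le; first by apply/cvg_ex; eexists; exact: cv.
near=> t; have t0 : t != 0 by near: t; exact: nbhs_dnbhs_neq.
rewrite normrZ normfV ler_pdivrMl ?normr_gt0// mulr1 addr0.
apply: le_trans (lip _ _) _.
by rewrite addrAC subrr add0r eucl_delta.
Unshelve. all: by end_near. Qed.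

Lemma H3_bcont2 h (j k : 'I_d) : H3 h -> bcont 1 (pdx j (pdx k h)).
Proof.
move=> Hh; split => [x y|y x]; last exact: differentiable_continuous (H3_diff2 _ _ _ _ Hh).
by have [_ /(_ y)[_ [_ b2 _]]] := Hh; exact: b2.
Qed.

Lemma H3_bcont3 h (j k l : 'I_d) : H3 h -> bcont 1 (pdx j (pdx k (pdx l h))).
Proof.
move=> Hh; split => [x y|y x].
  by have [_ /(_ y)[_ [_ _ b3]]] := Hh; exact: b3.
by have [_ /(_ y)[[_ _ _ _ c3] _]] := Hh; exact: c3.
Qed.

(** * The semigroup differentiated in s *)

Hypothesis HA : A^T *m A = Sigma.

Lemma is_derive_sqrt (s : R) : 0 < s -> is_derive s 1 (@Num.sqrt R) (2^-1 * (Num.sqrt s)^-1).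
Proof. by move=> s0; have := is_derive1_sqrt s0; rewrite invfM. Qed.

Lemma pt_derive x b (s : R) : s \in `]0, 1[ ->
  is_derive s 1 (fun s => pt x s b)
    ((- (2^-1 * kap s)) *: x + (2^-1 * (Num.sqrt s)^-1) *: ((\row_i b i) *m A)).
Proof.
rewrite in_itv/= => /andP[s0 s1].
have d1 := is_derive1_scale x (is_derive1_sqrt_onem s1).
have d2 := is_derive1_scale ((\row_i b i) *m A) (is_derive_sqrt s0).
exact: is_deriveD d1 d2.
Qed.

(** Stein's identity in the i-th standard coordinate. By the chain rule this coordinate moves the
    argument of g by sqrt(s) times row i of A. *)
Lemma Ss_ibp M g (i : 'I_d) s x z : bcont M g -> (forall x, differentiable (g ^~ z) x) ->
  (forall l : 'I_d, bcont M (pdx l g)) ->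
  gaussIter (enum 'I_d) (fun b => b i * g (pt x s b) z) (fun=> 0) =
  Num.sqrt s * \sum_l A i l * Ss Sigma s (pdx l g) x z.
Proof.
move=> Hg dg Hg'; have M0 := bcont_ge0 Hg.
pose c l := Num.sqrt s * A i l.
pose N := \sum_l `|c l| * M.
have N0 : 0 <= N by rewrite sumr_ge0// => l _; rewrite mulr_ge0.
have HG := bcont_sum (index_enum 'I_d) c Hg'.
have hd b (t : R) : is_derive t 1 (fun t => g (pt x s (upd b i t)) z)
    (\sum_l c l * pdx l g (pt x s (upd b i t)) z).
  under eq_fun do rewrite pt_upd.
  set w := _ *: (_ *m A); apply: (@is_derive_line _ _ (g ^~ z)).
  rewrite -pt_upd; apply: DeriveDef; first exact/diff_derivable/dg.
  rewrite derive_pd; last exact: dg.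
  apply: eq_bigr => l _; rewrite /w /c mxE mxE (bigD1 i)//= mxE !eqxx mul1r big1 ?addr0//.
  by move=> i' /negbTE ii; rewrite mxE ii andbF mul0r.
have lg : lingrowth (M + N) (fun b => g (pt x s b) z).
  by apply: lingrowthW (lingrowth_pt x s z Hg); rewrite lerDl.
have lg' : lingrowth (M + N) (fun b => \sum_l c l * pdx l g (pt x s b) z).
  by apply: lingrowthW (lingrowth_pt x s z HG); rewrite lerDr.
have bg b : `|g (pt x s b) z| <= M + N.
  by apply: le_trans (Hg.1 _ _) _; rewrite lerDl.
have bg' b : `|\sum_l c l * pdx l g (pt x s b) z| <= M + N.
  by apply: le_trans (HG.1 _ _) _; rewrite lerDr.
have im : i \in enum 'I_d by rewrite mem_enum.
rewrite (@gaussIter_ibp _ _ (enum 'I_d) i _ _ _ _ (enum_uniq _) im lg lg' bg bg' hd).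
rewrite (gaussIter_sum _ _ _ _ (fun l => lingrowth_pt x s z (Hg' l))) mulr_sumr.
by apply: eq_bigr => l _; rewrite -mulrA.
Qed.

(* Chosen so that d/ds S_s h (x, z) = S_s (Gs h s x) (x, z); the scaling of x in
   S_s gives the first sum, Gaussian integration by parts the second. *)
Definition Gs h s x : 'rV[R]_d -> ('I_r -> nat) -> R := fun x' z =>
  1 * (\sum_j (- (2^-1 * kap s * x 0 j)) * pdx j h x' z) +
  \sum_(p : 'I_d * 'I_d) (2^-1 * Sigma p.1 p.2) * pdx p.2 (pdx p.1 h) x' z.

Definition Gs_bound s x : R := `|1| * (\sum_j `|- (2^-1 * kap s * x 0 j)| * 1) +
  \sum_(p : 'I_d * 'I_d) `|2^-1 * Sigma p.1 p.2| * 1.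

Lemma bcont_Gs h s x : H3 h -> bcont (Gs_bound s x) (Gs h s x).
Proof.
move=> Hh; apply: bcont_lin.
  exact: bcont_sum (fun j => H3_bcont1 j Hh).
exact: (bcont_sum _ _ (fun p : 'I_d * 'I_d => H3_bcont2 p.2 p.1 Hh)).
Qed.

Lemma kap_le s t : s <= t -> t < 1 -> kap s <= kap t.
Proof.
move=> st t1; rewrite /kap lef_pV2 ?posrE ?sqrtr_gt0 ?subr_gt0//; last exact: le_lt_trans t1.
by apply: ler_wsqrtr; rewrite lerD2l lerN2.
Qed.

Lemma Gs_bound_le s t x : s <= t -> t < 1 -> Gs_bound s x <= Gs_bound t x.
Proof.
move=> st t1; rewrite lerD2r ler_wpM2l//; apply: ler_sum => j _.
rewrite !mulr1 !normrN !normrM !(ger0_norm (kap_ge0 _)).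
by rewrite ler_wpM2r// ler_wpM2l// kap_le.
Qed.

Lemma Ss_derive_s h x z (s0 : R) : H3 h -> s0 \in `]0, 1[ ->
  is_derive s0 1 (fun s => Ss Sigma s h x z) (Ss Sigma s0 (Gs h s0 x) x z).
Proof.
move=> Hh; rewrite in_itv/= => /andP[s00 s01].
(* Away from both endpoints the coefficients are bounded: [kap] by its value at v, 1 / sqrt(s) by
   its value at u. *)
pose u : R := s0 / 2; pose v : R := (1 + s0) / 2.
have u0 : 0 < u by rewrite divr_gt0.
have v1 : v < 1 by rewrite /v; lra.
have s0uv : s0 \in `]u, v[ by rewrite in_itv/= /u /v; lra.
have Hb1 j x' s := lingrowth_pt x' s z (H3_bcont1 j Hh).
have Hb2 x' s (p : 'I_d * 'I_d) :
    lingrowth 1 (fun b => b p.1 * pdx p.2 h (pt x' s b) z).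
  by apply: lingrowth_coord => // b; have [bb _] := H3_bcont1 p.2 Hh; exact: bb.
pose c1 s (j : 'I_d) := - (2^-1 * kap s * x 0 j).
pose c2 s (p : 'I_d * 'I_d) := 2^-1 * (Num.sqrt s)^-1 * A p.1 p.2.
pose F s b := 1 * (\sum_j c1 s j * pdx j h (pt x s b) z) +
  \sum_p c2 s p * (b p.1 * pdx p.2 h (pt x s b) z).
have lF s : lingrowth (`|1| * (\sum_j `|c1 s j| * 1) + \sum_p `|c2 s p| * 1) (F s).
  apply: lingrowth_lin; first exact: lingrowth_sum (fun j => Hb1 j x s).
  exact: lingrowth_sum (Hb2 x s).
pose N : R := 1 + (`|1| * (\sum_j `|c1 v j| * 1) + \sum_p `|c2 u p| * 1).
have dS : is_derive s0 1 (fun s => Ss Sigma s h x z) (gaussIter (enum 'I_d) (F s0) (fun=> 0)).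
  apply: (@gaussIter_derive _ _ _ (fun s b => h (pt x s b) z) F N u v) => //.
  - move=> s _; apply: lingrowthW (lingrowth_pt x s z (H3_bcont Hh)).
    by rewrite /N lerDl addr_ge0 ?mulr_ge0 ?sumr_ge0// => ? _; rewrite mulr_ge0.
  - move=> s; rewrite in_itv/= => /andP[us sv]; apply: lingrowthW (lF s).
    rewrite /N; apply: le_trans (_ : _ <= 0 + _) _; first by rewrite add0r.
    apply: lerD => //; apply: lerD.
      rewrite ler_wpM2l//; apply: ler_sum => j _.
      rewrite !mulr1 !normrN !normrM !(ger0_norm (kap_ge0 _)).
      by rewrite ler_wpM2r// ler_wpM2l// kap_le// ltW.
    apply: ler_sum => p _; rewrite !mulr1 /c2 !normrM ler_wpM2r// ler_wpM2l//.
    rewrite !normfV !(ger0_norm (sqrtr_ge0 _)) lef_pV2 ?posrE ?sqrtr_gt0//; last exact: lt_trans us.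
    by apply: ler_wsqrtr; exact: ltW.
  - move=> s b; rewrite in_itv/= => /andP[us sv].
    have s01' : s \in `]0, 1[ by rewrite in_itv/= (lt_trans u0)//= (lt_trans sv).
    apply: is_derive_eq.
      exact: (@is_derive1_chain _ _ (h ^~ z) (fun s => pt x s b) s _ (H3_diff _ _ Hh) (pt_derive x b s01')).
    rewrite /F mul1r; under eq_bigr do rewrite mxE mulrDl.
    rewrite big_split; congr (_ + _).
      by apply: eq_bigr => j _; rewrite !mxE /c1 mulNr.
    rewrite /c2 -(pair_bigA _ (fun i j => 2^-1 * (Num.sqrt s)^-1 * A i j * (b i * pdx j h (pt x s b) z)))/= exchange_big/=.
    apply: eq_bigr => j _; rewrite mxE mxE mulr_sumr mulr_suml.
    by apply: eq_bigr => i _; rewrite mxE /pdx; ring.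
apply: is_derive_eq dS _.
rewrite (gaussIter_lin _ _ _ (lingrowth_sum _ _ (fun j => Hb1 j x s0)) (lingrowth_sum _ _ (Hb2 x s0))).
rewrite (gaussIter_sum _ _ _ _ (fun j => Hb1 j x s0)) (gaussIter_sum _ _ _ _ (Hb2 x s0)).
rewrite (Ss_lin _ _ _ _ (bcont_sum _ _ (fun j => H3_bcont1 j Hh))
  (bcont_sum _ _ (fun p : 'I_d * 'I_d => H3_bcont2 p.2 p.1 Hh))).
rewrite (Ss_sum _ _ _ _ _ (fun j => H3_bcont1 j Hh)).
rewrite (Ss_sum _ _ _ _ _ (fun p : 'I_d * 'I_d => H3_bcont2 p.2 p.1 Hh)).
congr (_ + _).
(* The 1 / sqrt(s) from differentiating sqrt(s) cancels the sqrt(s) produced by [Ss_ibp], and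
   summing over i assembles A^T A = Sigma. *)
have q0 : Num.sqrt s0 != 0 by rewrite gt_eqF// sqrtr_gt0.
under eq_bigr => p _ do rewrite (Ss_ibp _ _ _ (H3_bcont1 p.2 Hh) (fun x => H3_diff1 _ _ _ Hh) (fun l => H3_bcont2 l p.2 Hh)).
rewrite /c2 -(pair_bigA _ (fun i j => 2^-1 * (Num.sqrt s0)^-1 * A i j * (Num.sqrt s0 * \sum_l A i l * Ss Sigma s0 (pdx l (pdx j h)) x z)))/=.
rewrite -(pair_bigA _ (fun j l => 2^-1 * Sigma j l * Ss Sigma s0 (pdx l (pdx j h)) x z))/=.
rewrite exchange_big/=; apply: eq_bigr => j _.
under eq_bigr => i _ do rewrite !mulr_sumr.
rewrite exchange_big/=; apply: eq_bigr => l _.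
rewrite -HA mxE mulr_sumr mulr_suml; apply: eq_bigr => i _.
by rewrite mxE; field.
Qed.

(** Truncation at 0 is harmless: the value only counts where y k > 0 or where it is multiplied by y
    k. *)
Definition decr y k : 'I_r -> nat := fun i => (y i - (i == k))%N.

(* d/ds T_s h (x, y) *)
Definition TD h s x y : R := Ts Sigma lam s (Gs h s x) x y +
  \sum_k (lam k * Ts Sigma lam s (Dk k h) x y
          - (y k)%:R * Ts Sigma lam s (Dk k h) x (decr y k)).

Lemma serIter_qsD M g k s x y : bcont M g -> `|s| <= 2 ->
  serIter (enum 'I_r) (upd (qw s y) k (qsD (lam k) s (y k))) (Ss Sigma s g x) (fun=> 0%N) =
  lam k * Ts Sigma lam s (Dk k g) x y
  - (y k)%:R * Ts Sigma lam s (Dk k g) x (decr y k).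
Proof.
move=> Hg s2.
rewrite -(Ts_shift k x y Hg s2) -(Ts_shift k x (decr y k) Hg s2).
set D := fun n => shiftw (qw s y k) n - _; set D' := fun n => shiftw (qw s (decr y k) k) n - _.
(* The two kernels differ in coordinate k only, which [upd] overwrites. *)
have -> : upd (qw s (decr y k)) k D' = upd (qw s y) k D'.
  apply/funext => i; rewrite /upd; case: eqP => // /eqP ik; apply/funext => n.
  by rewrite /qw /decr (negbTE ik) subn0.
set C := 3 * qC y + 3 * qC (decr y k).
have q1 := qC_ge0 y; have q2 := qC_ge0 (decr y k).
have gw i : geo C (qw s y i) by apply: geoW (geo_qw y i s2); rewrite /C; lra.
have gD : geo C D by apply: geoW (geo_shift_diff (geo_qw y k s2)); rewrite /C; lra.
have gD' : geo C D'.
  by apply: geoW (geo_shift_diff (geo_qw (decr y k) k s2)); rewrite /C; lra.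
have C0 : 0 <= C by exact: geo_ge0 gD.
have g0 : geo C (fun=> 0) by move=> n; rewrite normr0 mulr_ge0// exprn_ge0// invr_ge0.
have bS z : `|Ss Sigma s g x z| <= M by exact: Ss_bound.
have uq := enum_uniq 'I_r; have kin : k \in enum 'I_r by rewrite mem_enum.
have -> : qsD (lam k) s (y k) = (fun n => lam k * D n + (- (y k)%:R * D' n + 0)).
  by apply/funext => n; rewrite /qsD /D /D' /qw /decr eqxx subn1 addr0 mulNr.
have gE : geo (`|- (y k)%:R| * C + C) (fun n => - (y k)%:R * D' n + 0).
  exact: geo_lin gD' g0.
have C1 : C <= `|- (y k)%:R| * C + C by rewrite lerDr mulr_ge0.
rewrite (serIter_wlin _ _ uq kin (fun i => geoW C1 (gw i)) (geoW C1 gD) gE bS).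
rewrite (serIter_wlin _ _ uq kin gw gD' g0 bS) (serIter_w0 _ uq kin gw bS) addr0.
by rewrite mulNr.
Qed.

Lemma Ts_derive_s h x y (s0 : R) : H3 h -> s0 \in `]0, 1[ ->
  is_derive s0 1 (fun s => Ts Sigma lam s h x y) (TD h s0 x y).
Proof.
move=> Hh s001; have := s001; rewrite in_itv/= => /andP[s00 s01].
pose u : R := s0 / 2; pose v : R := (1 + s0) / 2.
have u0 : 0 < u by rewrite divr_gt0.
have v1 : v < 1 by rewrite /v; lra.
have s0uv : s0 \in `]u, v[ by rewrite in_itv/= /u /v; lra.
have s2 s : s \in `]u, v[ -> `|s| <= 2 by rewrite in_itv/= ler_norml; lra.
have s01' s : s \in `]u, v[ -> s \in `]0, 1[ by rewrite !in_itv/=; lra.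
pose M : R := 1 + Gs_bound v x.
have B0 : 0 <= Gs_bound v x by exact: bcont_ge0 (bcont_Gs v x Hh).
apply: is_derive_eq.
  apply: (@serIter_derive _ _ (qC y) M (enum 'I_r) (fun s => qw s y)
    (fun s k => qsD (lam k) s (y k)) (fun s => Ss Sigma s h x)
    (fun s => Ss Sigma s (Gs h s x) x) u v) => //.
  - exact: enum_uniq.
  - exact: qC_ge0.
  - exact: addr_ge0.
  - by move=> s k /s2; exact: geo_qw.
  - by move=> s k /s2; exact: geo_qwD.
  - by move=> s z _; apply: le_trans (Ss_bound s x z (H3_bcont Hh)) _; rewrite lerDl.
  - move=> s z; rewrite in_itv/= => /andP[_ /ltW sv].
    apply: le_trans (Ss_bound s x z (bcont_Gs s x Hh)) _.
    by apply: le_trans (Gs_bound_le x sv v1) _; rewrite lerDr.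
  - by move=> s k n _; exact: qs_derive.
  - by move=> s z /s01'; exact: Ss_derive_s.
rewrite /TD addrC; congr (_ + _).
rewrite big_enum/=; apply: eq_bigr => k _.
exact: serIter_qsD (H3_bcont Hh) (s2 _ s0uv).
Qed.

(** * Weighted integrals of the semigroup over [0, 1] *)

Definition weight (w : R -> R) (c : R) :=
  (forall s, s \in `]0, 1[ -> {for s, continuous w}) /\
  (forall s, s \in `]0, 1[ -> `|w s| <= c * kap s).

Lemma kap_ge1 s : s \in `]0, 1[ -> 1 <= kap s.
Proof.
rewrite in_itv/= => /andP[s0 s1]; rewrite /kap -[leLHS]invr1 lef_pV2 ?posrE//; last first.
  by rewrite sqrtr_gt0 subr_gt0.
by rewrite -[leRHS]sqrtr1; apply: ler_wsqrtr; lra.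
Qed.

Lemma itv01_le2 s : s \in `]0, 1[ -> `|s| <= 2.
Proof. by rewrite in_itv/= ler_norml; lra. Qed.

(** [w1], [w2], [w3] are what remains of (2 (1 - s))^(-1) after one, two and three x-derivatives.
    The original factor is too singular to be a [weight], so f_h itself is handled apart from
    [Lw]. *)
Definition w1 s : R := 2^-1 * kap s.
Definition w2 s : R := 2^-1.
Definition w3 s : R := 2^-1 * Num.sqrt (1 - s).

Lemma weight1 : weight w1 2^-1.
Proof.
split => s s01; last first.
  by rewrite /w1 normrM !ger0_norm ?kap_ge0.
apply: cvgMl_tmp; apply: kap_continuous.
by move: s01; rewrite in_itv/= => /andP[].
Qed.

Lemma weight2 : weight w2 2^-1.
Proof.
split => s s01; first exact: cst_continuous.
by rewrite /w2 ger0_norm// ler_peMr// kap_ge1.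
Qed.

Lemma Ts_singular w c M g x y : weight w c -> bcont M g ->
  singular (c * (TC y * M)) (fun s => w s * Ts Sigma lam s g x y).
Proof.
move=> [cw bw] Hg; split => s s01.
  apply: cvgM; first exact: cw.
  by apply: Ts_continuous Hg _; exact: subset_itv_oo_cc.
rewrite normrM mulrAC ler_pM//; first exact: bw.
by apply: Ts_bound Hg _; exact: itv01_le2.
Qed.

(* All derivatives of f_h have this form: each x-derivative multiplies the weight
   by sqrt (1 - s) and Delta_k multiplies it by 1 - s. *)
Definition Lw w g x y : R := - Rint `[0, 1] (fun s => w s * Ts Sigma lam s g x y).

Lemma Lw_eq w w' c M g x y : weight w c -> bcont M g ->
  (forall s, s \in `]0, 1[ -> w s = w' s) -> Lw w g x y = Lw w' g x y.
Proof.
move=> Hw Hg ww; rewrite /Lw; congr (- _).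
by apply: (Rint_singular_eq (Ts_singular x y Hw Hg)) => s /ww ->.
Qed.

Lemma Lw_sum (I : Type) (l : seq I) (a : I -> R) w c
    (g : I -> 'rV[R]_d -> ('I_r -> nat) -> R) M x y : weight w c -> (forall i, bcont M (g i)) ->
  Lw w (fun x y => \sum_(i <- l) a i * g i x y) x y = \sum_(i <- l) a i * Lw w (g i) x y.
Proof.
move=> Hw Hg; rewrite /Lw.
have sg i := Ts_singular x y Hw (Hg i).
have [D [_ E]] := singular_sum l a sg.
rewrite (Rint_singular_eq (g := fun s => \sum_(i <- l) a i * (w s * Ts Sigma lam s (g i) x y))
  (Ts_singular x y Hw (bcont_sum l a Hg))).
  by rewrite E -sumrN; apply: eq_bigr => i _; rewrite mulrN.
move=> s s01; rewrite (Ts_sum l a x y Hg (itv01_le2 s01)) mulr_sumr.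
by apply: eq_bigr => i _; rewrite mulrCA.
Qed.

Lemma weight_sqrt w c : weight w c -> weight (fun s => w s * Num.sqrt (1 - s)) c.
Proof.
move=> [cw bw]; split => s s01.
  by apply: cvgM; [exact: cw|exact: sqrt_onem_continuous].
rewrite normrM (ger0_norm (sqrtr_ge0 _)); apply: le_trans (bw s s01).
rewrite ler_piMr// -[leRHS]sqrtr1; apply: ler_wsqrtr.
by move: s01; rewrite in_itv/=; lra.
Qed.

Lemma Lw_derive w c M M' g g' v x y : weight w c -> bcont M g -> bcont M' g' ->
  (forall x y, is_derive x v (g ^~ y) (g' x y)) ->
  is_derive x v (Lw w g ^~ y) (Lw (fun s => w s * Num.sqrt (1 - s)) g' x y).
Proof.
move=> Hw Hg Hg' dg; apply: line_is_derive; apply: is_deriveN.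
have i0 : (0 : R) \in `]-1, 1[ by rewrite in_itv/=; lra.
have Hw' := weight_sqrt Hw.
pose f (t s : R) := w s * Ts Sigma lam s g (x + t *: v) y.
pose f' (t s : R) := w s * Num.sqrt (1 - s) * Ts Sigma lam s g' (x + t *: v) y.
have h1 (t : R) : t \in `]-1, 1[ -> exists C, singular C (f t).
  by move=> _; eexists; exact: Ts_singular Hw Hg.
have h2 (t : R) : t \in `]-1, 1[ -> singular (c * (TC y * M')) (f' t).
  by move=> _; exact: Ts_singular Hw' Hg'.
have dT (t s : R) : t \in `]-1, 1[ -> s \in `]0, 1[ -> is_derive t 1 (f ^~ s) (f' t s).
  move=> _ s01; rewrite /f' -mulrA; apply: is_derive1Z.
  apply: (@is_derive_line _ _ (fun x => Ts Sigma lam s g x y)).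
  exact: Ts_derive_x Hg Hg' (itv01_le2 s01) dg.
by have := Rint_singular_derive h1 h2 dT i0; rewrite /f' scale0r addr0.
Qed.

(** The coefficients of [TD] are arranged to contain [w1] or [w2], so its integral consists of the
    [Lw] terms that represent derivatives of f_h. The counting terms carry no 1/2 of their own,
    hence the factors 2. *)
Lemma TD_singular h x y : H3 h -> exists D,
  singular D (fun s => TD h s x y) /\
  Rint `[0, 1] (fun s => TD h s x y) =
    \sum_j x 0 j * Lw w1 (pdx j h) x y
    - \sum_(p : 'I_d * 'I_d) Sigma p.1 p.2 * Lw w2 (pdx p.2 (pdx p.1 h)) x y
    - \sum_k (2 * lam k) * Lw w2 (Dk k h) x y
    + \sum_k (2 * (y k)%:R) * Lw w2 (Dk k h) x (decr y k).
Proof.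
move=> Hh.
have b1 j := H3_bcont1 j Hh.
have b2 (p : 'I_d * 'I_d) := H3_bcont2 p.2 p.1 Hh.
have b0 k := bcont_Dk k (H3_bcont Hh).
have [D1 [s1 E1]] := singular_sum (index_enum 'I_d) (fun j => - x 0 j)
  (fun j => Ts_singular x y weight1 (b1 j)).
have [D2 [s2 E2]] := singular_sum (index_enum ('I_d * 'I_d)%type) (fun p => Sigma p.1 p.2)
  (fun p => Ts_singular x y weight2 (b2 p)).
have [D3 [s3 E3]] := singular_sum (index_enum 'I_r) (fun k => 2 * lam k)
  (fun k => Ts_singular x y weight2 (b0 k)).
(* The base point [decr y k] varies with k, while [singular_sum] takes one constant for all k. *)
pose Cd := \sum_k 2^-1 * (TC (decr y k) * (`|-1| * 1 + 1)).
have s4' k : singular Cd (fun s => w2 s * Ts Sigma lam s (Dk k h) x (decr y k)).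
  have [c4 b4] := Ts_singular x (decr y k) weight2 (b0 k).
  split => // s s01; apply: le_trans (b4 s s01) _; rewrite ler_wpM2r ?kap_ge0//.
  rewrite /Cd (bigD1 k)//= lerDl sumr_ge0// => i _.
  by rewrite !mulr_ge0 ?TC_ge0 ?addr_ge0.
have [D4 [s4 E4]] := singular_sum (index_enum 'I_r) (fun k => - (2 * (y k)%:R)) s4'.
have S12 := singular_lin 1 s1 s2; have S34 := singular_lin 1 s3 s4.
have S := singular_lin 1 S12 S34.
have EQ s : s \in `]0, 1[ -> 1 * (1 * (\sum_j - x 0 j * (w1 s * Ts Sigma lam s (pdx j h) x y)) +
   \sum_(p : 'I_d * 'I_d) Sigma p.1 p.2 * (w2 s * Ts Sigma lam s (pdx p.2 (pdx p.1 h)) x y)) +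
   (1 * (\sum_k 2 * lam k * (w2 s * Ts Sigma lam s (Dk k h) x y)) +
   \sum_k - (2 * (y k)%:R) * (w2 s * Ts Sigma lam s (Dk k h) x (decr y k))) = TD h s x y.
  move=> s01; have s2' := itv01_le2 s01; rewrite /TD !mul1r; congr (_ + _).
    rewrite /Gs (Ts_lin _ _ _ (bcont_sum _ _ b1) (bcont_sum _ _ b2) s2') mul1r.
    rewrite (Ts_sum _ _ _ _ b1 s2') (Ts_sum _ _ _ _ b2 s2'); congr (_ + _).
      by apply: eq_bigr => j _; rewrite /w1; ring.
    by apply: eq_bigr => p _; rewrite /w2; ring.
  rewrite big_split/=; by congr (_ + _); apply: eq_bigr => k _; rewrite /w2; field.
eexists; split; first exact: singular_ext EQ S.
rewrite -(Rint_singular_eq S EQ) (Rint_singular_lin _ S12 S34) (Rint_singular_lin _ s1 s2).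
rewrite (Rint_singular_lin _ s3 s4) E1 E2 E3 E4 !mul1r /Lw.
rewrite -!addrA; congr (_ + _); first by apply: eq_bigr => j _; ring.
congr (_ + _); first by rewrite -sumrN; apply: eq_bigr => p _; ring.
congr (_ + _); first by rewrite -sumrN; apply: eq_bigr => k _; ring.
by apply: eq_bigr => k _; ring.
Qed.

Lemma Ts_within_continuous h x y : H3 h ->
  {within `[0, 1], continuous (fun s => Ts Sigma lam s h x y)}.
Proof.
move=> Hh; apply: continuous_in_subspaceT => s /set_mem s01.
exact: Ts_continuous (H3_bcont Hh) s01.
Qed.

Lemma TD_integral h x y : H3 h ->
  Rint `[0, 1] (fun s => TD h s x y) = EhZN Sigma lam h - h x y.
Proof.
move=> Hh; have [D [sD _]] := TD_singular x y Hh.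
rewrite (Rint_singular_FTC (@Ts_within_continuous h x y Hh)
  (fun s s01 => Ts_derive_s x y Hh s01) sD).
by rewrite Ts_at1 Ts_at0.
Qed.

Lemma inv_onem s : s \in `]0, 1[ -> (2 * (1 - s))^-1 = 2^-1 * kap s * kap s.
Proof.
rewrite in_itv/= => /andP[s0 s1]; rewrite -mulrA /kap -invfM -expr2 sqr_sqrtr ?invfM//.
by rewrite subr_ge0 ltW.
Qed.

Lemma sqrt_kap s : s \in `]0, 1[ -> kap s * Num.sqrt (1 - s) = 1.
Proof.
by rewrite in_itv/= => /andP[s0 s1]; rewrite /kap mulVf// gt_eqF// sqrtr_gt0 subr_gt0.
Qed.

Lemma fh_singular h x y : H3 h -> exists C, singular C
  (fun s => (2 * (1 - s))^-1 * (Ts Sigma lam s h x y - EhZN Sigma lam h)).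
Proof.
move=> Hh; have [D [sD _]] := TD_singular x y Hh.
have H := singular_primitive_bound (@Ts_within_continuous h x y Hh)
  (fun s s01 => Ts_derive_s x y Hh s01) sD.
exists D; split => s s01.
  have s1 : s < 1 by move: s01; rewrite in_itv/= => /andP[].
  apply: cvgM.
    apply: cvgV; first by rewrite mulf_neq0// gt_eqF// subr_gt0.
    by apply: cvgMl_tmp; exact: is_derive1_continuous (is_derive1_onem s).
  apply: cvgB; last exact: cvg_cst.
  by apply: Ts_continuous (H3_bcont Hh) _; exact: subset_itv_oo_cc.
have := H s s01; rewrite /= Ts_at1 => h1.
rewrite (inv_onem s01) normrM ger0_norm ?mulr_ge0 ?kap_ge0//.
apply: le_trans (ler_wpM2l _ h1) _; first by rewrite !mulr_ge0 ?kap_ge0.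
(* The square root from [singular_primitive_bound] cancels one of the two factors [kap s] in (2 (1 -
   s))^(-1). *)
rewrite [leLHS](_ : _ = D * kap s * (kap s * Num.sqrt (1 - s))); last by field.
by rewrite sqrt_kap// mulr1.
Qed.

Lemma fh_derive h M g' v x y : H3 h -> bcont M g' ->
  (forall x y, is_derive x v (h ^~ y) (g' x y)) ->
  is_derive x v (fh Sigma lam h ^~ y) (Lw w1 g' x y).
Proof.
move=> Hh Hg' dh; apply: line_is_derive; apply: is_deriveN.
have i0 : (0 : R) \in `]-1, 1[ by rewrite in_itv/=; lra.
pose f (t s : R) := (2 * (1 - s))^-1 * (Ts Sigma lam s h (x + t *: v) y - EhZN Sigma lam h).
pose f' (t s : R) := w1 s * Ts Sigma lam s g' (x + t *: v) y.
have h1 (t : R) : t \in `]-1, 1[ -> exists C, singular C (f t).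
  by move=> _; exact: fh_singular.
have h2 (t : R) : t \in `]-1, 1[ -> singular (2^-1 * (TC y * M)) (f' t).
  by move=> _; exact: Ts_singular weight1 Hg'.
have dT (t s : R) : t \in `]-1, 1[ -> s \in `]0, 1[ -> is_derive t 1 (f ^~ s) (f' t s).
  move=> _ s01.
  have d1 : is_derive t 1 (fun t => Ts Sigma lam s h (x + t *: v) y)
      (Num.sqrt (1 - s) * Ts Sigma lam s g' (x + t *: v) y).
    apply: (@is_derive_line _ _ (fun x => Ts Sigma lam s h x y)).
    exact: Ts_derive_x (H3_bcont Hh) Hg' (itv01_le2 s01) dh.
  apply: is_derive_eq (is_derive1Z _ (is_derive1D d1 (is_derive1_cst (- EhZN Sigma lam h) t))) _.
  rewrite addr0 (inv_onem s01) /f' /w1.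
  rewrite [LHS](_ : _ = 2^-1 * kap s * (kap s * Num.sqrt (1 - s)) *
    Ts Sigma lam s g' (x + t *: v) y); last by ring.
  by rewrite (sqrt_kap s01) mulr1.
by have := Rint_singular_derive h1 h2 dT i0; rewrite /f' scale0r addr0.
Qed.

(** In the difference E h(Z, N) drops out, and the factor 1 - s of [Ts_Dk] cancels the singularity
    completely. *)
Lemma fh_Dk h k x y : H3 h -> Dk k (fh Sigma lam h) x y = Lw w2 (Dk k h) x y.
Proof.
move=> Hh.
have [C1 S1] := fh_singular x (incr y k) Hh; have [C2 S2] := fh_singular x y Hh.
have S := singular_lin (-1) S2 S1.
have E : Rint `[0, 1] (fun s =>
     -1 * ((2 * (1 - s))^-1 * (Ts Sigma lam s h x y - EhZN Sigma lam h)) +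
     (2 * (1 - s))^-1 * (Ts Sigma lam s h x (incr y k) - EhZN Sigma lam h)) =
   Rint `[0, 1] (fun s => w2 s * Ts Sigma lam s (Dk k h) x y).
  apply: (Rint_singular_eq S) => s s01.
  have := Ts_Dk k x y (H3_bcont Hh) (itv01_le2 s01).
  move=> h1; rewrite mulN1r addrC -mulrBr opprB addrA subrK h1 mulrA; congr (_ * _).
  rewrite (inv_onem s01) /w2.
  have e2 : 1 - s = Num.sqrt (1 - s) * Num.sqrt (1 - s).
    by rewrite -expr2 sqr_sqrtr// subr_ge0; move: s01; rewrite in_itv/= => /andP[_ /ltW].
  rewrite [X in _ * X]e2 [LHS](_ : _ = 2^-1 * (kap s * Num.sqrt (1 - s)) * (kap s * Num.sqrt (1 - s))).
    by rewrite (sqrt_kap s01) !mulr1.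
  ring.
by rewrite /Lw -E (Rint_singular_lin _ S2 S1) {1}/Dk /fh -/(incr y k); ring.
Qed.

(** * Derivatives of the Stein solution and the Stein equation *)

Local Notation f h := (fh Sigma lam h).

Lemma is_derive_grad (g : 'rV[R]_d -> R) x v : differentiable g x ->
  is_derive x v g (\sum_j v 0 j * pd j g x).
Proof. by move=> dg; apply: DeriveDef; [exact: diff_derivable|exact: derive_pd]. Qed.

(** The Taylor bounds work along lines, so linearity in v is obtained directly: g is differentiated
    in direction v and the gradient sum is then pulled out with [Lw_sum]. *)
Lemma Lw_line w c M g v x y : weight w c -> bcont M g ->
  (forall x y, differentiable (g ^~ y) x) -> (forall j, bcont M (pdx j g)) ->
  is_derive x v (Lw w g ^~ y)
    (\sum_j v 0 j * Lw (fun s => w s * Num.sqrt (1 - s)) (pdx j g) x y).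
Proof.
move=> Hw Hg dg Hg'; rewrite -(Lw_sum _ _ x y (weight_sqrt Hw) Hg').
have hd x' y' : is_derive x' v (g ^~ y') (\sum_j v 0 j * pdx j g x' y').
  exact: is_derive_grad.
exact: (@Lw_derive _ _ _ _ _ _ _ x y Hw Hg (bcont_sum (index_enum 'I_d) (v 0) Hg') hd).
Qed.

Lemma sum_delta (j : 'I_d) (F : 'I_d -> R) :
  \sum_i (delta_mx 0 j : 'rV[R]_d) 0 i * F i = F j.
Proof.
rewrite (bigD1 j)//= mxE !eqxx mul1r big1 ?addr0// => i /negbTE ij.
by rewrite mxE ij andbF mul0r.
Qed.

Lemma pdx_Lw w c M g (j : 'I_d) : weight w c -> bcont M g ->
  (forall x y, differentiable (g ^~ y) x) -> (forall j, bcont M (pdx j g)) ->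
  pdx j (Lw w g) = Lw (fun s => w s * Num.sqrt (1 - s)) (pdx j g).
Proof.
move=> Hw Hg dg Hg'; apply/funext => x; apply/funext => y.
have := Lw_line (delta_mx 0 j) x y Hw Hg dg Hg'.
by rewrite sum_delta => /@derive_val.
Qed.

Lemma fh_line h v x y : H3 h ->
  is_derive x v (f h ^~ y) (\sum_j v 0 j * Lw w1 (pdx j h) x y).
Proof.
move=> Hh; have Hg' j := H3_bcont1 j Hh.
rewrite -(Lw_sum _ _ x y weight1 Hg').
have hd x' y' : is_derive x' v (h ^~ y') (\sum_j v 0 j * pdx j h x' y').
  by apply: is_derive_grad; exact: H3_diff.
exact: (@fh_derive _ _ _ _ x y Hh (bcont_sum (index_enum 'I_d) (v 0) Hg') hd).
Qed.

Lemma pdx_fh h (j : 'I_d) : H3 h -> pdx j (f h) = Lw w1 (pdx j h).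
Proof.
move=> Hh; apply/funext => x; apply/funext => y.
by have := fh_line (delta_mx 0 j) x y Hh; rewrite sum_delta => /@derive_val.
Qed.

Lemma w12 s : s \in `]0, 1[ -> w1 s * Num.sqrt (1 - s) = w2 s.
Proof. by move=> s01; rewrite /w1 -mulrA sqrt_kap// mulr1. Qed.

Lemma pdx2_fh h (j k : 'I_d) : H3 h ->
  pdx k (pdx j (f h)) = Lw w2 (pdx k (pdx j h)).
Proof.
move=> Hh; rewrite (pdx_fh j Hh).
rewrite (pdx_Lw k weight1 (H3_bcont1 j Hh) (fun x y => H3_diff1 _ _ _ Hh) (fun i => H3_bcont2 i j Hh)).
apply/funext => x; apply/funext => y.
by apply: (Lw_eq _ _ (weight_sqrt weight1) (H3_bcont2 k j Hh)) => s; exact: w12.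
Qed.

Lemma pdx3_fh h (j k l : 'I_d) : H3 h ->
  pdx l (pdx k (pdx j (f h))) = Lw w3 (pdx l (pdx k (pdx j h))).
Proof.
move=> Hh; rewrite (pdx2_fh j k Hh).
exact: (pdx_Lw l weight2 (H3_bcont2 k j Hh) (fun x y => H3_diff2 _ _ _ _ Hh) (fun i => H3_bcont3 i k j Hh)).
Qed.

Lemma fh_line1 h v x y : H3 h ->
  is_derive x v (f h ^~ y) (\sum_j v 0 j * pdx j (f h) x y).
Proof.
move=> Hh; apply: is_derive_eq (fh_line v x y Hh) _.
by apply: eq_bigr => j _; rewrite (pdx_fh j Hh).
Qed.

Lemma fh_line2 h (j : 'I_d) v x y : H3 h ->
  is_derive x v (pdx j (f h) ^~ y) (\sum_(l < d) v 0 l * pdx l (pdx j (f h)) x y).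
Proof.
move=> Hh; rewrite {1}(pdx_fh j Hh).
apply: is_derive_eq (Lw_line v x y weight1 (H3_bcont1 j Hh) (fun x y => H3_diff1 _ _ _ Hh) (fun i => H3_bcont2 i j Hh)) _.
apply: eq_bigr => k _; rewrite (pdx2_fh j k Hh); congr (_ * _).
by apply: (Lw_eq _ _ (weight_sqrt weight1) (H3_bcont2 k j Hh)) => s; exact: w12.
Qed.

Lemma fh_line3 h (j k : 'I_d) v x y : H3 h ->
  is_derive x v (pdx k (pdx j (f h)) ^~ y) (\sum_(l < d) v 0 l * pdx l (pdx k (pdx j (f h))) x y).
Proof.
move=> Hh; rewrite {1}(pdx2_fh j k Hh).
apply: is_derive_eq (Lw_line v x y weight2 (H3_bcont2 k j Hh) (fun x y => H3_diff2 _ _ _ _ Hh) (fun i => H3_bcont3 i k j Hh)) _.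
by apply: eq_bigr => l _; rewrite (pdx3_fh j k l Hh).
Qed.

Lemma H3_pdxC h (j k : 'I_d) : H3 h -> pdx j (pdx k h) = pdx k (pdx j h).
Proof.
move=> Hh; apply/funext => x; apply/funext => y.
apply: (@pdC _ _ (h ^~ y)) => [x'|i x'|i l].
- exact: H3_diff.
- exact: (H3_diff1 y i x' Hh).
- by have [_ c2] := H3_bcont2 i l Hh; exact: (c2 y).
Qed.

Lemma H3_pdx3C h (j k l : 'I_d) : H3 h ->
  pdx j (pdx k (pdx l h)) = pdx k (pdx j (pdx l h)).
Proof.
move=> Hh; apply/funext => x; apply/funext => y.
apply: (@pdC _ _ (pdx l h ^~ y)) => [x'|i x'|i i'].
- exact: H3_diff1.
- exact: (H3_diff2 y i l x' Hh).
- by have [_ c3] := H3_bcont3 i i' l Hh; exact: (c3 y).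
Qed.

Lemma fh_pdxC h (j k : 'I_d) : H3 h -> pdx j (pdx k (f h)) = pdx k (pdx j (f h)).
Proof. by move=> Hh; rewrite (pdx2_fh k j Hh) (pdx2_fh j k Hh) (H3_pdxC j k Hh). Qed.

(** Expanding d_j f produces partials in the reverse of the order used in the bound. Three adjacent
    transpositions, performed on h, are transported through [Lw w3]. *)
Lemma fh_pdx3C h (j k l : 'I_d) : H3 h ->
  pdx l (pdx k (pdx j (f h))) = pdx j (pdx k (pdx l (f h))).
Proof.
move=> Hh.
have e1 : pdx l (pdx k (pdx j h)) = pdx l (pdx j (pdx k h)) := congr1 (pdx l) (H3_pdxC k j Hh).
have e2 := H3_pdx3C l j k Hh.
have e3 : pdx j (pdx l (pdx k h)) = pdx j (pdx k (pdx l h)) := congr1 (pdx j) (H3_pdxC l k Hh).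
exact: etrans (pdx3_fh j k l Hh) (etrans (congr1 (Lw w3) (etrans e1 (etrans e2 e3))) (esym (pdx3_fh l k j Hh))).
Qed.

Lemma stein_equation h x y : H3 h ->
  \sum_(j < d) \sum_(l < d) Sigma j l * pdx l (pdx j (f h)) x y
  - \sum_j x 0 j * pdx j (f h) x y
  + 2 * \sum_k (lam k * Dk k (f h) x y - (y k)%:R * Dk k (f h) x (decr y k))
  = h x y - EhZN Sigma lam h.
Proof.
move=> Hh; apply: oppr_inj; rewrite opprB -(TD_integral x y Hh).
have [_ [_ ->]] := TD_singular x y Hh.
rewrite -(pair_bigA _ (fun j l : 'I_d => Sigma j l * Lw w2 (pdx l (pdx j h)) x y))/=.
have -> : \sum_(j < d) \sum_(l < d) Sigma j l * pdx l (pdx j (f h)) x y =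
    \sum_(j < d) \sum_(l < d) Sigma j l * Lw w2 (pdx l (pdx j h)) x y.
  by apply: eq_bigr => j _; apply: eq_bigr => l _; rewrite (pdx2_fh j l Hh).
have -> : \sum_j x 0 j * pdx j (f h) x y = \sum_j x 0 j * Lw w1 (pdx j h) x y.
  by apply: eq_bigr => j _; rewrite (pdx_fh j Hh).
have -> : \sum_k (lam k * Dk k (f h) x y - (y k)%:R * Dk k (f h) x (decr y k)) =
    \sum_k lam k * Lw w2 (Dk k h) x y - \sum_k (y k)%:R * Lw w2 (Dk k h) x (decr y k).
  by rewrite -sumrB; apply: eq_bigr => k _; rewrite (fh_Dk k x y Hh) (fh_Dk k x (decr y k) Hh).
have -> : \sum_k 2 * lam k * Lw w2 (Dk k h) x y = 2 * \sum_k lam k * Lw w2 (Dk k h) x y.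
  by rewrite mulr_sumr; apply: eq_bigr => k _; rewrite mulrA.
have -> : \sum_k 2 * (y k)%:R * Lw w2 (Dk k h) x (decr y k) =
    2 * \sum_k (y k)%:R * Lw w2 (Dk k h) x (decr y k).
  by rewrite mulr_sumr; apply: eq_bigr => k _; rewrite mulrA.
ring.
Qed.

End InterpolationSemigroup.

(** * Expectations over a finite space *)

Section FiniteExpectation.
Context {R : realType} {Om : finType}.
Set Implicit Arguments.
Unset Strict Implicit.
Implicit Types (X Y : Om -> R) (c : R).

Definition fexp (mu : Om -> R) (X : Om -> R) : R := \sum_i mu i * X i.

Variable mu : Om -> R.

Lemma fexpZ c X : fexp mu (fun i => c * X i) = c * fexp mu X.
Proof. by rewrite /fexp mulr_sumr; apply: eq_bigr => i _; rewrite mulrCA. Qed.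

Lemma fexpD X Y : fexp mu (fun i => X i + Y i) = fexp mu X + fexp mu Y.
Proof. by rewrite /fexp -big_split; apply: eq_bigr => i _; rewrite mulrDr. Qed.

Lemma fexpB X Y : fexp mu (fun i => X i - Y i) = fexp mu X - fexp mu Y.
Proof. by rewrite /fexp -sumrB; apply: eq_bigr => i _; rewrite mulrBr. Qed.

Lemma fexp_sum (I : finType) (Q : pred I) (X : I -> Om -> R) :
  fexp mu (fun i => \sum_(a | Q a) X a i) = \sum_(a | Q a) fexp mu (X a).
Proof.
by rewrite /fexp exchange_big; apply: eq_bigr => i _; rewrite mulr_sumr.
Qed.

Lemma eq_fexp X Y : X =1 Y -> fexp mu X = fexp mu Y.
Proof. by move=> XY; apply: eq_bigr => i _; rewrite XY. Qed.

Hypothesis mu_ge0 : forall i, 0 <= mu i.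

Lemma fexp_ge0 X : (forall i, 0 <= X i) -> 0 <= fexp mu X.
Proof. by move=> X0; apply: sumr_ge0 => i _; rewrite mulr_ge0. Qed.

Lemma ler_norm_fexp X : `|fexp mu X| <= fexp mu (fun i => `|X i|).
Proof.
rewrite (le_trans (ler_norm_sum _ _ _))// ler_sum// => i _.
by rewrite normrM ger0_norm.
Qed.

Hypothesis mu_sum1 : \sum_i mu i = 1.

Lemma fexp_cst c : fexp mu (fun=> c) = c.
Proof. by rewrite /fexp -mulr_suml mu_sum1 mul1r. Qed.

(** With m = E|X|, expand E(|X| - m)^2 >= 0. *)
Lemma fexp_norm_le_sqrt X :
  fexp mu (fun i => `|X i|) <= Num.sqrt (fexp mu (fun i => X i ^+ 2)).
Proof.
have M0 : 0 <= fexp mu (fun i => `|X i|) by exact: fexp_ge0.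
rewrite -(ger0_norm M0) -sqrtr_sqr ler_sqrt; last by apply: fexp_ge0 => i; exact: sqr_ge0.
set m := fexp mu (fun i => `|X i|).
have : 0 <= fexp mu (fun i => (`|X i| - m) ^+ 2) by apply: fexp_ge0 => i; exact: sqr_ge0.
have -> : fexp mu (fun i => (`|X i| - m) ^+ 2) =
    fexp mu (fun i => X i ^+ 2 - ((2 * m) * `|X i| - m ^+ 2)).
  by apply: eq_fexp => i; rewrite sqrrB real_normK ?num_real//; ring.
by rewrite fexpB fexpB fexpZ fexp_cst -/m; lra.
Qed.

End FiniteExpectation.

(* Weights of value [+oo] are allowed, which is why this is not an
   inequality between reals. *)
Lemma le_wsum {R : realType} {I K : finType} (Q : pred I) (m x : I -> R)
    (S : K -> \bar R) (y : I -> K -> R) :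
  (forall a, 0 <= m a) -> (forall t, 0 <= S t)%E -> (forall a t, 0 <= y a t) ->
  (forall a, Q a -> (x a)%:E <= \sum_t S t * (y a t)%:E)%E ->
  ((\sum_(a | Q a) m a * x a)%:E <= \sum_t S t * (\sum_(a | Q a) m a * y a t)%:E)%E.
Proof.
move=> m0 S0 y0 xS; rewrite -sumEFin.
apply: (@le_trans _ _ (\sum_(a | Q a) \sum_t S t * (m a * y a t)%:E)%E); last first.
  rewrite exchange_big; apply: lee_sum => t _; rewrite -sumEFin ge0_sume_distrr//.
  by move=> a _; rewrite lee_fin mulr_ge0.
apply: lee_sum => a Qa; rewrite EFinM.
apply: (@le_trans _ _ ((m a)%:E * \sum_t S t * (y a t)%:E)%E).
  by rewrite lee_wpmul2l ?lee_fin// xS.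
rewrite ge0_sume_distrr; last by move=> t _; rewrite mule_ge0 ?lee_fin.
by apply: lee_sum => t _; rewrite EFinM muleCA.
Qed.

Lemma le_norm_fexp_wsum {R : realType} {Om K : finType} (mu X : Om -> R)
    (S : K -> \bar R) (Y : K -> Om -> R) :
  (forall i, 0 <= mu i) -> (forall t, 0 <= S t)%E -> (forall t i, 0 <= Y t i) ->
  (forall i, (`|X i|)%:E <= \sum_t S t * (Y t i)%:E)%E ->
  ((`|fexp mu X|)%:E <= \sum_t S t * (fexp mu (Y t))%:E)%E.
Proof.
move=> mu0 S0 Y0 XS; apply: (@le_trans _ _ (fexp mu (fun i => `|X i|))%:E).
  by rewrite lee_fin ler_norm_fexp.
by apply: (@le_wsum _ _ _ predT mu (fun i => `|X i|) S (fun i t => Y t i)).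
Qed.

Lemma le_norm_sum_wsum {R : realType} {I K : finType} (Q : pred I) (c : R) (x : I -> R)
    (S : K -> \bar R) (y : I -> K -> R) :
  0 <= c -> (forall t, 0 <= S t)%E -> (forall a t, 0 <= y a t) ->
  (forall a, Q a -> (`|x a|)%:E <= \sum_t S t * (y a t)%:E)%E ->
  ((`|c * \sum_(a | Q a) x a|)%:E <= \sum_t S t * (c * \sum_(a | Q a) y a t)%:E)%E.
Proof.
move=> c0 S0 y0 xS.
apply: (@le_trans _ _ (\sum_(a | Q a) c * `|x a|)%:E).
  by rewrite lee_fin normrM ger0_norm// -mulr_sumr ler_wpM2l// ler_norm_sum.
have := @le_wsum _ _ _ Q (fun=> c) (fun a => `|x a|) S y (fun=> c0) S0 y0 xS.
by under [X in (_ <= X)%E -> _]eq_bigr do rewrite -mulr_sumr.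
Qed.

(** * Increment bounds with possibly infinite constants *)

Section LineBounds.
Context {R : realType} {d : nat}.
Implicit Types (F : 'rV[R]_d -> R) (x v : 'rV[R]_d).

(** The mean value theorem on a segment. A coordinate with v_j = 0 contributes 0 even if [S j] is
    infinite. *)
Lemma line_increment_le F (dF : 'I_d -> 'rV[R]_d -> R) (S : 'I_d -> \bar R) :
  (forall x v, is_derive x v F (\sum_j v 0 j * dF j x)) ->
  (forall j, 0 <= S j)%E -> (forall j x, (`|dF j x|)%:E <= S j)%E ->
  forall x v, ((`|F (x + v) - F x|)%:E <= \sum_j S j * (`|v 0 j|)%:E)%E.
Proof.
move=> HF S0 HS x v.
have dline (t : R) : is_derive t 1 (fun t => F (x + t *: v))
    (\sum_j v 0 j * dF j (x + t *: v)) by apply: is_derive_line; exact: HF.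
have [c _] : exists2 c, c \in `]0, 1[%R &
    F (x + 1 *: v) - F (x + 0 *: v) = (\sum_j v 0 j * dF j (x + c *: v)) * (1 - 0).
  apply: (@MVT _ (fun t : R => F (x + t *: v))) => //.
  by apply: derivable_within_continuous => t _; apply: ex_derive.
rewrite scale1r scale0r addr0 subr0 mulr1 => ->.
apply: (@le_trans _ _ (\sum_j `|v 0 j| * `|dF j (x + c *: v)|)%:E).
  rewrite lee_fin (le_trans (ler_norm_sum _ _ _))// ler_sum// => j _.
  by rewrite normrM.
rewrite -sumEFin; apply: lee_sum => j _.
by rewrite EFinM muleC lee_wpmul2r ?lee_fin.
Qed.

(** Lagrange's remainder by Rolle's theorem applied twice. The factor 2 stays on the left so that no
    division occurs among extended reals. *)
Lemma taylor2_le F (dF : 'I_d -> 'rV[R]_d -> R) (ddF : 'I_d -> 'I_d -> 'rV[R]_d -> R)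
    (S : 'I_d -> 'I_d -> \bar R) :
  (forall x v, is_derive x v F (\sum_k v 0 k * dF k x)) ->
  (forall k x v, is_derive x v (dF k) (\sum_l v 0 l * ddF k l x)) ->
  (forall k l, 0 <= S k l)%E -> (forall k l x, (`|ddF k l x|)%:E <= S k l)%E ->
  forall x v, ((2 * `|F (x + v) - F x - \sum_k v 0 k * dF k x|)%:E <=
     \sum_k \sum_l S k l * (`|v 0 k * v 0 l|)%:E)%E.
Proof.
move=> HF HdF S0 HS x v.
pose phi (t : R) := F (x + t *: v).
pose phi1 (t : R) := \sum_k v 0 k * dF k (x + t *: v).
pose phi2 (t : R) := \sum_k \sum_l v 0 k * v 0 l * ddF k l (x + t *: v).
have dphi (t : R) : is_derive t 1 phi (phi1 t) by apply: is_derive_line; exact: HF.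
have dphi1 (t : R) : is_derive t 1 phi1 (phi2 t).
  have H (k : 'I_d) : is_derive t 1 (fun t => v 0 k * dF k (x + t *: v))
      (v 0 k * \sum_l v 0 l * ddF k l (x + t *: v)).
    by apply: is_derive1Z; apply: is_derive_line; exact: HdF.
  have := @is_derive_sum _ _ _ d (fun k (t : R) => v 0 k * dF k (x + t *: v)) t 1 _ H.
  rewrite (_ : \sum_(k < d) _ = phi1); last by apply/funext => u; rewrite fct_sumE.
  move=> H1; apply: (is_derive_eq H1); apply: eq_bigr => k _.
  by rewrite mulr_sumr; apply: eq_bigr => l _; rewrite mulrA.
pose K := phi 1 - phi 0 - phi1 0.
(* By the choice of K, [psi] vanishes at 0 and 1, and [psi1] vanishes at 0; the second use of Rolle
   yields [phi2 e = 2 * K]. *)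
pose psi (t : R) := phi t - (phi 0 + t * phi1 0 + t ^+ 2 * K).
pose psi1 (t : R) := phi1 t - (phi1 0 + 2 * t * K).
have dpsi (t : R) : is_derive t 1 psi (psi1 t).
  by apply: is_derive_eq; rewrite /psi1 /GRing.scale/=; ring.
have dpsi1 (t : R) : is_derive t 1 psi1 (phi2 t - 2 * K).
  by apply: is_derive_eq; rewrite /GRing.scale/=; ring.
have [c /[!in_itv]/= /andP[c0 _] c1] : exists2 c : R, c \in `]0, 1[ & is_derive c 1 psi 0.
  apply: Rolle => //.
  - by apply: derivable_within_continuous => t _; apply: ex_derive.
  - by rewrite /psi /K; ring.
have [e _ e1] : exists2 e : R, e \in `]0, c[ & is_derive e 1 psi1 0.
  apply: Rolle => //.
  - by apply: derivable_within_continuous => t _; apply: ex_derive.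
  - have := @derive_val _ _ _ _ _ _ _ c1; rewrite (@derive_val _ _ _ _ _ _ _ (dpsi c)) => ->.
    by rewrite /psi1; ring.
have KE : 2 * K = phi2 e.
  have := @derive_val _ _ _ _ _ _ _ e1; rewrite (@derive_val _ _ _ _ _ _ _ (dpsi1 e)).
  by move/subr0_eq.
have -> : F (x + v) - F x - \sum_k v 0 k * dF k x = K.
  by rewrite /K /phi /phi1 scale1r scale0r addr0.
have -> : 2 * `|K| = `|phi2 e| by rewrite -KE normrM ger0_norm.
apply: (@le_trans _ _ (\sum_k \sum_l `|v 0 k * v 0 l| * `|ddF k l (x + e *: v)|)%:E).
  rewrite lee_fin (le_trans (ler_norm_sum _ _ _))// ler_sum// => k _.
  by rewrite (le_trans (ler_norm_sum _ _ _))// ler_sum// => l _; rewrite normrM.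
rewrite -sumEFin; apply: lee_sum => k _; rewrite -sumEFin; apply: lee_sum => l _.
by rewrite EFinM muleC lee_wpmul2r ?lee_fin.
Qed.

End LineBounds.

(** A walk from y to y' by unit steps, each one reducing the distance, visits only coordinates where
    the two differ; an infinite [S k] is thus charged only there. *)
Lemma nat_increment_le {R : realType} {r : nat} (G : ('I_r -> nat) -> R)
    (S : 'I_r -> \bar R) :
  (forall k, 0 <= S k)%E -> (forall k y, (`|G (incr y k) - G y|)%:E <= S k)%E ->
  forall y y', ((`|G y - G y'|)%:E <=
    \sum_k S k * (`|(y k)%:R - (y' k)%:R|)%:E)%E.
Proof.
move=> S0 HS.
pose bnd y y' := (\sum_k S k * (`|(y k)%:R - (y' k)%:R : R|)%:E)%E.
pose dist (y y' : 'I_r -> nat) := (\sum_k ((y k - y' k) + (y' k - y k)))%N.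
have step y y' k : (y' k < y k)%N ->
    ((`|G (decr y k) - G y'|)%:E <= bnd (decr y k) y')%E ->
    ((`|G y - G y'|)%:E <= bnd y y')%E.
  move=> lt IH; have yE : incr (decr y k) k = y.
    by apply/funext => i; rewrite /incr /decr; case: (eqVneq i k) => [->|_] /=; lia.
  apply: (@le_trans _ _ (S k + bnd (decr y k) y')%E).
    apply: (@le_trans _ _ ((`|G y - G (decr y k)|)%:E + (`|G (decr y k) - G y'|)%:E)%E).
      by rewrite -EFinD lee_fin ler_distD.
    by apply: leeD => //; rewrite -{1}yE.
  rewrite /bnd (bigD1 k)//= [leRHS](bigD1 k)//= addeA leeD//.
    rewrite -[X in (X + _)%E]mule1 -ge0_muleDr// lee_wpmul2l// lee_fin.
    rewrite /decr eqxx natrB; last by lia.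
    have : (y' k)%:R + 1 <= (y k)%:R :> R by rewrite natr1 ler_nat.
    by rewrite [true%:R]mulr1n => h; rewrite !ger0_norm; lra.
  apply: lee_sum => i /negbTE ik; rewrite /decr ik subn0.
  exact: lexx.
move=> y y'; have [n] := ubnP (dist y y'); elim: n y y' => // n IH y y' lt.
(* By symmetry only downward steps are needed: whichever point is larger in some coordinate is
   lowered. *)
have symb : bnd y y' = bnd y' y by apply: eq_bigr => k _; rewrite distrC.
have lt_dist (z z' : 'I_r -> nat) k : (z' k < z k)%N -> (dist (decr z k) z' < dist z z')%N.
  move=> kk; rewrite /dist (bigD1 k)//= [ltnRHS](bigD1 k)//= -addSn leq_add//.
    by rewrite /decr eqxx; lia.
  by apply: leq_sum => i /negbTE ik; rewrite /decr ik subn0.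
have [/existsP[k kk]|/existsPn gek] := boolP [exists k, (y' k < y k)%N].
  by apply: (step _ _ k kk); apply: IH; have := lt_dist _ _ _ kk; lia.
have [/existsP[k kk]|/existsPn lek] := boolP [exists k, (y k < y' k)%N].
  rewrite -/(bnd y y') symb distrC.
  apply: (step _ _ k kk); apply: IH; have := lt_dist _ _ _ kk.
  have : dist y y' = dist y' y by apply: eq_bigr => i _; rewrite addnC.
  lia.
have -> : y = y'.
  by apply/funext => k; have := gek k; have := lek k; lia.
by rewrite subrr normr0 sume_ge0// => k _; rewrite mule_ge0 ?lee_fin.
Qed.

Lemma b2rM {R : realType} (a b : bool) : b2r (a && b) = b2r a * b2r b :> R.
Proof. by case: a; rewrite /b2r /= ?mul1r// mul0r. Qed.

Lemma b2r_ge0 {R : realType} (a : bool) : 0 <= b2r a :> R.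
Proof. by case: a; rewrite /b2r /=. Qed.

(** Expansion over single configurations, which carries the coupling hypothesis from atoms to
    arbitrary functions of the indicators. *)
Lemma b2r_ind {R : realType} {Gam : finType} (psi : (Gam -> bool) -> R) (u : Gam -> bool) :
  psi u = \sum_(v : {ffun Gam -> bool}) psi v * b2r [forall b, u b == v b].
Proof.
rewrite (bigD1 [ffun b => u b])//= big1 => [|v vu].
  rewrite (_ : [forall b, _] = true); last by apply/forallP => b; rewrite ffunE.
  by rewrite addr0 /b2r mulr1; congr psi; apply/funext => b; rewrite ffunE.
rewrite (_ : [forall b, _] = false) ?/b2r ?mulr0//.
apply/negbTE; apply: contra vu => /forallP uv.
by apply/eqP/ffunP => b; rewrite ffunE; apply/esym/eqP.
Qed.

(** * The size-bias coupling *)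

Section CouplingIdentities.
Context {R : realType} {Om Gam : finType}.
Set Implicit Arguments.
Unset Strict Implicit.
Variables (mu : Om -> R) (I : Gam -> Om -> bool) (J : Gam -> Gam -> Om -> bool).
Local Notation E := (fexp mu).
Local Notation p a := (E (fun i => b2r (I a i))).
(** The conditional law multiplied by p_a; at p_a = 0 both sides vanish. *)
Hypothesis law : forall a (v : Gam -> bool),
  E (fun i => b2r (I a i && [forall b, J b a i == v b])) =
  p a * E (fun i => b2r [forall b, I b i == v b]).

Lemma fexp_coupling a (psi : (Gam -> bool) -> R) :
  E (fun i => b2r (I a i) * psi (fun b => J b a i)) =
  p a * E (fun i => psi (fun b => I b i)).
Proof.
transitivity (E (fun i => \sum_(v : {ffun Gam -> bool})
    psi v * b2r (I a i && [forall b, J b a i == v b]))).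
  apply: eq_fexp => i; rewrite (b2r_ind psi) mulr_sumr; apply: eq_bigr => v _.
  by rewrite b2rM mulrCA.
have -> : E (fun i => psi (fun b => I b i)) = E (fun i => \sum_(v : {ffun Gam -> bool})
    psi v * b2r [forall b, I b i == v b]).
  by apply: eq_fexp => i; rewrite -b2r_ind.
rewrite !fexp_sum mulr_sumr; apply: eq_bigr => v _.
by rewrite !fexpZ law mulrCA.
Qed.

Lemma fexp_centered_mul a (psi : (Gam -> bool) -> R) :
  E (fun i => (b2r (I a i) - p a) * psi (fun b => I b i)) =
  E (fun i => b2r (I a i) * (psi (fun b => I b i) - psi (fun b => J b a i))).
Proof.
rewrite (@eq_fexp _ _ _ _ (fun i => b2r (I a i) * psi (fun b => I b i) -
  p a * psi (fun b => I b i))); last by move=> i; rewrite mulrBl.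
rewrite fexpB fexpZ -fexp_coupling -fexpB.
by apply: eq_fexp => i; rewrite mulrBr.
Qed.

Lemma fexp_sum_centered_mul (Q : pred Gam) (psi : (Gam -> bool) -> R) :
  E (fun i => (\sum_(a | Q a) (b2r (I a i) - p a)) * psi (fun b => I b i)) =
  \sum_(a | Q a)
    E (fun i => b2r (I a i) * (psi (fun b => I b i) - psi (fun b => J b a i))).
Proof.
rewrite (@eq_fexp _ _ _ _ (fun i => \sum_(a | Q a)
  (b2r (I a i) - p a) * psi (fun b => I b i))); last by move=> i; rewrite mulr_suml.
by rewrite fexp_sum; apply: eq_bigr => a _; exact: fexp_centered_mul.
Qed.

Hypothesis mu_ge0 : forall i, 0 <= mu i.

(** The pointwise bound is demanded only where I_a = 1; removing alpha from its own count is
    meaningful only there. *)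
Lemma le_norm_sum_fexp_wsum {K : finType} (Q : pred Gam) c (Z : Gam -> Om -> R)
    (S : K -> \bar R) (y : Gam -> K -> Om -> R) :
  0 <= c -> (forall t, 0 <= S t)%E -> (forall a t i, 0 <= y a t i) ->
  (forall a i, Q a -> I a i -> (`|Z a i|)%:E <= \sum_t S t * (y a t i)%:E)%E ->
  ((`|c * \sum_(a | Q a) E (fun i => b2r (I a i) * Z a i)|)%:E <=
    \sum_t S t * (c * \sum_(a | Q a) E (fun i => b2r (I a i) * y a t i))%:E)%E.
Proof.
move=> c0 S0 y0 H; apply: (@le_norm_sum_wsum _ _ _ Q c _ S
  (fun a t => E (fun i => b2r (I a i) * y a t i))) => // [a t|a Qa].
  by apply: fexp_ge0 => // i; rewrite mulr_ge0// b2r_ge0.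
apply: (@le_norm_fexp_wsum _ _ _ _ _ S (fun t i => b2r (I a i) * y a t i)) => // [t i|i].
  by rewrite mulr_ge0// b2r_ge0.
have := H a i Qa; case: (I a i) => [/(_ isT)|_]; rewrite /b2r/=.
  by rewrite mul1r; under [X in _ -> (_ <= X)%E]eq_bigr do rewrite mul1r.
rewrite mul0r normr0 sume_ge0// => t _.
by rewrite mul0r mule0.
Qed.

End CouplingIdentities.

Lemma le_supn {R : realType} {d r : nat} (F : 'rV[R]_d -> ('I_r -> nat) -> R) x y :
  ((`|F x y|)%:E <= supn F)%E.
Proof. by apply: ereal_sup_ubound; exists x, y. Qed.

Lemma supn_ge0 {R : realType} {d r : nat} (F : 'rV[R]_d -> ('I_r -> nat) -> R) :
  (0 <= supn F)%E.
Proof. by apply: le_trans (le_supn F 0 (fun=> 0%N)); rewrite lee_fin. Qed.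

Lemma le_norm_sum_ereal {R : realType} {K : finType} (x : K -> R) (B : K -> \bar R) :
  (forall t, (`|x t|)%:E <= B t)%E -> ((`|\sum_t x t|)%:E <= \sum_t B t)%E.
Proof.
move=> H; apply: (@le_trans _ _ (\sum_t `|x t|)%:E).
  by rewrite lee_fin ler_norm_sum.
by rewrite -sumEFin; apply: lee_sum => t _.
Qed.

Lemma le_norm_stein_terms {R : realType} (a1 a2 a3 a4 a5 : R) (b1 b2 b3 b4 b5 : \bar R) :
  ((`|a1|)%:E <= b1)%E -> ((`|a2|)%:E <= b2)%E -> ((`|a3|)%:E <= b3)%E ->
  ((`|a4|)%:E <= b4)%E -> ((`|a5|)%:E <= b5)%E ->
  ((`|a1 + a2 - a3 + (2 * a4 + 2 * a5)|)%:E <=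
    b1 + b2 + b3 + 2%:E * b4 + 2%:E * b5)%E.
Proof.
move=> h1 h2 h3 h4 h5.
apply: (@le_trans _ _ ((`|a1|)%:E + (`|a2|)%:E + (`|a3|)%:E + 2%:E * (`|a4|)%:E
    + 2%:E * (`|a5|)%:E)%E).
  rewrite -!EFinM -!EFinD lee_fin addrA.
  have n2 (x : R) : 2 * `|x| = `|2 * x| by rewrite normrM ger0_norm.
  rewrite !n2; apply: le_trans (ler_normD _ _) _; rewrite lerD2r.
  apply: le_trans (ler_normD _ _) _; rewrite lerD2r.
  apply: le_trans (ler_normB _ _) _; rewrite lerD2r.
  exact: ler_normD.
by do ?apply: leeD => //; rewrite lee_wpmul2l ?lee_fin.
Qed.

(** * Decomposition of E h(W) - E h(Z, N) *)

Section SizeBiasCoupling.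
Context {R : realType} {Om Gam : finType} {d r : nat}.
Set Implicit Arguments.
Unset Strict Implicit.
Variables (mu : Om -> R) (I : Gam -> Om -> bool) (J : Gam -> Gam -> Om -> bool).
Variables (cls : Gam -> 'I_d + 'I_r) (s : 'I_d -> R) (p : Gam -> R).
Local Notation E := (fexp mu).
Hypothesis mu_ge0 : forall i, 0 <= mu i.
Hypothesis mu_sum1 : \sum_i mu i = 1.
Hypothesis pE : forall a, p a = E (fun i => b2r (I a i)).
Hypothesis law : forall a (v : Gam -> bool),
  E (fun i => b2r (I a i && [forall b, J b a i == v b])) =
  E (fun i => b2r (I a i)) * E (fun i => b2r [forall b, I b i == v b]).
Hypothesis s_gt0 : forall j, 0 < s j.

(** A function of the configuration, so that one formula yields both W_1 and its coupled version. *)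
Definition normW (u : Gam -> bool) : 'rV[R]_d :=
  \row_(j < d) ((s j)^-1 * \sum_(a | cls a == inl j) (b2r (u a) - p a)).
Definition countW (u : Gam -> bool) (k : 'I_r) : nat :=
  (\sum_(a | cls a == inr k) (u a : nat))%N.

Local Notation W1 i := (normW (fun b => I b i)).
Local Notation W2 i := (countW (fun b => I b i)).
Local Notation V1 a i := (normW (fun b => J b a i)).
Local Notation V2 a i := (countW (fun b => J b a i)).
Local Notation D a b i := (b2r (I b i) - b2r (J b a i) : R).
Local Notation X j k i := (\sum_(a | cls a == inl j)
  (b2r (I a i) * \sum_(b | cls b == inl k) D a b i)).

Lemma normWB a i k : (W1 i - V1 a i) 0 k = (s k)^-1 * \sum_(b | cls b == inl k) D a b i.
Proof.
rewrite !mxE -mulrBr -sumrB; congr (_ * _); apply: eq_bigr => b _; ring.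
Qed.

Lemma countWB a i k : (W2 i k)%:R - (V2 a i k)%:R = \sum_(b | cls b == inr k) D a b i.
Proof. by rewrite /countW !natr_sum -sumrB. Qed.

Lemma fexp_normW_mul (j : 'I_d) (psi : (Gam -> bool) -> R) :
  E (fun i => W1 i 0 j * psi (fun b => I b i)) = (s j)^-1 *
  \sum_(a | cls a == inl j)
    E (fun i => b2r (I a i) * (psi (fun b => I b i) - psi (fun b => J b a i))).
Proof.
rewrite -(fexp_sum_centered_mul law) -fexpZ; apply: eq_fexp => i.
by rewrite mxE mulrA; congr (_ * _ * _); apply: eq_bigr => a _; rewrite pE.
Qed.

Lemma fexp_normW (j : 'I_d) : E (fun i => W1 i 0 j) = 0.
Proof.
transitivity (E (fun i => W1 i 0 j * 1)); first by apply: eq_fexp => i; rewrite mulr1.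
rewrite (fexp_normW_mul j (fun=> 1)) big1 ?mulr0// => a _.
by rewrite -[RHS](fexp_cst mu_sum1 0); apply: eq_fexp => i; rewrite subrr mulr0.
Qed.

(** The size-bias identity with a coordinate of W_1 as test function: up to scaling, Sigma is the
    mean of X, the very quantity that appears in the linear Taylor term. *)
Lemma fexp_normW_normW (j k : 'I_d) :
  E (fun i => (W1 i 0 j - E (fun i => W1 i 0 j)) * (W1 i 0 k - E (fun i => W1 i 0 k))) =
  (s j * s k)^-1 * E (fun i => X j k i).
Proof.
rewrite !fexp_normW.
transitivity (E (fun i => W1 i 0 j * W1 i 0 k)); first by apply: eq_fexp => i; rewrite !subr0.
rewrite (fexp_normW_mul j (fun u => normW u 0 k)) fexp_sum invfM -mulrA; congr (_ * _).
rewrite mulr_sumr; apply: eq_bigr => a _; rewrite -fexpZ; apply: eq_fexp => i.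
by have := normWB a i k; rewrite !mxE => ->; rewrite mulrCA.
Qed.

Lemma fexp_countW_mul (k : 'I_r) (Z : Om -> R) :
  E (fun i => (W2 i k)%:R * Z i) =
  \sum_(a | cls a == inr k) E (fun i => b2r (I a i) * Z i).
Proof.
rewrite -fexp_sum; apply: eq_fexp => i; rewrite -mulr_suml; congr (_ * _).
by rewrite /countW natr_sum.
Qed.

Lemma fexp_countW_cst_mul (k : 'I_r) (G : 'rV[R]_d -> ('I_r -> nat) -> R) :
  E (fun i => (W2 i k)%:R) * E (fun i => G (W1 i) (W2 i)) =
  \sum_(a | cls a == inr k) E (fun i => b2r (I a i) * G (V1 a i) (V2 a i)).
Proof.
have -> : E (fun i => (W2 i k)%:R) = \sum_(a | cls a == inr k) E (fun i => b2r (I a i)).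
  have := fexp_countW_mul k (fun=> 1).
  under eq_fexp do rewrite mulr1.
  by move=> ->; apply: eq_bigr => a _; apply: eq_fexp => i; rewrite mulr1.
rewrite mulr_suml; apply: eq_bigr => a _.
by rewrite (fexp_coupling law a (fun u => G (normW u) (countW u))).
Qed.

Implicit Types (g G : 'rV[R]_d -> ('I_r -> nat) -> R)
  (dg : 'I_d -> 'rV[R]_d -> ('I_r -> nat) -> R).

(* The summands of the decomposition of E h(W) - E h(Z, N); V1 and V2 stand for
   W_1 and W_2 computed from the coupled indicators J_{. a}. *)
Definition cov_defect g (j l : 'I_d) : R :=
  E (fun i => X j l i) * E (fun i => g (W1 i) (W2 i)) -
  E (fun i => X j l i * g (W1 i) (W2 i)).

Definition taylor_rem g dg a i : R :=
  g (V1 a i) (W2 i) - g (W1 i) (W2 i) -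
  \sum_l (V1 a i - W1 i) 0 l * dg l (W1 i) (W2 i).

Definition count_shift g a i : R := g (V1 a i) (W2 i) - g (V1 a i) (V2 a i).

Definition location_shift G a i : R := G (V1 a i) (V2 a i) - G (W1 i) (V2 a i).

Definition removal_shift G (k : 'I_r) a i : R :=
  G (W1 i) (V2 a i) - G (W1 i) (decr (W2 i) k).

Lemma fexp_stein_coord g dg (j : 'I_d) :
  \sum_l (s j * s l)^-1 * E (fun i => X j l i) * E (fun i => dg l (W1 i) (W2 i))
  - E (fun i => W1 i 0 j * g (W1 i) (W2 i)) =
  \sum_l (s j * s l)^-1 * cov_defect (dg l) j l
  + (s j)^-1 * (\sum_(a | cls a == inl j) E (fun i => b2r (I a i) * taylor_rem g dg a i))
  - (s j)^-1 * (\sum_(a | cls a == inl j) E (fun i => b2r (I a i) * count_shift g a i)).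
Proof.
rewrite (fexp_normW_mul j (fun u => g (normW u) (countW u))).
(* The path goes from (W1, W2) through (V1, W2) to (V1, V2). Expanding the first leg at (W1, W2)
   keeps the derivatives functions of (W1, W2), as conditioning requires. *)
have -> : \sum_(a | cls a == inl j) E (fun i => b2r (I a i) *
      (g (W1 i) (W2 i) - g (V1 a i) (V2 a i))) =
    \sum_l (s l)^-1 * E (fun i => X j l i * dg l (W1 i) (W2 i))
    - \sum_(a | cls a == inl j) E (fun i => b2r (I a i) * taylor_rem g dg a i)
    + \sum_(a | cls a == inl j) E (fun i => b2r (I a i) * count_shift g a i).
  have -> : \sum_l (s l)^-1 * E (fun i => X j l i * dg l (W1 i) (W2 i)) =
      \sum_(a | cls a == inl j) E (fun i => b2r (I a i) *
        \sum_l (W1 i - V1 a i) 0 l * dg l (W1 i) (W2 i)).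
    rewrite -fexp_sum; under eq_bigr do rewrite -fexpZ; rewrite -fexp_sum.
    apply: eq_fexp => i.
    under [RHS]eq_bigr do rewrite mulr_sumr.
    rewrite exchange_big/=; apply: eq_bigr => l _; rewrite mulr_suml mulr_sumr.
    by apply: eq_bigr => a _; rewrite normWB; ring.
  rewrite -sumrB -big_split/=; apply: eq_bigr => a _.
  rewrite -fexpB -fexpD; apply: eq_fexp => i.
  rewrite -mulrBr -mulrDr; congr (_ * _).
  rewrite /taylor_rem /count_shift.
  have -> : \sum_l (V1 a i - W1 i) 0 l * dg l (W1 i) (W2 i) =
     - \sum_l (W1 i - V1 a i) 0 l * dg l (W1 i) (W2 i).
    by rewrite -sumrN; apply: eq_bigr => l _; rewrite -mulNr -opprB mxE.
  ring.
rewrite mulrDr mulrBr mulr_sumr.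
have -> : \sum_l (s j * s l)^-1 * cov_defect (dg l) j l =
    \sum_l (s j * s l)^-1 * E (fun i => X j l i) *
       E (fun i => dg l (W1 i) (W2 i)) -
    \sum_l (s j)^-1 * ((s l)^-1 * E (fun i => X j l i * dg l (W1 i) (W2 i))).
  rewrite -sumrB; apply: eq_bigr => l _.
  by rewrite /cov_defect mulrBr !mulrA invfM.
ring.
Qed.

(** Size-biasing evaluates the first product at (V1, V2); the path to (W1, W2 - e_k) passes through
    (W1, V2). The factor 1 * fits [le_norm_sum_fexp_wsum]. *)
Lemma fexp_stein_count G (k : 'I_r) :
  E (fun i => (W2 i k)%:R) * E (fun i => G (W1 i) (W2 i))
  - E (fun i => (W2 i k)%:R * G (W1 i) (decr (W2 i) k)) =
  1 * (\sum_(a | cls a == inr k) E (fun i => b2r (I a i) * location_shift G a i))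
  + \sum_(a | cls a == inr k) E (fun i => b2r (I a i) * removal_shift G k a i).
Proof.
rewrite fexp_countW_cst_mul fexp_countW_mul mul1r -sumrB -big_split/=.
apply: eq_bigr => a _; rewrite -fexpB -fexpD; apply: eq_fexp => i.
rewrite /location_shift /removal_shift -mulrBr -mulrDr; congr (_ * _).
by rewrite addrA addrNK.
Qed.

Variables (Sigma : 'M[R]_d) (lam : 'I_r -> R) (h : 'rV[R]_d -> ('I_r -> nat) -> R).
Hypothesis SigmaE : forall j k, Sigma j k =
  E (fun i => (W1 i 0 j - E (fun i => W1 i 0 j)) * (W1 i 0 k - E (fun i => W1 i 0 k))).
Hypothesis lamE : forall k, lam k = E (fun i => (W2 i k)%:R).
Hypothesis lam_gt0 : forall k, 0 < lam k.
Hypothesis hH3 : H3 h.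
Local Notation f := (fh Sigma lam h).

(** A covariance form is the mean of a square, so a factor exists and the choice in [sqrtmx] does
    not fall back on its default 0. *)
Lemma cov_gram : (sqrtmx Sigma)^T *m sqrtmx Sigma = Sigma.
Proof.
have [A HA] : exists A : 'M[R]_d, A^T *m A = Sigma.
  apply: psd_gram.
    apply/matrixP => j k; rewrite mxE !SigmaE; apply: eq_fexp => i.
    by rewrite mulrC.
  move=> u; pose Z i := \sum_j u 0 j * (W1 i 0 j - E (fun i => W1 i 0 j)).
  have -> : (u *m Sigma *m u^T) 0 0 = E (fun i => Z i ^+ 2).
    rewrite mxE.
    under eq_bigr do rewrite !mxE mulr_suml.
    rewrite exchange_big/=.
    transitivity (E (fun i => \sum_(j < d) \sum_(k < d) u 0 j * u 0 k *
       ((W1 i 0 j - E (fun i => W1 i 0 j)) * (W1 i 0 k - E (fun i => W1 i 0 k))))).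
      rewrite fexp_sum; apply: eq_bigr => j _; rewrite fexp_sum; apply: eq_bigr => k _.
      by rewrite fexpZ -SigmaE; ring.
    apply: eq_fexp => i; rewrite expr2 mulr_suml; apply: eq_bigr => j _.
    by rewrite mulr_sumr; apply: eq_bigr => k _; ring.
  by apply: fexp_ge0 => // i; exact: sqr_ge0.
exact: (@xgetPex _ 0 [set A : 'M[R]_d | A^T *m A = Sigma] (ex_intro _ A HA)).
Qed.

Let lam_ge0 k : 0 <= lam k. Proof. exact: ltW. Qed.

Lemma fexp_stein :
  E (fun i => h (W1 i) (W2 i)) - EhZN Sigma lam h =
  \sum_j \sum_l (s j * s l)^-1 * cov_defect (pdx l (pdx j f)) j l
  + \sum_j (s j)^-1 * (\sum_(a | cls a == inl j) E (fun i => b2r (I a i) * taylor_rem (pdx j f) (fun l => pdx l (pdx j f)) a i))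
  - \sum_j (s j)^-1 * (\sum_(a | cls a == inl j) E (fun i => b2r (I a i) * count_shift (pdx j f) a i))
  + (2 * (\sum_k 1 * (\sum_(a | cls a == inr k) E (fun i => b2r (I a i) * location_shift (Dk k f) a i)))
  + 2 * (\sum_k \sum_(a | cls a == inr k) E (fun i => b2r (I a i) * removal_shift (Dk k f) k a i))).
Proof.
rewrite -{1}(fexp_cst mu_sum1 (EhZN Sigma lam h)) -fexpB.
transitivity (E (fun i => \sum_(j < d)
    (\sum_(l < d) Sigma j l * pdx l (pdx j f) (W1 i) (W2 i)
      - W1 i 0 j * pdx j f (W1 i) (W2 i))
    + 2 * \sum_k (lam k * Dk k f (W1 i) (W2 i)
      - (W2 i k)%:R * Dk k f (W1 i) (decr (W2 i) k)))).
  apply: eq_fexp => i.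
  by rewrite sumrB; exact: (esym (stein_equation lam_ge0 cov_gram (W1 i) (W2 i) hH3)).
have SE j l : Sigma j l = (s j * s l)^-1 * E (fun i => X j l i).
  by rewrite SigmaE fexp_normW_normW.
rewrite fexpD; congr (_ + _).
  rewrite -sumrN -!big_split/= fexp_sum; apply: eq_bigr => j _.
  rewrite fexpB fexp_sum.
  apply: etrans (fexp_stein_coord (pdx j f) (fun l => pdx l (pdx j f)) j).
  by congr (_ - _); apply: eq_bigr => l _; rewrite fexpZ SE.
rewrite fexpZ -mulrDr -big_split/= fexp_sum; congr (2 * _); apply: eq_bigr => k _.
apply: etrans (fexp_stein_count (Dk k f) k).
by rewrite fexpB fexpZ lamE.
Qed.

(** * Bounds on the individual terms *)

Lemma cov_defect_le g (S : \bar R) c (Y : Om -> R) (j l : 'I_d) :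
  0 <= c -> (forall x y, (`|g x y|)%:E <= S)%E ->
  (forall G, E (fun i => X j l i * G (W1 i) (W2 i)) =
             E (fun i => Y i * G (W1 i) (W2 i))) ->
  ((`|c * cov_defect g j l|)%:E <=
     S * (c * Num.sqrt (E (fun i => (Y i - E Y) ^+ 2)))%:E)%E.
Proof.
move=> c0 HS tower.
(* The last hypothesis makes Y a version of E[X | W]. Taking the test function 1 in it shows that X
   and Y have the same mean. *)
have -> : cov_defect g j l = - E (fun i => (Y i - E Y) * g (W1 i) (W2 i)).
  rewrite /cov_defect tower.
  have -> : E (fun i => X j l i) = E Y.
    have m1 Z : E (fun i => Z i * 1) = E Z by apply: eq_fexp => i; rewrite mulr1.
    by have := tower (fun _ _ => 1); rewrite !m1.
  apply: oppr_inj; rewrite opprB opprK -fexpZ -fexpB; apply: eq_fexp => i.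
  by rewrite mulrBl.
have S0 : (0 <= S)%E by apply: le_trans (HS 0 (fun=> 0%N)); rewrite lee_fin.
rewrite normrM normrN ger0_norm// !EFinM muleCA lee_wpmul2l ?lee_fin//.
have := @le_norm_fexp_wsum _ _ unit mu (fun i => (Y i - E Y) * g (W1 i) (W2 i))
  (fun=> S) (fun _ i => `|Y i - E Y|) mu_ge0 (fun=> S0) (fun _ _ => normr_ge0 _).
rewrite big_const card_unit/= adde0 => H.
apply: le_trans (H _) _ => [i|].
  rewrite big_const card_unit/= adde0 normrM EFinM muleC lee_wpmul2r ?lee_fin//.
by rewrite lee_wpmul2l// lee_fin; exact: fexp_norm_le_sqrt.
Qed.

Lemma taylor_rem_le g dg (ddg : 'I_d -> 'I_d -> 'rV[R]_d -> ('I_r -> nat) -> R)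
    (S : 'I_d -> 'I_d -> \bar R) (j : 'I_d) :
  (forall x v y, is_derive x v (g^~ y) (\sum_k v 0 k * dg k x y)) ->
  (forall k x v y, is_derive x v (dg k ^~ y) (\sum_l v 0 l * ddg k l x y)) ->
  (forall k l, 0 <= S k l)%E -> (forall k l x y, (`|ddg k l x y|)%:E <= S k l)%E ->
  ((`|(s j)^-1 * \sum_(a | cls a == inl j)
      E (fun i => b2r (I a i) * taylor_rem g dg a i)|)%:E <=
   (2^-1)%:E * \sum_k \sum_l S k l * ((s j * s k * s l)^-1 *
     \sum_(a | cls a == inl j) E (fun i => `|b2r (I a i) *
       (\sum_(b | cls b == inl k) D a b i) * (\sum_(b | cls b == inl l) D a b i)|))%:E)%E.
Proof.
move=> Hg Hdg S0 HS.
have s0 k : 0 <= (s k)^-1 by rewrite invr_ge0 ltW.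
pose V a k i := (V1 a i - W1 i) 0 k.
pose Sp (t : 'I_d * 'I_d) := S t.1 t.2.
pose yp a (t : 'I_d * 'I_d) i := `|V a t.1 i * V a t.2 i|.
have H := @le_norm_sum_fexp_wsum _ _ _ mu I mu_ge0 _ (fun a => cls a == inl j) (s j)^-1
  (fun a i => 2 * taylor_rem g dg a i) Sp yp (s0 j) (fun t => S0 _ _) (fun _ _ _ => normr_ge0 _).
have /H{}H a i : cls a == inl j -> I a i ->
    ((`|2 * taylor_rem g dg a i|)%:E <= \sum_t Sp t * (yp a t i)%:E)%E.
  move=> _ _; rewrite normrM ger0_norm// -(pair_bigA _ (fun k l => S k l * (`|V a k i * V a l i|)%:E)%E)/=.
  have := @taylor2_le _ _ (g^~ (W2 i)) (fun k x => dg k x (W2 i)) (fun k l x => ddg k l x (W2 i)) S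
    (fun x v => Hg x v _) (fun k x v => Hdg k x v _) S0 (fun k l x => HS k l x _)
    (W1 i) (V1 a i - W1 i).
  by rewrite [W1 i + _]addrC subrK.
(* Brings in the 2 that [taylor2_le] has on its left side. *)
have -> : (s j)^-1 * \sum_(a | cls a == inl j)
      E (fun i => b2r (I a i) * taylor_rem g dg a i) =
    2^-1 * ((s j)^-1 * \sum_(a | cls a == inl j)
      E (fun i => b2r (I a i) * (2 * taylor_rem g dg a i))).
  rewrite mulrCA; congr (_ * _); rewrite mulr_sumr; apply: eq_bigr => a _.
  by rewrite -fexpZ; apply: eq_fexp => i; field.
rewrite normrM ger0_norm// EFinM lee_wpmul2l ?lee_fin//.
apply: (le_trans H); rewrite -(pair_bigA _ (fun k l => S k l * ((s j)^-1 *
  \sum_(a | cls a == inl j) E (fun i => b2r (I a i) * `|V a k i * V a l i|))%:E)%E)/=.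
apply: lee_sum => k _; apply: lee_sum => l _.
rewrite le_eqVlt; apply/orP; left; apply/eqP; congr (_ * _%:E)%E.
rewrite !invfM -!mulrA; congr (_ * _); rewrite !mulr_sumr; apply: eq_bigr => a _.
rewrite -!fexpZ; apply: eq_fexp => i.
rewrite /V -!(opprB (W1 i)) !mxE.
have := normWB a i k; rewrite !mxE => ->; have := normWB a i l; rewrite !mxE => ->.
rewrite !normrM !normrN !normrM !(ger0_norm (s0 _)) (ger0_norm (b2r_ge0 _)).
by ring.
Qed.

Lemma count_shift_le g (S : 'I_r -> \bar R) (j : 'I_d) :
  (forall k, 0 <= S k)%E -> (forall k x y, (`|Dk k g x y|)%:E <= S k)%E ->
  ((`|(s j)^-1 * \sum_(a | cls a == inl j)
      E (fun i => b2r (I a i) * count_shift g a i)|)%:E <=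
   \sum_k S k * ((s j)^-1 * \sum_(a | cls a == inl j)
     E (fun i => `|b2r (I a i) * \sum_(b | cls b == inr k) D a b i|))%:E)%E.
Proof.
move=> S0 HS; have s0 k : 0 <= (s k)^-1 by rewrite invr_ge0 ltW.
have H := @le_norm_sum_fexp_wsum _ _ _ mu I mu_ge0 _ (fun a => cls a == inl j) (s j)^-1
  (fun a i => count_shift g a i) S (fun a k i => `|\sum_(b | cls b == inr k) D a b i|)
  (s0 j) S0 (fun _ _ _ => normr_ge0 _).
apply: (le_trans (H _)) => [a i _ _|].
  have := @nat_increment_le _ _ (g (V1 a i)) S S0 (fun k y => HS k _ y) (W2 i) (V2 a i).
  by under eq_bigr do rewrite countWB.
apply: lee_sum => k _; rewrite le_eqVlt; apply/orP; left; apply/eqP.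
congr (_ * (_ * _)%:E)%E; apply: eq_bigr => a _; apply: eq_fexp => i.
by rewrite normrM ger0_norm// b2r_ge0.
Qed.

Lemma location_shift_le G dG (S : 'I_d -> \bar R) (k : 'I_r) :
  (forall x v y, is_derive x v (G^~ y) (\sum_j v 0 j * dG j x y)) ->
  (forall j, 0 <= S j)%E -> (forall j x y, (`|dG j x y|)%:E <= S j)%E ->
  ((`|1 * \sum_(a | cls a == inr k)
      E (fun i => b2r (I a i) * location_shift G a i)|)%:E <=
   \sum_j S j * ((s j)^-1 * \sum_(a | cls a == inr k)
     E (fun i => `|b2r (I a i) * \sum_(b | cls b == inl j) D a b i|))%:E)%E.
Proof.
move=> HG S0 HS; have s0 j : 0 <= (s j)^-1 by rewrite invr_ge0 ltW.
have H := @le_norm_sum_fexp_wsum _ _ _ mu I mu_ge0 _ (fun a => cls a == inr k) 1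
  (fun a i => location_shift G a i) S (fun a j i => `|(V1 a i - W1 i) 0 j|)
  ler01 S0 (fun _ _ _ => normr_ge0 _).
apply: (le_trans (H _)) => [a i _ _|].
  have := @line_increment_le _ _ (G^~ (V2 a i)) (fun j x => dG j x (V2 a i)) S
    (fun x v => HG x v _) S0 (fun j x => HS j x _) (W1 i) (V1 a i - W1 i).
  by rewrite [W1 i + _]addrC subrK.
apply: lee_sum => j _; rewrite le_eqVlt; apply/orP; left; apply/eqP.
congr (_ * _%:E)%E; rewrite mul1r mulr_sumr; apply: eq_bigr => a _.
rewrite -fexpZ; apply: eq_fexp => i.
rewrite -(opprB (W1 i)) mxE normWB normrN !normrM (ger0_norm (s0 _)) (ger0_norm (b2r_ge0 _)).
by rewrite mulrCA.
Qed.

Local Notation inr_cls a := (if cls a is inr _ then true else false).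

Lemma sum_inr_cls (Q : pred Gam) (F : Gam -> R) :
  \sum_(b | inr_cls b && Q b) F b = \sum_m \sum_(b | (cls b == inr m) && Q b) F b.
Proof.
under [RHS]eq_bigr do rewrite big_mkcond; rewrite exchange_big big_mkcond/=.
apply: eq_bigr => b _; case: (cls b) => [j|k] /=.
  by rewrite big1.
rewrite (bigD1 k)//= eqxx big1 ?addr0//= => m mk.
by rewrite (_ : (_ == _) = false)//; apply/negbTE; apply: contra mk => /eqP[->].
Qed.

(** Since I_a = 1, removing one point from count k removes alpha itself. Its share of the distance
    is then J_aa, whose product with I_a has mean p_a^2. *)
Lemma removal_dist_le a i k : cls a == inr k -> I a i ->
  \sum_m `|(V2 a i m)%:R - (decr (W2 i) k m)%:R| <=
  b2r (J a a i) + \sum_(b | inr_cls b && (b != a)) `|D a b i|.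
Proof.
move=> ak Ia; rewrite sum_inr_cls.
have -> : b2r (J a a i) = \sum_m (m == k)%:R * b2r (J a a i) :> R.
  rewrite (bigD1 k)//= eqxx mul1r big1 ?addr0// => m /negbTE->.
  by rewrite mul0r.
rewrite -big_split/=; apply: ler_sum => m _.
have -> : (V2 a i m)%:R - (decr (W2 i) k m)%:R = (m == k)%:R * b2r (J a a i) -
    \sum_(b | (cls b == inr m) && (b != a)) D a b i :> R.
  have dE : (decr (W2 i) k m)%:R = (W2 i m)%:R - (m == k)%:R :> R.
    rewrite /decr natrB//; case: eqVneq => [->|]//=.
    by rewrite /countW (bigD1 a)//= Ia.
  rewrite dE; have := countWB a i m.
  have [mk|mk] := eqVneq m k.
    rewrite mk (bigD1 a)//= {1}Ia => e; rewrite mul1r.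
    have b1 : b2r true = 1 :> R by [].
    by move: e; rewrite b1 => e; lra.
  rewrite mul0r sub0r.
  rewrite (eq_bigl (fun b => (cls b == inr m) && (b != a))) => [<-|b].
    by rewrite [false%:R]mulr0n subr0 opprB.
  have [->|] := eqVneq b a; last by rewrite andbT.
  rewrite andbF (eqP ak); apply/negbTE; apply: contra mk => /eqP[->].
  by [].
apply: (le_trans (ler_normB _ _)); rewrite lerD ?ler_norm_sum//.
by rewrite ger0_norm// mulr_ge0 ?b2r_ge0.
Qed.

Lemma removal_shift_le (G : 'I_r -> 'rV[R]_d -> ('I_r -> nat) -> R) (M : \bar R) :
  (0 <= M)%E -> (forall m k x y, (`|Dk m (G k) x y|)%:E <= M)%E ->
  ((`|\sum_k \sum_(a | cls a == inr k)
      E (fun i => b2r (I a i) * removal_shift (G k) k a i)|)%:E <=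
   M * (\sum_(a | inr_cls a) p a ^+ 2
        + \sum_(a | inr_cls a) \sum_(b | inr_cls b && (b != a))
             E (fun i => b2r (I a i) * `|D a b i|))%:E)%E.
Proof.
move=> M0 HM.
pose Z a i := if cls a is inr k then removal_shift (G k) k a i else 0.
pose q a i := b2r (J a a i) + \sum_(b | inr_cls b && (b != a)) `|D a b i|.
have q0 a i : 0 <= q a i by rewrite addr_ge0 ?b2r_ge0 ?sumr_ge0.
have -> : \sum_k \sum_(a | cls a == inr k)
      E (fun i => b2r (I a i) * removal_shift (G k) k a i) =
    1 * \sum_(a | inr_cls a) E (fun i => b2r (I a i) * Z a i).
  rewrite mul1r (eq_bigl (fun a => inr_cls a && predT a)); last first.
    by move=> a; rewrite andbT.
  rewrite sum_inr_cls; apply: eq_bigr => k _.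
  apply: eq_big => [a|a /eqP ak]; first by rewrite andbT.
  by apply: eq_fexp => i; rewrite /Z ak.
have H := @le_norm_sum_fexp_wsum _ _ _ mu I mu_ge0 unit (fun a => inr_cls a) 1
  Z (fun=> M) (fun a _ i => q a i) ler01 (fun=> M0) (fun a _ => q0 a).
apply: (le_trans (H _)) => [a i|].
  rewrite /Z; case ak : (cls a) => [//|k] _ Ia.
  have le1 := @nat_increment_le _ _ (G k (W1 i)) (fun=> M) (fun=> M0)
    (fun m y => HM m k _ y) (V2 a i) (decr (W2 i) k).
  apply: (le_trans le1); rewrite big_const card_unit/= adde0.
  rewrite -ge0_sume_distrr//.
  rewrite lee_wpmul2l// sumEFin lee_fin; apply: removal_dist_le => //.
  by rewrite ak.
rewrite big_const card_unit/= adde0 lee_wpmul2l// lee_fin mul1r -big_split/=.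
apply: ler_sum => a _; rewrite le_eqVlt; apply/orP; left; apply/eqP.
(* The coupling with the coordinate a as test function gives p_a^2 = E[I_a J_aa]. *)
rewrite expr2 !pE -(fexp_coupling law a (fun u => b2r (u a))).
rewrite -fexp_sum -fexpD; apply: eq_fexp => i.
by rewrite /q mulrDr mulr_sumr.
Qed.

Lemma cov_term_le (vr : 'I_d -> 'I_d -> R) :
  (forall j l, exists2 Y : Om -> R, vr j l = E (fun i => (Y i - E Y) ^+ 2) &
    forall G, E (fun i => X j l i * G (W1 i) (W2 i)) =
              E (fun i => Y i * G (W1 i) (W2 i))) ->
  ((`|\sum_j \sum_l (s j * s l)^-1 * cov_defect (pdx l (pdx j f)) j l|)%:E <=
   \sum_(j < d) \sum_(k < d)
        supn (pdx j (pdx k f)) * ((s j * s k)^-1 * Num.sqrt (vr j k))%:E)%E.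
Proof.
move=> Hvr; apply: le_norm_sum_ereal => j; apply: le_norm_sum_ereal => l.
have [Y -> tower] := Hvr j l.
rewrite (fh_pdxC lam_ge0 cov_gram j l hH3).
apply: (@cov_defect_le (pdx l (pdx j f)) (supn (pdx l (pdx j f))) _ Y j l _ (@le_supn _ _ _ _) tower).
by rewrite invr_ge0 mulr_ge0// ltW.
Qed.

Lemma taylor_term_le :
  ((`|\sum_j (s j)^-1 * \sum_(a | cls a == inl j)
      E (fun i => b2r (I a i) * taylor_rem (pdx j f) (fun l => pdx l (pdx j f)) a i)|)%:E <=
   (2^-1)%:E * \sum_(j < d) \sum_(k < d) \sum_(l < d)
        supn (pdx j (pdx k (pdx l f))) *
        ((s j * s k * s l)^-1 * \sum_(a | cls a == inl j) E (fun i => `|b2r (I a i) *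
       (\sum_(b | cls b == inl k) D a b i) * (\sum_(b | cls b == inl l) D a b i)|))%:E)%E.
Proof.
rewrite ge0_sume_distrr; last first.
  move=> j _; apply: sume_ge0 => k _; apply: sume_ge0 => l _.
  apply: mule_ge0; first exact: supn_ge0.
  rewrite lee_fin; apply: mulr_ge0.
    by rewrite invr_ge0; do ?apply: mulr_ge0; exact: ltW.
  by apply: sumr_ge0 => a _; exact: fexp_ge0.
apply: le_norm_sum_ereal => j.
apply: (@taylor_rem_le (pdx j f) (fun k => pdx k (pdx j f))
    (fun k l => pdx l (pdx k (pdx j f))) (fun k l => supn (pdx j (pdx k (pdx l f)))) j
    (fun x v y => fh_line2 lam_ge0 cov_gram j v x y hH3)
    (fun k x v y => fh_line3 lam_ge0 cov_gram j k v x y hH3)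
    (fun k l => supn_ge0 _)) => k l x y.
by rewrite (fh_pdx3C lam_ge0 cov_gram j k l hH3); exact: le_supn.
Qed.

Lemma count_term_le :
  ((`|\sum_j (s j)^-1 * \sum_(a | cls a == inl j)
      E (fun i => b2r (I a i) * count_shift (pdx j f) a i)|)%:E <=
   \sum_(j < d) \sum_(k < r) supn (Dk k (pdx j f)) *
        ((s j)^-1 * \sum_(a | cls a == inl j)
          E (fun i => `|b2r (I a i) * \sum_(b | cls b == inr k) D a b i|))%:E)%E.
Proof.
apply: le_norm_sum_ereal => j.
exact: (@count_shift_le (pdx j f) (fun k => supn (Dk k (pdx j f))) j
  (fun k => supn_ge0 _) (fun k => @le_supn _ _ _ _)).
Qed.

Lemma location_term_le :
  ((`|\sum_k 1 * \sum_(a | cls a == inr k)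
      E (fun i => b2r (I a i) * location_shift (Dk k f) a i)|)%:E <=
   \sum_(k < r) \sum_(j < d) supn (Dk k (pdx j f)) *
        ((s j)^-1 * \sum_(a | cls a == inr k)
          E (fun i => `|b2r (I a i) * \sum_(b | cls b == inl j) D a b i|))%:E)%E.
Proof.
apply: le_norm_sum_ereal => k.
have dG x v y : is_derive x v ((Dk k f)^~ y) (\sum_j v 0 j * Dk k (pdx j f) x y).
  have := is_deriveB (fh_line1 lam_ge0 cov_gram v x (incr y k) hH3)
      (fh_line1 lam_ge0 cov_gram v x y hH3).
  rewrite -sumrB (eq_bigr (fun j => v 0 j * Dk k (pdx j f) x y))//.
  by move=> j _; rewrite -mulrBr.
exact: (@location_shift_le (Dk k f) (fun j => Dk k (pdx j f))
    (fun j => supn (Dk k (pdx j f))) k dG (fun j => supn_ge0 _) (fun j => @le_supn _ _ _ _)).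
Qed.

Lemma removal_term_le :
  ((`|\sum_k \sum_(a | cls a == inr k)
      E (fun i => b2r (I a i) * removal_shift (Dk k f) k a i)|)%:E <=
   (\big[maxe/0%E]_(j < r) \big[maxe/0%E]_(k < r) supn (Dk j (Dk k f))) *
        (\sum_(a | inr_cls a) p a ^+ 2
         + \sum_(a | inr_cls a) \sum_(b | inr_cls b && (b != a))
             E (fun i => b2r (I a i) * `|D a b i|))%:E)%E.
Proof.
apply: (@removal_shift_le (fun k => Dk k f)) => [|m k x y].
  by apply: bigmax_ge_id.
apply: le_trans (le_supn (Dk m (Dk k f)) x y) _.
apply: le_trans (le_bigmax _ (fun m => \big[maxe/0%E]_(k < r) supn (Dk m (Dk k f))) m).
exact: (le_bigmax _ (fun k => supn (Dk m (Dk k f))) k).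
Qed.

(** The expectations are parameters constrained by equations: those over the original space then
    match by unification and are transferred to the finite space one by one. *)
Lemma size_bias_bound (eh : R) (vr : 'I_d -> 'I_d -> R)
    (q2 : 'I_d -> 'I_d -> 'I_d -> Gam -> R)
    (q3 : 'I_d -> 'I_r -> Gam -> R) (q4 : 'I_r -> 'I_d -> Gam -> R) (q5 : Gam -> Gam -> R) :
  eh = E (fun i => h (W1 i) (W2 i)) ->
  (forall j l, exists2 Y : Om -> R, vr j l = E (fun i => (Y i - E Y) ^+ 2) &
    forall G, E (fun i => X j l i * G (W1 i) (W2 i)) =
              E (fun i => Y i * G (W1 i) (W2 i))) ->
  (forall j k l a, q2 j k l a = E (fun i => `|b2r (I a i) *
       (\sum_(b | cls b == inl k) D a b i) * (\sum_(b | cls b == inl l) D a b i)|)) ->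
  (forall j k a, q3 j k a = E (fun i => `|b2r (I a i) * \sum_(b | cls b == inr k) D a b i|)) ->
  (forall k j a, q4 k j a = E (fun i => `|b2r (I a i) * \sum_(b | cls b == inl j) D a b i|)) ->
  (forall a b, q5 a b = E (fun i => b2r (I a i) * `|D a b i|)) ->
  ((`| eh - EhZN Sigma lam h |)%:E <=
     \sum_(j < d) \sum_(k < d)
        supn (pdx j (pdx k f)) * ((s j * s k)^-1 * Num.sqrt (vr j k))%:E
   + (2^-1)%:E * \sum_(j < d) \sum_(k < d) \sum_(l < d)
        supn (pdx j (pdx k (pdx l f))) *
        ((s j * s k * s l)^-1 * \sum_(a | cls a == inl j) q2 j k l a)%:E
   + \sum_(j < d) \sum_(k < r)
        supn (Dk k (pdx j f)) *
        ((s j)^-1 * \sum_(a | cls a == inl j) q3 j k a)%:E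
   + 2%:E * \sum_(k < r) \sum_(j < d)
        supn (Dk k (pdx j f)) *
        ((s j)^-1 * \sum_(a | cls a == inr k) q4 k j a)%:E
   + 2%:E * (\big[maxe/0%E]_(j < r) \big[maxe/0%E]_(k < r) supn (Dk j (Dk k f))) *
        (\sum_(a | inr_cls a) p a ^+ 2
         + \sum_(a | inr_cls a) \sum_(b | inr_cls b && (b != a)) q5 a b)%:E)%E.
Proof.
move=> -> Hvr Hq2 Hq3 Hq4 Hq5.
have {}Hq2 : q2 = fun j k l a => E (fun i => `|b2r (I a i) *
       (\sum_(b | cls b == inl k) D a b i) * (\sum_(b | cls b == inl l) D a b i)|).
  by do 4 apply/funext => ?; exact: Hq2.
have {}Hq3 : q3 = fun j k a => E (fun i => `|b2r (I a i) * \sum_(b | cls b == inr k) D a b i|).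
  by do 3 apply/funext => ?; exact: Hq3.
have {}Hq4 : q4 = fun k j a => E (fun i => `|b2r (I a i) * \sum_(b | cls b == inl j) D a b i|).
  by do 3 apply/funext => ?; exact: Hq4.
have {}Hq5 : q5 = fun a b => E (fun i => b2r (I a i) * `|D a b i|).
  by do 2 apply/funext => ?; exact: Hq5.
subst q2 q3 q4 q5; rewrite fexp_stein -[(2%:E * _ * _)%E]muleA.
apply: le_norm_stein_terms.
- exact: cov_term_le.
- exact: taylor_term_le.
- exact: count_term_le.
- exact: location_term_le.
- exact: removal_term_le.
Qed.

End SizeBiasCoupling.

(** The averaging property of conditional expectation, by exchanging the two sums. Division by the
    mass of a level set is legitimate at atoms of positive mass, and null atoms contribute
    nothing. *)
Lemma fexp_tower {R : realType} {Om : finType} {K : Type} (mu X : Om -> R) (W : Om -> K)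
    (G : K -> R) : (forall i, 0 <= mu i) ->
  fexp mu (fun i => X i * G (W i)) =
  fexp mu (fun i => fexp mu (fun k => b2r `[< W k = W i >] * X k) /
                    fexp mu (fun k => b2r `[< W k = W i >]) * G (W i)).
Proof.
move=> mu0; pose c i := fexp mu (fun k => b2r `[< W k = W i >]).
transitivity (\sum_k mu k * X k * (\sum_i mu i * (b2r `[< W k = W i >] * (G (W i) / c i)))).
  apply: eq_bigr => k _; have [->|muk] := eqVneq (mu k) 0; first by rewrite !mul0r.
  have ck : c k != 0.
    rewrite gt_eqF// /c /fexp (bigD1 k)//= ltr_wpDr//.
      by apply: sumr_ge0 => i _; rewrite mulr_ge0// b2r_ge0.
    by rewrite asboolT// /b2r mulr1 lt_neqAle eq_sym muk mu0.
  rewrite -mulrA; congr (_ * (_ * _)).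
  rewrite (eq_bigr (fun i => mu i * b2r `[< W i = W k >] * (G (W k) / c k))).
    by rewrite -mulr_suml -/(fexp mu _) -/(c k) mulrC divfK.
  move=> i _; rewrite -mulrA; congr (_ * _).
  case: (pselect (W k = W i)) => [e|ne]; last first.
    by rewrite !asboolF ?mul0r// => /esym.
  by rewrite asboolT// asboolT// /c e.
rewrite /fexp; under eq_bigr do rewrite mulr_sumr.
rewrite exchange_big; apply: eq_bigr => i _ /=.
have -> (u v w z : R) : u * (v / w * z) = v * (u * (z / w)) by ring.
by rewrite mulr_suml; apply: eq_bigr => k _; rewrite -/(c i); ring.
Qed.

Lemma Ex_b2r {R : realType} {dT : measure_display} {T : measurableType dT}
    (P : probability T R) (B : T -> bool) : measurable [set w | B w] ->
  Ex P (fun w => b2r (B w)) = fine (P [set w | B w]).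
Proof.
move=> mB; rewrite /Ex (eq_integral (fun w => (\1_[set u | B u] w)%:E)) => [|w _].
  by rewrite integral_indic// setIT.
rewrite indicE /b2r; case: (boolP (B w)) => [Bw|nBw]; first by rewrite mem_set.
by rewrite memNset//=; apply/negP.
Qed.

(** * Reduction to a finite space *)

Section FiniteReduction.
Context {R : realType} {dT : measure_display} {T : measurableType dT}.
Variables (P : probability T R) (Om : finType) (V : T -> Om).
Set Implicit Arguments.
Unset Strict Implicit.
Hypothesis mV : forall v, measurable [set w | V w = v].

Lemma probability_inhabited : exists w : T, True.
Proof.
apply: contrapT => h; have : P setT = 0%E.
  rewrite (_ : setT = set0) ?measure0//; apply/seteqP; split => // w _.
  by apply: h; exists w.
by rewrite probability_setT => -[] /eqP; rewrite oner_eq0.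
Qed.

Definition fibre_mass (v : Om) : R := fine (P [set w | V w = v]).

(* Only fibres of positive mass matter, so an empty one may get any point. *)
Definition fibre_point (v : Om) : T :=
  xget (projT1 (cid probability_inhabited)) [set w | V w = v].

Lemma fibre_mass_ge0 v : 0 <= fibre_mass v.
Proof. exact: fine_ge0. Qed.

Lemma fibre_pointE w : V (fibre_point (V w)) = V w.
Proof. exact: (@xgetPex _ _ [set u | V u = V w] (ex_intro _ w erefl)). Qed.

(** Such an X is a finite combination of fibre indicators, with its values at the representatives as
    coefficients. *)
Lemma Ex_fibre (X : T -> R) : (forall w w', V w = V w' -> X w = X w') ->
  Ex P X = fexp fibre_mass (fun v => X (fibre_point v)).
Proof.
move=> XV; pose c v := X (fibre_point v).
have int v : P.-integrable setT (fun w => (c v)%:E * (\1_[set u | V u = v] w)%:E)%E.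
  apply: integrableZl => //; apply: integrable_indic => //.
rewrite /Ex; under eq_integral => w _.
  rewrite (_ : (X w)%:E = \sum_(v : Om) (c v)%:E * (\1_[set u | V u = v] w)%:E)%E.
    over.
  rewrite (bigD1 (V w))//= big1 ?adde0 => [|v vw].
    by rewrite indicE mem_set// mule1 /c; congr _%:E; apply: XV; rewrite fibre_pointE.
  by rewrite indicE memNset ?mule0//= => vE; rewrite -vE eqxx in vw.
rewrite integral_sum//.
rewrite (eq_bigr (fun v => (fibre_mass v * c v)%:E)) ?sumEFin// => v _.
rewrite integralZl//; last exact: integrable_indic.
by rewrite integral_indic// setIT muleC EFinM fineK// fin_num_measure.
Qed.

Lemma sum_fibre_mass : \sum_v fibre_mass v = 1.
Proof.
have := @Ex_fibre (fun=> 1) (fun _ _ _ => erefl).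
rewrite /fexp; under eq_bigr do rewrite mulr1; move=> <-.
by rewrite /Ex integral_cst//= mul1e probability_setT.
Qed.

Lemma measurable_fibre_union (A : set T) :
  (forall w w', V w = V w' -> A w -> A w') -> measurable A.
Proof.
move=> AV; rewrite (_ : A = \bigcup_(v in V @` A) [set w | V w = v]).
  by apply: fin_bigcup_measurable => //; exact: finite_finset.
apply/seteqP; split => [w Aw|w [v [u Au <-]] /= e]; first by exists (V w) => //; exists w.
exact: AV Au.
Qed.

Lemma condE_fibre {K : Type} (X : T -> R) (W : T -> K) w :
  (forall w w', V w = V w' -> X w = X w') -> (forall w w', V w = V w' -> W w = W w') ->
  condE P X W w =
  fexp fibre_mass (fun v => b2r `[< W (fibre_point v) = W w >] * X (fibre_point v)) /
  fexp fibre_mass (fun v => b2r `[< W (fibre_point v) = W w >]).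
Proof.
move=> XV WV; rewrite /condE; congr (_ / _).
  rewrite -(@Ex_fibre (fun u => b2r `[< W u = W w >] * X u)); last first.
    by move=> u u' e; rewrite (XV _ _ e) (WV _ _ e).
  rewrite /Ex integral_mkcond; congr fine; apply: eq_integral => u _.
  rewrite patchE; case: ifPn => [/set_mem/= Wu|/negP Wu].
    by rewrite asboolT// /b2r mul1r.
  by rewrite asboolF ?/b2r ?mul0r// => Wu'; apply: Wu; rewrite inE.
rewrite -(@Ex_fibre (fun u => b2r `[< W u = W w >])); last first.
  by move=> u u' e; rewrite (WV _ _ e).
have WE : [set u | `[< W u = W w >]] = [set u | W u = W w].
  by apply/seteqP; split => u /=; rewrite asboolE.
rewrite Ex_b2r /Prb WE//; apply: measurable_fibre_union => u u' e /=.
by rewrite (WV _ _ e).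
Qed.

End FiniteReduction.

(* Gamma = Gamma_1 (+) Gamma_2 with Gamma_1 = (+)_{j<d} Gamma_{1j} and
   Gamma_2 = (+)_{k<r} Gamma_{2k} is encoded by  cls : Gamma -> 'I_d + 'I_r
   (alpha in Gamma_{1j} iff cls alpha = inl j, alpha in Gamma_{2k} iff
   cls alpha = inr k).  J beta alpha is J_{beta alpha}. *)
Theorem theorem3p1 (R : realType) (dT : measure_display) (T : measurableType dT)
    (P : probability T R) (Gam : finType) (d r : nat)
    (cls : Gam -> 'I_d + 'I_r)
    (I : Gam -> T -> bool) (J : Gam -> Gam -> T -> bool)
    (s : 'I_d -> R)
    (h : 'rV[R]_d -> ('I_r -> nat) -> R) :
  (forall a, measurable [set w | I a w]) ->
  (forall b a, measurable [set w | J b a w]) ->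
  (* L(J_{beta alpha}, beta in Gamma | I_alpha = 1) = L(I_beta, beta in Gamma) *)
  (forall (a : Gam) (v : Gam -> bool),
      (P [set w | I a w /\ forall b, J b a w = v b]
       = P [set w | I a w] * P [set w | forall b, I b w = v b])%E) ->
  (forall j, 0 < s j) ->
  let p := fun a => Ex P (fun w => b2r (I a w)) in
  let W1 := fun w => \row_(j < d)
      ((s j)^-1 * \sum_(a | cls a == inl j) (b2r (I a w) - p a)) in
  let W2 := fun w (k : 'I_r) => (\sum_(a | cls a == inr k) (I a w : nat))%N in
  let Sigma := \matrix_(j < d, k < d)
      Cov P (fun w => W1 w 0 j) (fun w => W1 w 0 k) in
  let lam := fun k => Ex P (fun w => ((W2 w k)%:R : R)) in
  (forall k, 0 < lam k) ->
  H3 h ->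
  let f := fh Sigma lam h in
  let D := fun a b w => b2r (I b w) - b2r (J b a w) in  (* I_b - J_{b a} *)
  let inG2 := fun a => if cls a is inr _ then true else false in
  let X := fun j k w => \sum_(a | cls a == inl j)
      (b2r (I a w) * \sum_(b | cls b == inl k) D a b w) in
  ((`| Ex P (fun w => h (W1 w) (W2 w)) - EhZN Sigma lam h |)%:E <=
     \sum_(j < d) \sum_(k < d)
        supn (pdx j (pdx k f)) *
        ((s j * s k)^-1 *
         Num.sqrt (Var P (condE P (X j k) (fun w => (W1 w, W2 w)))))%:E
   + (2^-1)%:E * \sum_(j < d) \sum_(k < d) \sum_(l < d)
        supn (pdx j (pdx k (pdx l f))) *
        ((s j * s k * s l)^-1 *
         \sum_(a | cls a == inl j)
           Ex P (fun w => `| b2r (I a w)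
                             * (\sum_(b | cls b == inl k) D a b w)
                             * (\sum_(c | cls c == inl l) D a c w) |))%:E
   + \sum_(j < d) \sum_(k < r)
        supn (Dk k (pdx j f)) *
        ((s j)^-1 *
         \sum_(a | cls a == inl j)
           Ex P (fun w => `| b2r (I a w) * \sum_(b | cls b == inr k) D a b w |))%:E
   + 2%:E * \sum_(k < r) \sum_(j < d)
        supn (Dk k (pdx j f)) *
        ((s j)^-1 *
         \sum_(a | cls a == inr k)
           Ex P (fun w => `| b2r (I a w) * \sum_(b | cls b == inl j) D a b w |))%:E
   + 2%:E * (\big[maxe/0%E]_(j < r) \big[maxe/0%E]_(k < r) supn (Dk j (Dk k f))) *
        (\sum_(a | inG2 a) p a ^+ 2
         + \sum_(a | inG2 a) \sum_(b | inG2 b && (b != a))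
             Ex P (fun w => b2r (I a w) * `| D a b w |))%:E)%E.
Proof.
move=> mI mJ Hlaw s_gt0 p W1 W2 Sigma lam lam_gt0 hH3; lazy zeta.
(* Joint configurations of all indicators I and J; every expectation in the bound depends on w
   through V w alone. *)
pose Om : finType := ({ffun Gam -> bool} * {ffun Gam * Gam -> bool})%type.
pose V w : Om := ([ffun a => I a w], [ffun q => J q.1 q.2 w]).
have meq (B : T -> bool) (c : bool) : measurable [set w | B w] ->
    measurable [set w | B w = c].
  case: c => // mB; rewrite (_ : [set w | _] = ~` [set w | B w]).
    exact: measurableC.
  by apply/seteqP; split => w /=; [move=> ->|move/negP/negbTE].
have mV v : measurable [set w | V w = v].
  rewrite (_ : [set w | _] = (\bigcap_(a in [set: Gam]) [set w | I a w = v.1 a]) `&`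
     (\bigcap_(q in [set: Gam * Gam]) [set w | J q.1 q.2 w = v.2 q])).
    apply: measurableI; apply: fin_bigcap_measurable; [exact: finite_finset| |exact: finite_finset|].
      by move=> a _; exact: meq.
    by move=> q _; exact: meq.
  apply/seteqP; split => w /=; first by move=> <-; split => q _ /=; rewrite ffunE.
  move=> [h1 h2]; case: v h1 h2 => v1 v2 /= h1 h2; congr (_, _); apply/ffunP => q.
    by rewrite ffunE; exact: h1.
  by rewrite ffunE; exact: h2.
pose pt := fibre_point P V; pose mu := fibre_mass P V.
pose I' a i := I a (pt i); pose J' b a i := J b a (pt i).
have VI (w w' : T) : V w = V w' -> (I^~ w = I^~ w') /\ ((fun b a => J b a w) = (fun b a => J b a w')).
  move=> [eI eJ]; split; first by apply/funext => a; have /ffunP/(_ a) := eI; rewrite !ffunE.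
  by apply/funext => b; apply/funext => a; have /ffunP/(_ (b, a)) := eJ; rewrite !ffunE.
have ExE (Phi : (Gam -> bool) -> (Gam -> Gam -> bool) -> R) :
    Ex P (fun w => Phi (I^~ w) (fun b a => J b a w)) =
    fexp mu (fun i => Phi (I'^~ i) (fun b a => J' b a i)).
  apply: (@Ex_fibre _ _ _ P Om V mV (fun w => Phi (I^~ w) (fun b a => J b a w))).
  by move=> w w' /VI[-> ->].
have mu_ge0 i : 0 <= mu i by exact: fibre_mass_ge0.
have mu_sum1 : \sum_i mu i = 1 by exact: sum_fibre_mass.
have pE a : p a = fexp mu (fun i => b2r (I' a i)) by exact: (ExE (fun u _ => b2r (u a))).
have mfin (B : Gam -> T -> bool) : (forall b, measurable [set w | B b w]) ->
    measurable [set w | [forall b, B b w]].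
  move=> mB; rewrite (_ : [set w | _] = \bigcap_(b in [set: Gam]) [set w | B b w]).
    by apply: fin_bigcap_measurable => //; exact: finite_finset.
  by apply/seteqP; split => w /= => [/forallP Bw b _|Bw]; [exact: Bw|apply/forallP => b; exact: Bw].
have meqb (B : T -> bool) c : measurable [set w | B w] -> measurable [set w | B w == c].
  move=> mB; rewrite (_ : [set w | _] = [set w | B w = c]); first exact: meq.
  by apply/seteqP; split => w /= /eqP.
have law a (v : Gam -> bool) :
    fexp mu (fun i => b2r (I' a i && [forall b, J' b a i == v b])) =
    fexp mu (fun i => b2r (I' a i)) * fexp mu (fun i => b2r [forall b, I' b i == v b]).
  rewrite -(ExE (fun u t => b2r (u a && [forall b, t b a == v b]))).
  rewrite -(ExE (fun u t => b2r (u a))) -(ExE (fun u t => b2r [forall b, u b == v b])).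
  have mv1 : measurable [set w | [forall b, J b a w == v b]].
    by apply: (mfin (fun b w => J b a w == v b)) => b; exact: meqb.
  have mv2 : measurable [set w | [forall b, I b w == v b]].
    by apply: (mfin (fun b w => I b w == v b)) => b; exact: meqb.
  have mv3 : measurable [set w | I a w && [forall b, J b a w == v b]].
    rewrite (_ : [set w | _] = [set w | I a w] `&` [set w | [forall b, J b a w == v b]]).
      exact: measurableI.
    by apply/seteqP; split => w /= => [/andP[]|[-> ->]].
  rewrite !Ex_b2r// -fineM ?fin_num_measure//; congr fine.
  have fE (g : Gam -> bool) : [forall b, g b == v b] = (forall b, g b = v b) :> Prop.
    by apply/propext; split => [/forallP gv b|gv]; [exact/eqP|apply/forallP => b; exact/eqP].
  rewrite (_ : [set w | [forall b, I b w == v b]] = [set w | forall b, I b w = v b]).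
    rewrite -Hlaw; congr (P _); apply/seteqP; split => w /=.
      by move=> /andP[Ia]; rewrite fE.
    by move=> [-> Jv]; rewrite fE.
  by apply/seteqP; split => w /=; rewrite fE.
have SigmaE j k : Sigma j k = fexp mu (fun i =>
    (normW cls s p (I'^~ i) 0 j - fexp mu (fun i => normW cls s p (I'^~ i) 0 j)) *
    (normW cls s p (I'^~ i) 0 k - fexp mu (fun i => normW cls s p (I'^~ i) 0 k))).
  rewrite mxE /Cov.
  rewrite -(ExE (fun u _ => normW cls s p u 0 j)) -(ExE (fun u _ => normW cls s p u 0 k)).
  exact: (ExE (fun u _ => (normW cls s p u 0 j - _) * (normW cls s p u 0 k - _))).
have lamE k : lam k = fexp mu (fun i => (countW cls (I'^~ i) k)%:R).
  exact: (ExE (fun u _ => (countW cls u k)%:R)).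
apply: (size_bias_bound mu_ge0 mu_sum1 pE law s_gt0 SigmaE lamE lam_gt0 hH3).
- exact: (ExE (fun u _ => h (normW cls s p u) (countW cls u))).
- move=> j l.
  pose WT (w : T) : 'rV[R]_d * ('I_r -> nat) := (normW cls s p (I^~ w), countW cls (I^~ w)).
  pose XT (w : T) : R := \sum_(a | cls a == inl j)
    (b2r (I a w) * \sum_(b | cls b == inl l) (b2r (I b w) - b2r (J b a w))).
  pose XP (u : Gam -> bool) (t : Gam -> Gam -> bool) : R := \sum_(a | cls a == inl j)
    (b2r (u a) * \sum_(b | cls b == inl l) (b2r (u b) - b2r (t b a))).
  have condEE w : condE P XT WT w =
      fexp mu (fun k => b2r `[< WT (pt k) = WT w >] * XT (pt k)) /
      fexp mu (fun k => b2r `[< WT (pt k) = WT w >]).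
    apply: (@condE_fibre _ _ _ P Om V mV) => u u' /VI[eI eJ].
      by rewrite -[LHS]/(XP (I^~ u) (fun b a => J b a u)) eI eJ.
    by rewrite /WT eI.
  (* The conditional expectation is itself constant on fibres, so its mean and variance also
     transfer. *)
  have condS (w w' : T) : V w = V w' -> condE P XT WT w = condE P XT WT w'.
    move=> /VI[e _]; have eW : WT w = WT w' by rewrite /WT e.
    by rewrite !condEE eW.
  exists (fun i => condE P XT WT (pt i)).
    have <- : Ex P (condE P XT WT) = fexp mu (fun i => condE P XT WT (pt i)).
      exact: (@Ex_fibre _ _ _ P Om V mV _ condS).
    apply: (@Ex_fibre _ _ _ P Om V mV (fun w => (condE P XT WT w - Ex P (condE P XT WT)) ^+ 2)).
    by move=> w w' /condS ->.
  move=> G.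
  have := fexp_tower (fun i => XT (pt i)) (fun i => WT (pt i)) (fun z => G z.1 z.2) mu_ge0.
  move=> /= e; rewrite [LHS]e; apply: eq_bigr => i _.
  by rewrite condEE.
- by move=> j k l a; exact: (ExE (fun u t => `|b2r (u a) *
   (\sum_(b | cls b == inl k) (b2r (u b) - b2r (t b a))) *
   (\sum_(c | cls c == inl l) (b2r (u c) - b2r (t c a)))|)).
- by move=> j k a; exact: (ExE (fun u t => `|b2r (u a) *
   (\sum_(b | cls b == inr k) (b2r (u b) - b2r (t b a)))|)).
- by move=> j k a; exact: (ExE (fun u t => `|b2r (u a) *
   (\sum_(b | cls b == inl k) (b2r (u b) - b2r (t b a)))|)).
- by move=> a b; exact: (ExE (fun u t => b2r (u a) * `|b2r (u b) - b2r (t b a)|)).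
Qed.
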